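(* Let $\xi_1,\xi_2,\ldots$ be i.i.d. random elements of $C(T)$, where $(T,\rho)$ is a compact metric space, and suppose Conditions (C1)–(C4) below hold. Fix $D\in\{1,2,\ldots\}$ and $M>0$. Then the semimetric space $(\mathcal{V},\rho_2)$ is totally bounded, there exists a version of the centered Gaussian process $W$ on $\mathcal{V}$ (defined in the context) almost all of whose sample paths are uniformly $\rho_2$-continuous, and $$W_n \rightsquigarrow W \quad\text{as } n\to\infty \text{ in } \ell^\infty(\mathcal{V}).$$
   Context: $C(T)$ is the space of continuous real functions on $T$ with the supremum norm and its Borel $\sigma$-field; $\ell^\infty(\mathcal{V})$ is the space of bounded real functions on $\mathcal{V}$ with the sup norm, and $\rightsquigarrow$ denotes weak convergence in the sense of Hoffmann-Jørgensen. Let $F_t(x)=\mathbb{P}\{\xi_1(t)\le x\}$ for $t\in T$, $x\in\mathbb{R}$. (C1) For every $t\in T$, $F_t$ is continuous. Put $U_i(t)=1-F_t(\xi_i(t))$; each $U_i(t)$ is uniform on $(0,1)$. (C2) $k=k_n\in(0,n]$ satisfies $k\to\infty$ and $k/n\to0$ as $n\to\infty$. (C3) For all $m=2,\ldots,2D$ and all $\mathbf{t}=(t_1,\ldots,t_m)\in T^m$, $\mathbf{x}\in[0,\infty)^m$, the limit $R_{\mathbf{t}}(\mathbf{x})=\lim_{s\downarrow0}s^{-1}\mathbb{P}\{U_1(t_1)\le sx_1,\ldots,U_1(t_m)\le sx_m\}$ exists. For $m=1$, $R_t(x)=x$. (C4) There exist positive $c_1,c_2,u_0,\varepsilon_0$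 and, for every $\varepsilon\in(0,\varepsilon_0]$, a covering $T=\bigcup_{j=1}^{N_{T,\varepsilon}}T_{\varepsilon,j}$ such that for all $u\in(0,u_0]$, $\varepsilon\in(0,\varepsilon_0]$, $j\in\{1,\ldots,N_{T,\varepsilon}\}$: $\mathbb{P}[\sup_{t\in T_{\varepsilon,j}}U_1(t)>u\exp(c_1\varepsilon^2)\mid \inf_{t\in T_{\varepsilon,j}}U_1(t)\le u]\le c_2\varepsilon^2$, and $\int_0^1\sqrt{\log N_{T,\varepsilon}}\,d\varepsilon<\infty$. Index set: $\mathcal{V}_d=T^d\times[0,M]^d$ for $d=1,\ldots,D$ and $\mathcal{V}=\bigcup_{d=1}^D\mathcal{V}_d$; elements are $\mathbf{v}=(\mathbf{t},\mathbf{x})$ with $\mathbf{t}\in T^d,\mathbf{x}\in[0,M]^d$. Define $G_{n,\mathbf{t}}(\mathbf{x})=\frac1k\sum_{i=1}^n\mathbb{1}\{\forall j\le d: U_i(t_j)<\frac kn x_j\}$, $E_{n,\mathbf{t}}(\mathbf{x})=\mathbb{E}[G_{n,\mathbf{t}}(\mathbf{x})]=\frac nk\mathbb{P}\{\forall j\le d:U_1(t_j)<\frac knx_j\}$, and the tail empirical process $W_n(\mathbf{v})=\sqrt k\{G_{n,\mathbf{t}}(\mathbf{x})-E_{n,\mathbf{t}}(\mathbf{x})\}$, $\mathbf{v}\in\mathcal{V}$. $W=(W(\mathbf{v}))_{\mathbf{v}\in\mathcal{V}}$ is a centered Gaussian process with covariance $\mathbb{E}[W(\mathbf{v}_1)W(\mathbf{v}_2)]=R_{\mathbf{t}_1,\mathbf{t}_2}(\mathbf{x}_1,\mathbf{x}_2)$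 for $\mathbf{v}_i=(\mathbf{t}_i,\mathbf{x}_i)\in\mathcal{V}_{d_i}$, where $(\mathbf{t}_1,\mathbf{t}_2)\in T^{d_1+d_2}$ and $(\mathbf{x}_1,\mathbf{x}_2)$ are concatenations. The standard deviation semimetric is $\rho_2(\mathbf{v}_1,\mathbf{v}_2)=(\mathbb{E}[\{W(\mathbf{v}_1)-W(\mathbf{v}_2)\}^2])^{1/2}=(R_{\mathbf{t}_1}(\mathbf{x}_1)-2R_{\mathbf{t}_1,\mathbf{t}_2}(\mathbf{x}_1,\mathbf{x}_2)+R_{\mathbf{t}_2}(\mathbf{x}_2))^{1/2}$. *)

(* Defs.v *)
From mathcomp Require Import all_boot all_order all_algebra.
From mathcomp Require Import all_classical all_reals all_analysis.
Set Implicit Arguments. Unset Strict Implicit. Unset Printing Implicit Defensive.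
Import Order.TTheory GRing.Theory Num.Theory.
Import numFieldNormedType.Exports.
Local Open Scope classical_set_scope.
Local Open Scope ring_scope.

Section Defs.
Context (R : realType).

Record vrec (T : Type) := VRec { vd : nat; vt : 'I_vd -> T; vx : 'I_vd -> R }.
Arguments vt {T} v _.
Arguments vx {T} v _.
Arguments vd {T} v.

Definition inV (T : Type) (D : nat) (M : R) (v : vrec T) : Prop :=
  (1 <= vd v <= D)%N /\ forall j, 0 <= vx v j <= M.

Definition Vt (T : Type) (D : nat) (M : R) := {v : vrec T | inV D M v}.

Definition catf (A : Type) m n (a : 'I_m -> A) (b : 'I_n -> A) : 'I_(m + n) -> A :=
  fun i => match fintype.split i with inl j => a j | inr j => b j end.

(* sigma-field on T -> R generated by the evaluation maps
   (for compact metric T this is the Borel sigma-field of C(T)) *)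
Definition evgen (T : Type) : set (set (T -> R)) :=
  [set A | exists t (B : set R), measurable B /\ A = (fun f => f t) @^-1` B].
Definition cylm (T : Type) : set (set (T -> R)) := smallest (sigma_algebra setT) (@evgen T).

Definition lbounded (I : Type) (f : I -> R) := exists C, forall i, `|f i| <= C.
Definition supdist (I : Type) (f g : I -> R) : R :=
  sup [set `|f i - g i| | i in [set: I]].
Definition lopen (I : Type) (O : set (I -> R)) :=
  (forall f, O f -> lbounded f) /\
  (forall f, O f -> exists2 e, 0 < e &
     forall g, lbounded g -> supdist f g < e -> O g).
Definition lcont (I : Type) (h : (I -> R) -> R) :=
  forall f, lbounded f -> forall e, 0 < e -> exists2 del, 0 < del &
     forall g, lbounded g -> supdist f g < del -> `|h f - h g| < e.
Definition lbddfun (I : Type) (h : (I -> R) -> R) :=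
  exists C, forall f, lbounded f -> `|h f| <= C.

Context {d : measure_display} {Om : measurableType d} (P : probability Om R).

Definition Fdist (X : Om -> R) (x : R) : R := fine (P [set w | X w <= x]).

(* U_i(t) = 1 - F_t(xi_i(t)), F_t the d.f. of xi_1(t) (= xi 0 here) *)
Definition Ufun (T : Type) (xi : nat -> Om -> T -> R) (i : nat) (w : Om) (t : T) : R :=
  1 - Fdist (fun w' => xi 0%N w' t) (xi i w t).

Definition Rfun (T : Type) (xi : nat -> Om -> T -> R) m (t : 'I_m -> T) (x : 'I_m -> R) : R :=
  lim ((fun s : R => s^-1 * fine (P [set w | forall j, Ufun xi 0 w (t j) <= s * x j]))
         @ 0^'+).

(* covariance E[W(v1)W(v2)] = R_{(t1,t2)}(x1,x2) *)
Definition Rcov (T : Type) (xi : nat -> Om -> T -> R) D M (v1 v2 : Vt T D M) : R :=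
  Rfun xi (catf (vt (sval v1)) (vt (sval v2))) (catf (vx (sval v1)) (vx (sval v2))).

Definition rho2 (T : Type) (xi : nat -> Om -> T -> R) D M (v1 v2 : Vt T D M) : R :=
  Num.sqrt (Rfun xi (vt (sval v1)) (vx (sval v1)) - 2 * Rcov xi v1 v2
            + Rfun xi (vt (sval v2)) (vx (sval v2))).

(* tail empirical process W_n(v) = sqrt k (G_{n,t}(x) - E_{n,t}(x));
   xi i (i = 0..n-1) stands for xi_{i+1} *)
Definition Wn (T : Type) (xi : nat -> Om -> T -> R) (k : nat -> R) D M (n : nat)
    (w : Om) (v : Vt T D M) : R :=
  let kn := k n in let v' := sval v in
  Num.sqrt kn *
  (kn^-1 * \sum_(i < n)
       (asbool (forall j, Ufun xi i w (vt v' j) < kn / n%:R * vx v' j))%:R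
   - n%:R / kn *
       fine (P [set w' | forall j, Ufun xi 0 w' (vt v' j) < kn / n%:R * vx v' j])).

Definition outexp (f : Om -> R) : \bar R :=
  ereal_inf [set (\int[P]_w (g w)%:E)%E | g in
     [set g : Om -> R | measurable_fun setT g /\ P.-integrable setT (EFin \o g)
                        /\ forall w, f w <= g w]].

End Defs.

(* Main.v *)
(** Put [sn = k n / n].  Then [Wn n] evaluated at [v] is the centred count,
    normalised by [(k n)^(-1/2)], of the indices [i] for which [U i] falls in the region of [v]
    scaled by [sn], and [rho2 v w ^+ 2] is the limit of [n / k n] times the probability
    of the symmetric difference of the regions of [v] and [w].  Condition (C4) encloses these
    regions, for every [q], between finitely many pairs of brackets of mass
    [O(4^-q) * k n / n], and the entropy integral makes [2^-q] times the square roots of the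
    log-cardinalities summable.  Chaining with Bernstein's inequality, stopped at the last
    level where its Gaussian regime applies (there the brackets absorb the remaining
    oscillation), shows that [Wn] is asymptotically equicontinuous for [rho2].
    The finite-dimensional characteristic functions converge by (C3).

    The limit is constructed on the same probability space: the i.i.d. uniform variables
    [U i t0] become i.i.d. normal variables through the normal quantile function, and a
    Cholesky factor of the covariance turns them into a Gaussian sequence indexed by a countable
    [rho2]-dense set.  Asymptotic equicontinuity passes to this sequence through convergence of
    finite-dimensional laws, so that it is almost surely uniformly continuous and extends by
    continuity.  Weak convergence is reduced to finitely many coordinates for Lipschitz
    functionals, and a continuous functional is squeezed between Lipschitz envelopes. *)

From HB Require Import structures.
From mathcomp.real_closed Require Import complex.
Require Import Defs.
From mathcomp Require Import all_boot all_order all_algebra.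
From mathcomp Require Import all_classical all_reals all_analysis.
From mathcomp Require Import measurable_realfun.
From mathcomp Require Import ring lra zify.
Set Implicit Arguments. Unset Strict Implicit. Unset Printing Implicit Defensive.
Import Order.TTheory GRing.Theory Num.Theory.
Import numFieldNormedType.Exports.
Local Open Scope classical_set_scope.
Local Open Scope ring_scope.

(** * Finite product laws and Bernstein's inequality *)

Import ComplexField.Normc.

(** Independence is used only through finite alphabets: [n] observations are reduced to finitely
    many indicator events, so that their joint law is a finite product law and expectations are the
    finite sums [prodE]. Variables that are not finite-valued, such as the normal ones, are reached
    as bounded limits.

    [Wn] need not be measurable as a map into the bounded functions. Every probabilistic estimate is
    therefore the bound of a measurable exceptional event, off which an inequality holds for all
    indices at once; suprema and infima over pieces of [T] become countable because [U i w] is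
    continuous in [t].

    Each observation moves the process by up to [(k n)^(-1/2)], which is not small compared with the
    deviations expected at fine scales. For fixed [n] the Gaussian regime thus breaks down at some
    level, which is what forces a stopping level depending on [n].

    The square of [rho2], as a limit of scaled probabilities of symmetric differences, satisfies the
    triangle inequality itself; it replaces [rho2] until the very end. *)

Section product_law.
Context {R : realType} {K : finType}.
Variable p : K -> R.

Definition prodE n (F : {ffun 'I_n -> K} -> R) : R :=
  \sum_(ka : {ffun 'I_n -> K}) F ka * \prod_i p (ka i).

Lemma prodE_prod n (f : 'I_n -> K -> R) :
  prodE (fun ka => \prod_i f i (ka i)) = \prod_i \sum_x f i x * p x.
Proof.
rewrite bigA_distr_bigA /=; apply: eq_bigr => ka _.
by rewrite -big_split.
Qed.

Lemma prodED n (F G : {ffun 'I_n -> K} -> R) :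
  prodE (fun ka => F ka + G ka) = prodE F + prodE G.
Proof.
by rewrite /prodE -big_split /=; apply: eq_bigr => ka _; rewrite mulrDl.
Qed.

Lemma prodEZ n (c : R) (F : {ffun 'I_n -> K} -> R) :
  prodE (fun ka => c * F ka) = c * prodE F.
Proof. by rewrite /prodE big_distrr /=; apply: eq_bigr => ka _; rewrite mulrA. Qed.

Hypothesis p0 : forall x, 0 <= p x.
Hypothesis p1 : \sum_x p x = 1.

Lemma prodE_le n (F G : {ffun 'I_n -> K} -> R) :
  (forall ka, F ka <= G ka) -> prodE F <= prodE G.
Proof.
move=> FG; apply: ler_sum => ka _; apply: ler_wpM2r => //.
by apply: prodr_ge0.
Qed.

(** From [exp (- y) >= 1 - y] follows [exp y * (1 - y) <= 1], while [(1 + y + 2 y^2) (1 - y) = 1 +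
    y^2 (1 - 2 y)] is at least 1 for [y <= 1/2]. *)
Lemma expR_sub_quad (y : R) : `|y| <= 1/2 -> expR y <= 1 + y + 2 * y ^+ 2.
Proof.
rewrite ler_norml => /andP[y1 y2].
have e1 := expR_ge1Dx (- y); rewrite expRN in e1.
have ey := expR_gt0 y.
have h : expR y * (1 - y) <= 1.
  by rewrite -[leRHS](mulfV (lt0r_neq0 ey)) ler_pM2l.
rewrite -(ler_pM2r (_ : 0 < 1 - y)); last lra.
apply: (le_trans h); nra.
Qed.

(** Chernoff's method with [s = lam / (4 V)], the minimiser of [- s lam + 2 s^2 V]. The condition
    [lam * b <= 2 * V] says precisely that [s * b <= 1/2], the range in which the exponential is
    bounded by its quadratic majorant. *)
Lemma bernstein_prod n (g : K -> R) (b V lam : R) :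
  (forall x, `|g x| <= b) -> \sum_x g x * p x = 0 ->
  n%:R * \sum_x g x ^+ 2 * p x <= V -> 0 < V -> 0 <= lam -> lam * b <= 2 * V ->
  prodE (fun ka : {ffun 'I_n -> K} => (lam <= `|\sum_i g (ka i)|)%R%:R)
    <= 2 * expR (- (lam ^+ 2 / (8 * V))).
Proof.
move=> gb g0 g2 V0 l0 lb.
pose s := lam / (4 * V).
have s0 : 0 <= s by rewrite /s divr_ge0 // mulr_ge0 // ltW.
have sb : s * b <= 1/2.
  rewrite /s mulrAC ler_pdivrMr ?mulr_gt0 //; lra.
have sE : s = lam / (4 * V) by [].
clearbody s.
(* The sign [t], with [t^2 = 1], treats the upper and the lower tail together. *)
have mgf (t : R) : t ^+ 2 = 1 -> prodE (fun ka : {ffun 'I_n -> K} => expR (s * t * \sum_i g (ka i)))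
    <= expR (2 * s ^+ 2 * V).
  move=> t2.
  have -> : prodE (fun ka : {ffun 'I_n -> K} => expR (s * t * \sum_i g (ka i)))
      = prodE (fun ka : {ffun 'I_n -> K} => \prod_i expR (s * t * g (ka i))).
    by congr prodE; apply/funext => ka; rewrite -expR_sum big_distrr.
  rewrite (prodE_prod (fun _ x => expR (s * t * g x))) prodr_const card_ord.
  have h : \sum_x expR (s * t * g x) * p x <= expR (2 * s ^+ 2 * \sum_x g x ^+ 2 * p x).
    apply: le_trans (expR_ge1Dx _).
    apply: (@le_trans _ _ (\sum_x (p x + s * t * (g x * p x) + 2 * s ^+ 2 * (g x ^+ 2 * p x)))).
      apply: ler_sum => x _.
      have := @expR_sub_quad (s * t * g x); rewrite !normrM (ger0_norm s0).
      have -> : `|t| = 1 by apply/eqP; rewrite -(@eqrXn2 _ 2) // ?expr1n ?real_normK ?num_real ?t2.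
      rewrite mulr1 => /(_ _)/(ler_wpM2r (p0 x)); rewrite !exprMn t2 => h.
      apply: le_trans (h _) _; last by lra.
      by apply: le_trans sb; apply: ler_wpM2l.
    rewrite !big_split /= p1 -!big_distrr /= g0; lra.
  apply: le_trans (_ : expR (2 * s ^+ 2 * \sum_x g x ^+ 2 * p x) ^+ n <= _).
    by apply: lerXn2r => //; rewrite nnegrE ?sumr_ge0// => *; rewrite ?mulr_ge0 ?expR_ge0.
  rewrite -expRM_natl ler_expR -mulr_natl.
  have := ler_wpM2l (_ : 0 <= 2 * s ^+ 2) g2; rewrite mulr_ge0 ?sqr_ge0// => /(_ isT); lra.
have ub (ka : {ffun 'I_n -> K}) : (lam <= `|\sum_i g (ka i)|)%R%:R <=
   expR (- (s * lam)) * expR (s * 1 * \sum_i g (ka i)) +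
   expR (- (s * lam)) * expR (s * (-1) * \sum_i g (ka i)).
  rewrite -!expRD; set S := \sum_i _.
  case: (boolP (lam <= _)) => h /=; last by rewrite addr_ge0 ?expR_ge0.
  have [S0|S0] := leP 0 S.
    rewrite ger0_norm // in h.
    have := expR_ge1Dx (- (s * lam) + s * 1 * S); have := expR_ge0 (- (s * lam) + s * -1 * S).
    have : s * lam <= s * S by apply: ler_wpM2l. lra.
  rewrite ltr0_norm // in h.
  have := expR_ge1Dx (- (s * lam) + s * (-1) * S); have := expR_ge0 (- (s * lam) + s * 1 * S).
  have : s * lam <= s * - S by apply: ler_wpM2l. lra.
apply: le_trans (prodE_le ub) _.
rewrite prodED !prodEZ -mulrDr.
have h1 := mgf 1 (expr1n _ _).
have h2 := mgf (-1) (etrans (sqrrN _) (expr1n _ _)).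
apply: le_trans (ler_wpM2l (expR_ge0 _) (lerD h1 h2)) _.
rewrite mulrDr -expRD.
have -> : - (s * lam) + 2 * s ^+ 2 * V = - (lam ^+ 2 / (8 * V)).
  by rewrite sE; field; rewrite gt_eqF.
lra.
Qed.

(** The expectation of [exp (i g)] under [p], a value of a characteristic function. *)
Definition cisE (g : K -> R) : R[i] :=
  Complex (\sum_x cos (g x) * p x) (\sum_x sin (g x) * p x).

Lemma sum_complex (I : finType) (f g : I -> R) :
  \sum_i Complex (f i) (g i) = Complex (\sum_i f i) (\sum_i g i).
Proof. by apply: (big_rec3 (fun a b c => a = Complex b c)) => // i a b c _ ->. Qed.

Lemma cis_prod n (u q : 'I_n -> R) :
  Complex (cos (\sum_i u i) * \prod_i q i) (sin (\sum_i u i) * \prod_i q i)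
  = \prod_i Complex (cos (u i) * q i) (sin (u i) * q i).
Proof.
apply: (big_rec3 (fun a b c => Complex (cos a * b) (sin a * b) = c)).
  by rewrite cos0 sin0 mul1r mul0r.
move=> i a b c _ <-; rewrite cosD sinD; apply/eqP; rewrite eq_complex /=.
by apply/andP; split; apply/eqP; ring.
Qed.

(** The exponential of a sum is a product, and distributing the product of sums over all words [ka]
    yields the product law. *)
Lemma prodE_cis n (f : 'I_n -> K -> R) :
  Complex (prodE (fun ka : {ffun 'I_n -> K} => cos (\sum_i f i (ka i))))
          (prodE (fun ka : {ffun 'I_n -> K} => sin (\sum_i f i (ka i))))
  = \prod_i cisE (f i).
Proof.
rewrite /prodE -sum_complex.
under [RHS]eq_bigr => i _ do rewrite /cisE -sum_complex.
rewrite bigA_distr_bigA; apply: eq_bigr => ka _ /=.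
exact: cis_prod.
Qed.

Lemma normc_cisE (g : K -> R) : normc (cisE g) <= 1.
Proof.
rewrite /cisE -sum_complex -p1.
apply: (big_rec2 (fun a b => normc a <= b)).
  by rewrite normc0.
move=> x a b _ h; apply: le_trans (le_normcD _ _) _.
apply: lerD => //=.
by rewrite !exprMn -mulrDl cos2Dsin2 mul1r sqrtr_sqr ger0_norm.
Qed.

(** Telescoping: factors are exchanged one at a time, each exchange costing [normc (z - w)] while
    the remaining factors stay in the unit disc. *)
Lemma normc_subX (z w : R[i]) n : normc z <= 1 ->
  normc w <= 1 ->
  normc (z ^+ n - w ^+ n) <= n%:R * normc (z - w).
Proof.
move=> z1 w1; elim: n => [|n ih].
  by rewrite !expr0 subrr normc0 mul0r.
have -> : z ^+ n.+1 - w ^+ n.+1 = z * (z ^+ n - w ^+ n) + (z - w) * w ^+ n.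
  by rewrite !exprS; ring.
apply: le_trans (le_normcD _ _) _; rewrite !normcM -natr1 mulrDl mul1r.
have n0 v : 0 <= normc v :> R by case: v => a b /=; apply: sqrtr_ge0.
have wn : normc (w ^+ n) <= 1.
  elim: n {ih} => [|n ih]; first by rewrite expr0 normc1.
  by rewrite exprS normcM mulr_ile1.
apply: lerD; last by rewrite ler_piMr.
by apply: le_trans ih; rewrite ler_piMl.
Qed.

(** The target is written as an [n]-th power [rho ^+ n], so that only one observation has to be
    compared with [rho], at the price of a factor [n]. *)
Lemma prodE_cis_approx n (g : K -> R) (rho : R) : 0 <= rho <= 1 ->
  `|prodE (fun ka : {ffun 'I_n -> K} => cos (\sum_i g (ka i))) - rho ^+ n| <=
     n%:R * (`|\sum_x cos (g x) * p x - rho| + `|\sum_x sin (g x) * p x|) /\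
  `|prodE (fun ka : {ffun 'I_n -> K} => sin (\sum_i g (ka i)))| <=
     n%:R * (`|\sum_x cos (g x) * p x - rho| + `|\sum_x sin (g x) * p x|).
Proof.
move=> /andP[r0 r1].
have normcE a b : normc (Complex a b) <= `|a| + `|b| :> R.
  rewrite -[leRHS]ger0_norm ?addr_ge0// -[leRHS]sqrtr_sqr ler_wsqrtr //.
  rewrite -(real_normK (num_real a)) -(real_normK (num_real b)).
  have := normr_ge0 a; have := normr_ge0 b; nra.
have norm1 a b : `|a| <= normc (Complex a b) :> R.
  by rewrite -sqrtr_sqr ler_wsqrtr //= lerDl sqr_ge0.
have norm2 a b : `|b| <= normc (Complex a b) :> R.
  by rewrite -sqrtr_sqr ler_wsqrtr //= lerDr sqr_ge0.
have nr : normc (Complex rho 0) <= 1.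
  by rewrite /= expr0n /= addr0 sqrtr_sqr ger0_norm.
have rn : Complex rho 0 ^+ n = Complex (rho ^+ n) 0.
  elim: n => [|n ih]; first by rewrite !expr0.
  by rewrite !exprS ih; apply/eqP; rewrite eq_complex /=; apply/andP; split; apply/eqP; ring.
have := prodE_cis (fun _ : 'I_n => g); rewrite prodr_const card_ord => h.
have := normc_subX n (normc_cisE g) nr; rewrite -h rn.
have subC (a b c : R) : Complex a b - Complex c 0 = Complex (a - c) b.
  by apply/eqP; rewrite eq_complex /= subr0 !eqxx.
rewrite /cisE !subC.
move=> {}h; split; [apply: le_trans (norm1 _ _) _|apply: le_trans (norm2 _ _) _];
  apply: (le_trans h); apply: ler_wpM2l => //.
Qed.

End product_law.

(** * Taylor bounds for sine and cosine *)

Section trig_bounds.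
Context {R : realType}.

Lemma norm_sin_le (y : R) : `|sin y| <= `|y|.
Proof.
have gen (z : R) : 0 <= z -> `|sin z| <= z.
  move=> z0.
  have h1 x : x \in `]0, z[ -> is_derive x 1 sin (cos x) by move=> _; exact: is_derive_sin.
  have h2 : {within `[0, z], continuous (@sin R)}.
    by apply: continuous_subspaceT => x; exact: continuous_sin.
  have [c _] := MVT_segment z0 h1 h2.
  rewrite sin0 !subr0 => ->; rewrite normrM (ger0_norm z0) ler_piMl //.
  exact: cos_max.
have [y0|y0] := leP 0 y; first by rewrite (ger0_norm y0) gen.
by rewrite (ltr0_norm y0) -normrN -sinN gen // oppr_ge0 ltW.
Qed.

Lemma norm_cos_sub1_le (y : R) : `|cos y - 1| <= y ^+ 2.
Proof.
have -> : cos y - 1 = - (2 * sin (y / 2) ^+ 2).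
  have {1}-> : y = y / 2 + y / 2 by field.
  rewrite cosD; have := cos2Dsin2 (y / 2); lra.
rewrite normrN normrM normrX; have := norm_sin_le (y / 2).
rewrite normrM (ger0_norm (_ : 0 <= 2)) // (ger0_norm (_ : 0 <= 2^-1)) //.
rewrite -[in X in _ -> X](real_normK (num_real y)).
have := normr_ge0 y; have := normr_ge0 (sin (y/2)); nra.
Qed.

(** The derivative of [sin x - x] is [cos x - 1], so the mean value theorem raises the previous
    bound by one power. The next lemma repeats this once more; sharp constants are not sought. *)
Lemma norm_sin_subid_le (y : R) : `|sin y - y| <= `|y| ^+ 3.
Proof.
have gen (z : R) : 0 <= z -> `|sin z - z| <= z ^+ 3.
  move=> z0.
  have h1 x : x \in `]0, z[ -> is_derive x 1 (fun x => sin x - x) (cos x - 1).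
    by move=> _; apply: is_deriveB.
  have h2 : {within `[0, z], continuous (fun x : R => sin x - x)}.
    apply: continuous_subspaceT => x; apply: cvgB; last exact: cvg_id.
    exact: continuous_sin.
  have [c] := MVT_segment z0 h1 h2.
  rewrite in_itv /= => /andP[c0 cz].
  rewrite sin0 !subr0 => ->; rewrite normrM (ger0_norm z0) exprSr ler_wpM2r //.
  apply: le_trans (norm_cos_sub1_le c) _; nra.
have [y0|y0] := leP 0 y; first by rewrite (ger0_norm y0) gen.
have := gen (- y); rewrite oppr_ge0 ltW // => /(_ isT).
by rewrite sinN -opprD normrN (ltr0_norm y0).
Qed.

Lemma norm_cos_quad_le (y : R) : `|cos y - 1 + y ^+ 2 / 2| <= y ^+ 4.
Proof.
have gen (z : R) : 0 <= z -> `|cos z - 1 + z ^+ 2 / 2| <= z ^+ 4.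
  move=> z0.
  have h1 x : x \in `]0, z[ ->
      is_derive x 1 (fun x => cos x - 1 + x ^+ 2 / 2) (- sin x + x).
    move=> _; apply: is_deriveD.
      by rewrite -[X in is_derive _ _ _ X]subr0; apply: is_deriveB.
    by apply: is_derive_eq; rewrite /GRing.scale /=; field.
  have h2 : {within `[0, z], continuous (fun x : R => cos x - 1 + x ^+ 2 / 2)}.
    apply: continuous_subspaceT => x; apply: cvgD.
      by apply: cvgB; [exact: continuous_cos|exact: cvg_cst].
    by apply: cvgM; [exact: exprn_continuous|exact: cvg_cst].
  have [c] := MVT_segment z0 h1 h2.
  rewrite in_itv /= => /andP[c0 cz].
  rewrite cos0 expr0n /= mul0r addr0 subrr !subr0 => ->.
  rewrite normrM (ger0_norm z0) [in leRHS]exprSr ler_wpM2r //.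
  rewrite -normrN opprD opprK; apply: le_trans (norm_sin_subid_le c) _.
  by rewrite ger0_norm // lerXn2r.
have [y0|y0] := leP 0 y; first by rewrite gen.
by have := gen (- y); rewrite oppr_ge0 ltW // cosN sqrrN (_ : (- y) ^+ 4 = y ^+ 4); [exact|ring].
Qed.

End trig_bounds.

(** * Events of the coordinate processes *)

Section expectation.
Context {R : realType} {d : measure_display} {Om : measurableType d}.
Variable P : probability Om R.

Definition pr (A : set Om) : R := fine (P A).

Lemma prE A : measurable A -> P A = (pr A)%:E.
Proof. by move=> mA; rewrite /pr fineK // fin_num_measure. Qed.

Lemma pr_ge0 A : 0 <= pr A.
Proof. by rewrite /pr fine_ge0. Qed.

Lemma pr_le1 A : measurable A -> pr A <= 1.
Proof. by move=> mA; rewrite -lee_fin -prE // probability_le1. Qed.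

Lemma prT : pr setT = 1. Proof. by rewrite /pr probability_setT. Qed.

Lemma pr0 : pr set0 = 0. Proof. by rewrite /pr measure0. Qed.

Lemma pr_le A B : measurable A -> measurable B -> A `<=` B -> pr A <= pr B.
Proof.
by move=> mA mB AB; rewrite -lee_fin -!prE //; apply: le_measure => //; rewrite inE.
Qed.

Lemma prU A B : measurable A -> measurable B -> pr (A `|` B) <= pr A + pr B.
Proof.
move=> mA mB; rewrite -lee_fin EFinD -!prE //; last exact: measurableU.
exact: measureU2.
Qed.

Lemma prUD A B : measurable A -> measurable B -> A `&` B = set0 ->
  pr (A `|` B) = pr A + pr B.
Proof.
move=> mA mB AB; apply: EFin_inj; rewrite EFinD -!prE //; last exact: measurableU.
exact: measureU.
Qed.

Lemma pr_split A B : measurable A -> measurable B ->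
  pr A = pr (A `&` B) + pr (A `\` B).
Proof.
move=> mA mB; rewrite -prUD; [|exact: measurableI|exact: measurableD|].
  by rewrite setUIDK.
by rewrite -subset0 => w [[_ ?] [_ ?]].
Qed.

Lemma prC A : measurable A -> pr (~` A) = 1 - pr A.
Proof.
move=> mA; have := pr_split (measurableT) mA.
by rewrite setTI setTD prT => ->; lra.
Qed.

Lemma pr_bigU (I : finType) (B : I -> set Om) (Q : pred I) (A : set Om) :
  measurable A -> (forall i, measurable (B i)) ->
  (forall w, A w -> exists2 i, Q i & B i w) -> pr A <= \sum_(i | Q i) pr (B i).
Proof.
move=> mA mB AB.
have : pr (\big[setU/set0]_(i | Q i) B i) <= \sum_(i | Q i) pr (B i) /\
       measurable (\big[setU/set0]_(i | Q i) B i).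
  apply: (big_rec2 (fun A b => pr A <= b /\ measurable A)).
    by rewrite pr0.
  move=> i A' b _ [h m]; split; last exact: measurableU.
  by apply: le_trans (prU _ _) _ => //; rewrite lerD2l.
move=> [h m]; apply: le_trans h; apply: pr_le => // w /AB[i Qi Bi].
by rewrite (bigD1 i) //=; left.
Qed.

(** Bounded measurable functions: all are integrable under a probability, so the real-valued [Ex] is
    linear and monotone on them. *)
Definition bmf (f : Om -> R) :=
  measurable_fun setT f /\ exists C, forall w, `|f w| <= C.

Definition Ex (f : Om -> R) : R := fine (\int[P]_w (f w)%:E).

Lemma bmf_integrable f : bmf f -> P.-integrable setT (EFin \o f).
Proof.
move=> [mf [C fC]]; apply: measurable_bounded_integrable => //.
  by rewrite (le_lt_trans (probability_le1 _ _)) ?ltry.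
exists C; split; first exact: num_real.
by move=> x Cx w _ /=; apply: le_trans (ltW Cx).
Qed.

Lemma ExE f : bmf f -> (\int[P]_w (f w)%:E)%E = (Ex f)%:E.
Proof.
move=> bf; rewrite /Ex fineK //.
exact: (integrable_fin_num measurableT (bmf_integrable bf)).
Qed.

Lemma bmf_cst c : bmf (fun=> c).
Proof. by split; [exact: measurable_cst|exists `|c|]. Qed.

Lemma bmfD f g : bmf f -> bmf g -> bmf (fun w => f w + g w).
Proof.
move=> [mf [C fC]] [mg [D gD]]; split; first exact: measurable_funD.
by exists (C + D) => w; apply: le_trans (ler_normD _ _) _; apply: lerD.
Qed.

Lemma bmfM f g : bmf f -> bmf g -> bmf (fun w => f w * g w).
Proof.
move=> [mf [C fC]] [mg [D gD]]; split; first exact: measurable_funM.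
by exists (C * D) => w; rewrite normrM ler_pM.
Qed.

Lemma bmfZ c f : bmf f -> bmf (fun w => c * f w).
Proof. by move=> bf; apply: bmfM => //; exact: bmf_cst. Qed.

Lemma bmfN f : bmf f -> bmf (fun w => - f w).
Proof.
by move=> bf; rewrite (_ : (fun _ => _) = fun w => -1 * f w); [exact: bmfZ|apply/funext => w; rewrite mulN1r].
Qed.

Lemma bmfB f g : bmf f -> bmf g -> bmf (fun w => f w - g w).
Proof. by move=> bf bg; apply: bmfD => //; exact: bmfN. Qed.

Lemma bmf_sum (I : Type) (r : seq I) (Q : pred I) (f : I -> Om -> R) :
  (forall i, bmf (f i)) -> bmf (fun w => \sum_(i <- r | Q i) f i w).
Proof.
move=> bf; elim: r => [|i r ih].
  by under eq_fun do rewrite big_nil; exact: bmf_cst.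
under eq_fun do rewrite big_cons; case: (Q i) => //; exact: bmfD.
Qed.

Lemma bmf_indic A : measurable A -> bmf (\1_A).
Proof.
move=> mA; split; first by [].
by exists 1 => w; rewrite indicE; case: (_ \in _); rewrite ?normr0 ?normr1.
Qed.

Lemma Ex_indic A : measurable A -> Ex (\1_A) = pr A.
Proof. by move=> mA; rewrite /Ex integral_indic // setIT. Qed.

Lemma Ex_cst c : Ex (fun=> c) = c.
Proof. by rewrite /Ex integral_cst //= -/(P setT) probability_setT mule1. Qed.

Lemma ExD f g : bmf f -> bmf g -> Ex (fun w => f w + g w) = Ex f + Ex g.
Proof.
by move=> /bmf_integrable bf /bmf_integrable bg; exact: RintegralD.
Qed.

Lemma ExZ c f : bmf f -> Ex (fun w => c * f w) = c * Ex f.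
Proof. by move=> /bmf_integrable bf; exact: RintegralZl. Qed.

Lemma ExB f g : bmf f -> bmf g -> Ex (fun w => f w - g w) = Ex f - Ex g.
Proof.
by move=> /bmf_integrable bf /bmf_integrable bg; exact: RintegralB.
Qed.

Lemma Ex_sum (I : Type) (r : seq I) (Q : pred I) (f : I -> Om -> R) :
  (forall i, bmf (f i)) ->
  Ex (fun w => \sum_(i <- r | Q i) f i w) = \sum_(i <- r | Q i) Ex (f i).
Proof.
move=> bf; elim: r => [|i r ih].
  by under eq_fun do rewrite big_nil; rewrite Ex_cst big_nil.
under eq_fun do rewrite big_cons; rewrite big_cons; case: (Q i) => //.
by rewrite ExD ?ih //; exact: bmf_sum.
Qed.

Lemma Ex_le f g : bmf f -> bmf g -> (forall w, f w <= g w) -> Ex f <= Ex g.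
Proof.
by move=> /bmf_integrable bf /bmf_integrable bg fg; apply: le_Rintegral.
Qed.

(** [|f - g|] is dominated by [a + b * \1_A]. The typical [A] is a rare event off which [f] and [g]
    are close. *)
Lemma Ex_dist f g (A : set Om) (a b : R) : bmf f -> bmf g -> measurable A ->
  (forall w, ~ A w -> `|f w - g w| <= a) -> (forall w, `|f w - g w| <= b) ->
  0 <= a -> 0 <= b -> `|Ex f - Ex g| <= a + b * pr A.
Proof.
move=> bf bg mA h1 h2 a0 b0.
have bA := bmf_indic mA.
have le w : `|f w - g w| <= a + b * \1_A w.
  rewrite indicE; case: (boolP (w \in A)) => [_|/negP]; rewrite ?mulr1 ?mulr0 ?addr0.
    by apply: le_trans (h2 w) _; rewrite lerDr.
  by rewrite inE => /h1.
have E : Ex (fun w => a + b * \1_A w) = a + b * pr A.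
  rewrite (ExD (bmf_cst a) (bmfZ b bA)).
  by rewrite Ex_cst (ExZ b bA) Ex_indic.
rewrite -ExB // -E ler_norml; apply/andP; split.
  rewrite -[leRHS]opprK lerN2 -mulN1r -ExZ; last exact: bmfB.
  apply: Ex_le; [by apply: bmfZ; exact: bmfB|by apply: bmfD; [exact: bmf_cst|exact: bmfZ]|].
  by move=> w; apply: le_trans (le w); rewrite mulN1r -normrN ler_norm.
apply: Ex_le; [exact: bmfB|by apply: bmfD; [exact: bmf_cst|exact: bmfZ]|].
by move=> w; apply: le_trans (le w); exact: ler_norm.
Qed.

Lemma Ex_cvg (f : nat -> Om -> R) (g : Om -> R) (C : R) :
  (forall n, measurable_fun setT (f n)) -> (forall n w, `|f n w| <= C) ->
  measurable_fun setT g ->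
  (forall w, (fun n => f n w) @ \oo --> g w) -> (fun n => Ex (f n)) @ \oo --> Ex g.
Proof.
move=> mf fC mg fg.
have bC : P.-integrable setT (EFin \o (fun=> C)).
  by apply: bmf_integrable; exact: bmf_cst.
have gC w : `|g w| <= C.
  by apply: (cvgr_to_le (cvg_norm (fg w))); near=> n; exact: fC.
have [|||||ig _ cv] := @dominated_convergence _ _ R P setT measurableT
  (fun n w => (f n w)%:E) (fun w => (g w)%:E) (fun w => C%:E).
- by move=> n; exact/measurable_EFinP.
- exact/measurable_EFinP.
- by apply: aeW => w _; apply: cvg_EFin => //; [near=> n|exact: fg].
- exact: bC.
- by apply: aeW => w n _; rewrite lee_fin.
- have /= := cv; rewrite /= ExE; last by split => //; exists C.
  by move=> /fine_cvg.
Unshelve. all: by end_near.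
Qed.

End expectation.

(** * Events read off a single observation *)

Section observables.
Context {R : realType} {T : Type} {d : measure_display} {Om : measurableType d}.
Variables (P : probability Om R) (xi : nat -> Om -> T -> R).

(** Copies of one event: [E i] is read off the [i]-th path through a set [B] of paths common to all
    [i]. This is the form to which independence and equality of laws apply, and it is stable under
    countable operations. *)
Definition Obs (E : nat -> set Om) :=
  exists2 B, @cylm R T B & forall i, E i = xi i @^-1` B.

Lemma Obs_ext E F : Obs E -> (forall i, E i = F i) -> Obs F.
Proof. by move=> [B cB h] e; exists B => // i; rewrite -e. Qed.

Lemma Obs0 : Obs (fun=> set0).
Proof. by exists set0 => [|i]; [exact: sigma_algebra0|rewrite preimage_set0]. Qed.

Lemma ObsC E : Obs E -> Obs (fun i => ~` E i).
Proof.
move=> [B cB h]; exists (~` B) => [|i]; last by rewrite h preimage_setC.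
by rewrite -setTD; exact: sigma_algebraCD.
Qed.

Lemma Obs_bigcup (E : nat -> nat -> set Om) : (forall k, Obs (E k)) ->
  Obs (fun i => \bigcup_k E k i).
Proof.
move=> oE; have /choice[B hB] : forall k, exists B, @cylm R T B /\ forall i, E k i = xi i @^-1` B.
  by move=> k; have [B ? ?] := oE k; exists B.
exists (\bigcup_k B k) => [|i].
  by apply: sigma_algebra_bigcup => k; have [] := hB k.
by rewrite preimage_bigcup; apply: eq_bigcupr => k _; have [_ ->] := hB k.
Qed.

Lemma ObsT : Obs (fun=> setT).
Proof. by apply: Obs_ext (ObsC Obs0) _ => i; rewrite setC0. Qed.

Lemma Obs_bigcap (E : nat -> nat -> set Om) : (forall k, Obs (E k)) ->
  Obs (fun i => \bigcap_k E k i).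
Proof.
move=> oE; apply: Obs_ext (ObsC (Obs_bigcup (fun k => ObsC (oE k)))) _ => i.
by rewrite setC_bigcup; apply: eq_bigcapr => k _; rewrite setCK.
Qed.

Lemma Obs_forall (I : finType) (E : I -> nat -> set Om) : (forall k, Obs (E k)) ->
  Obs (fun i => [set w | forall k, E k i w]).
Proof.
(* A finite intersection is read as a countable one through the enumeration of [I]; integers that
   encode no element contribute [setT]. *)
move=> oE; have := Obs_bigcap (fun n : nat =>
  match @unpickle I n as o return Obs (match o with Some k => E k | None => fun=> setT end)
  with Some k => oE k | None => ObsT end).
move=> /Obs_ext; apply => i; apply/seteqP; split => w /= h.
  by move=> k; have := h (pickle k) Logic.I; rewrite pickleK.
by move=> n _; case: (unpickle n).
Qed.

Lemma Obs_eval t (B : set R) : measurable B -> Obs (fun i => [set w | B (xi i w t)]).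
Proof.
by move=> mB; exists [set f | B (f t)] => // ; apply: sub_sigma_algebra; exists t, B.
Qed.

Hypothesis mxi : forall i t, measurable_fun setT (fun w => xi i w t).

Lemma Obs_measurable E i : Obs E -> measurable (E i).
Proof.
move=> [B cB ->].
apply: (@smallest_sub _ (sigma_algebra setT) (@evgen R T) [set B | measurable (xi i @^-1` B)]) cB.
  split => /=.
  - by rewrite preimage_set0.
  - by move=> A mA; rewrite setTD preimage_setC; exact: measurableC.
  - by move=> A mA; rewrite preimage_bigcup; exact: bigcup_measurable.
move=> _ [t [B0 [mB0 ->]]] /=; rewrite -[X in measurable X]setTI.
exact: (mxi i t measurableT).
Qed.

Hypothesis indep : forall n (E : nat -> set Om),
  (forall i, (i < n)%N -> exists2 B, @cylm R T B & E i = xi i @^-1` B) ->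
  fine (P [set w | forall i, (i < n)%N -> E i w]) = \prod_(i < n) fine (P (E i)).
Hypothesis ident : forall i B, @cylm R T B -> P (xi i @^-1` B) = P (xi 0%N @^-1` B).

Lemma Obs_ident E i : Obs E -> P (E i) = P (E 0%N).
Proof. by move=> [B cB h]; rewrite !h ident. Qed.

Section law.
Context {K : finType}.
Variable X : nat -> Om -> K.
Hypothesis oX : forall x, Obs (fun i => [set w | X i w = x]).

Definition law (x : K) : R := pr P [set w | X 0%N w = x].

Lemma law_ge0 x : 0 <= law x. Proof. exact: pr_ge0. Qed.

Lemma sum_law_indic i (F : K -> R) w :
  F (X i w) = \sum_x F x * \1_[set w | X i w = x] w.
Proof.
rewrite (bigD1 (X i w)) //= indicE mem_set // mulr1 big1 ?addr0// => x xX.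
by rewrite indicE memNset ?mulr0 //= => h; rewrite h eqxx in xX.
Qed.

Lemma Ex_law1 i (F : K -> R) : Ex P (fun w => F (X i w)) = \sum_x F x * law x.
Proof.
under eq_fun do rewrite sum_law_indic.
have m x := Obs_measurable i (oX x).
rewrite Ex_sum; last by move=> x; apply: bmfZ; apply: bmf_indic.
apply: eq_bigr => x _; rewrite ExZ; last exact: bmf_indic.
by rewrite Ex_indic // /law /pr (Obs_ident _ (oX x)).
Qed.

Lemma sum_law : \sum_x law x = 1.
Proof.
have := Ex_law1 0 (fun=> 1); rewrite Ex_cst => ->.
by apply: eq_bigr => x _; rewrite mul1r.
Qed.

Lemma law_joint n (ka : {ffun 'I_n -> K}) :
  measurable [set w | [ffun i : 'I_n => X i w] = ka] /\
  pr P [set w | [ffun i : 'I_n => X i w] = ka] = \prod_i law (ka i).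
Proof.
(* The independence hypothesis takes a sequence of events over [nat]; it is filled with [setT] from
   [n] on. *)
pose E (i : nat) : set Om := if insub i is Some j then [set w | X i w = ka j] else setT.
have EE (j : 'I_n) : E j = [set w | X j w = ka j] by rewrite /E valK.
have eqE : [set w | [ffun i : 'I_n => X i w] = ka] = [set w | forall i, (i < n)%N -> E i w].
  apply/seteqP; split => w /=.
    move=> h i ni; have := EE (Ordinal ni); rewrite /= => -> /=.
    by rewrite -h ffunE.
  by move=> h; apply/ffunP => j; rewrite ffunE; have := h j (ltn_ord j); rewrite EE.
split.
  rewrite eqE; have -> : [set w | forall i, (i < n)%N -> E i w] = \bigcap_(i in `I_n) E i.
    by apply/seteqP; split => w /= h i; exact: h.
  apply: bigcap_measurableType => i /= ni.
  by have -> := EE (Ordinal ni); apply: (Obs_measurable i (oX _)).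
rewrite eqE /pr indep => [|i ni].
  by apply: eq_bigr => j _; rewrite EE (Obs_ident _ (oX _)).
by have -> := EE (Ordinal ni); have [B cB ->] := oX (ka (Ordinal ni)); exists B.
Qed.

Lemma law_indic n (F : {ffun 'I_n -> K} -> R) w : F [ffun i : 'I_n => X i w] =
  \sum_ka F ka * \1_[set w | [ffun i : 'I_n => X i w] = ka] w.
Proof.
rewrite (bigD1 [ffun i : 'I_n => X i w]) //= indicE mem_set // mulr1 big1 ?addr0// => x xX.
by rewrite indicE memNset ?mulr0 //= => h; rewrite h eqxx in xX.
Qed.

Lemma bmf_law n (F : {ffun 'I_n -> K} -> R) : bmf (fun w => F [ffun i : 'I_n => X i w]).
Proof.
rewrite (_ : (fun _ => _) = fun w => \sum_ka F ka * \1_[set w | [ffun i : 'I_n => X i w] = ka] w).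
  by apply: bmf_sum => ka; apply: bmfZ; apply: bmf_indic; have [] := law_joint ka.
by apply/funext => w; rewrite law_indic.
Qed.

(** The bridge from [Om] to the finite product law: through it independence enters all later
    estimates. *)
Lemma Ex_law n (F : {ffun 'I_n -> K} -> R) :
  Ex P (fun w => F [ffun i : 'I_n => X i w]) = prodE law F.
Proof.
under eq_fun do rewrite law_indic.
rewrite Ex_sum; last first.
  by move=> ka; apply: bmfZ; apply: bmf_indic; have [] := law_joint ka.
apply: eq_bigr => ka _; have [m e] := law_joint ka.
by rewrite ExZ ?Ex_indic ?e //; exact: bmf_indic.
Qed.

End law.
End observables.

(** * Normalised sums of indicators *)

Lemma asbool_mem (U : Type) (A : set U) w : `[< A w >] = (w \in A).
Proof. by apply/asboolP/idP; rewrite inE. Qed.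

Lemma cvg_finsum {R : realType} {X : Type} {F : set_system X} {FF : Filter F} (I : finType)
    (f : I -> X -> R) (l : I -> R) :
  (forall i, f i @ F --> l i) -> (fun x => \sum_i f i x) @ F --> \sum_i l i.
Proof.
move=> h; elim: (index_enum I) => [|i r ih].
  by under eq_fun do rewrite big_nil; rewrite big_nil; exact: cvg_cst.
by under eq_fun do rewrite big_cons; rewrite big_cons; exact: cvgD.
Qed.

Lemma cvg_finsum2 {R : realType} {X : Type} {F : set_system X} {FF : Filter F} (I J : finType)
    (f : I -> J -> X -> R) (l : I -> J -> R) :
  (forall i j, f i j @ F --> l i j) ->
  (fun x => \sum_i \sum_j f i j x) @ F --> \sum_i \sum_j l i j.
Proof. by move=> h; exact: cvg_finsum (fun i => cvg_finsum (h i)). Qed.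

(** Identities involving [k n] hold for [n > 0] only, where [k n] is known to be positive. *)
Lemma cvg_eqn {R : realType} (u v : nat -> R) (l : R) :
  (forall n, (0 < n)%N -> u n = v n) -> v @ \oo --> l -> u @ \oo --> l.
Proof.
move=> uv; apply: cvg_trans; apply: near_eq_cvg; near=> n; rewrite uv //.
near: n; exact: nbhs_infty_gt.
Unshelve. all: by end_near.
Qed.

Lemma cvg_err {R : realType} (u v err : nat -> R) (l : R) : err @ \oo --> (0 : R) ->
  (forall n, (0 < n)%N -> `|u n - v n| <= err n) -> v @ \oo --> l -> u @ \oo --> l.
Proof.
move=> /cvgr0Pnorm_le ce h cv.
rewrite -[l]add0r (_ : u = (fun n => (u n - v n) + v n)); last first.
  by apply/funext => n; rewrite subrK.
apply: cvgD => //; apply/cvgr0Pnorm_le => e e0; near=> n.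
apply: le_trans (h n _) _; first by near: n; exact: nbhs_infty_gt.
by apply: le_trans (ler_norm _) _; near: n; exact: ce.
Unshelve. all: by end_near.
Qed.

Section deviation.
Context {R : realType} {T : Type} {d : measure_display} {Om : measurableType d}.
Variables (P : probability Om R) (xi : nat -> Om -> T -> R).
Hypothesis mxi : forall i t, measurable_fun setT (fun w => xi i w t).
Hypothesis indep : forall n (E : nat -> set Om),
  (forall i, (i < n)%N -> exists2 B, @cylm R T B & E i = xi i @^-1` B) ->
  fine (P [set w | forall i, (i < n)%N -> E i w]) = \prod_(i < n) fine (P (E i)).
Hypothesis ident : forall i B, @cylm R T B -> P (xi i @^-1` B) = P (xi 0%N @^-1` B).

(** The tail empirical process at one index, with the region replaced by any family of events, so
    that brackets can be inserted as well. *)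
Definition Dn (k : R) (n : nat) (A : nat -> set Om) (w : Om) : R :=
  (Num.sqrt k)^-1 * \sum_(i < n) (\1_(A i) w - pr P (A 0%N)).

Section vector.
Variables (m : nat) (A : 'I_m -> nat -> set Om).
Hypothesis oA : forall j, Obs xi (A j).

(** All [m] indicators of observation [i] as one element of a finite type, to which the product law
    applies. *)
Definition obsv (i : nat) (w : Om) : {ffun 'I_m -> bool} := [ffun j => `[< A j i w >]].

Lemma obs_obsv x : Obs xi (fun i => [set w | obsv i w = x]).
Proof.
apply: (@Obs_ext _ _ _ _ _ (fun i => [set w | forall j, (if x j then A j else fun i => ~` A j i) i w])).
  by apply: Obs_forall => j; case: (x j); [exact: oA|exact/ObsC/oA].
move=> i; apply/seteqP; split => w /=.
  move=> h; apply/ffunP => j; rewrite ffunE; have := h j; case: (x j) => h'.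
    exact/asboolP.
  exact/asboolPn.
by move=> <- j; rewrite ffunE; case: asboolP.
Qed.

(** The contribution to [Dn] of one observation with indicator vector [x]; [Dn] is the sum of these
    centred i.i.d. terms. *)
Definition Dval (k : R) (j : 'I_m) (x : {ffun 'I_m -> bool}) : R :=
  (Num.sqrt k)^-1 * ((x j)%:R - pr P (A j 0%N)).

Lemma DnE k n j w :
  Dn k n (A j) w = \sum_(i < n) Dval k j ([ffun i : 'I_n => obsv i w] i).
Proof.
rewrite /Dn big_distrr /=; apply: eq_bigr => i _.
by rewrite /Dval !ffunE indicE asbool_mem.
Qed.

Lemma Dval_Ex0 (F : {ffun 'I_m -> bool} -> R) :
  \sum_x F x * law P obsv x = Ex P (fun w => F (obsv 0 w)).
Proof. by rewrite (Ex_law1 mxi ident obs_obsv). Qed.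

Lemma Dval_mean k j : \sum_x Dval k j x * law P obsv x = 0.
Proof.
rewrite Dval_Ex0 //; have mA := Obs_measurable mxi 0 (oA j).
have -> : (fun w => Dval k j (obsv 0 w)) =
    (fun w => (Num.sqrt k)^-1 * (\1_(A j 0%N) w - pr P (A j 0%N))).
  by apply/funext => w; rewrite /Dval ffunE indicE asbool_mem.
rewrite ExZ; last by apply: bmfB; [exact: bmf_indic|exact: bmf_cst].
by rewrite ExB ?Ex_indic ?Ex_cst ?subrr ?mulr0 //; [exact: bmf_indic|exact: bmf_cst].
Qed.

Lemma bmf_Dn k n j : bmf (Dn k n (A j)).
Proof.
rewrite (_ : Dn k n (A j) = fun w => \sum_(i < n) Dval k j ([ffun i : 'I_n => obsv i w] i)); last first.
  by apply/funext => w; rewrite DnE.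
exact: (bmf_law mxi indep ident obs_obsv (fun x : {ffun 'I_n -> _} => \sum_(i < n) Dval k j (x i))).
Qed.

Lemma Dval_cov k i j : 0 <= k -> \sum_x Dval k i x * Dval k j x * law P obsv x =
  k^-1 * (pr P (A i 0%N `&` A j 0%N) - pr P (A i 0%N) * pr P (A j 0%N)).
Proof.
move=> k0; rewrite (Dval_Ex0 (fun x => Dval k i x * Dval k j x)).
have mi := Obs_measurable mxi 0 (oA i); have mj := Obs_measurable mxi 0 (oA j).
set p := pr P (A i 0%N); set q := pr P (A j 0%N).
have -> : (fun w => Dval k i (obsv 0 w) * Dval k j (obsv 0 w)) =
   (fun w => k^-1 * (\1_(A i 0%N `&` A j 0%N) w + (- q) * \1_(A i 0%N) w
      + (- p) * \1_(A j 0%N) w + p * q)).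
  apply/funext => w; rewrite /Dval !ffunE indicI !indicE /= !indicE.
  rewrite !asbool_mem -/p -/q mulrACA -invfM -expr2 sqr_sqrtr //; ring.
have b (B : set Om) : measurable B -> bmf (\1_B : Om -> R) by exact: bmf_indic.
have b1 := b _ (measurableI _ _ mi mj).
have b2 := bmfZ (- q) (b _ mi).
have b3 := bmfZ (- p) (b _ mj).
have b12 := bmfD b1 b2; have b123 := bmfD b12 b3.
have b1234 := bmfD b123 (bmf_cst (p * q)).
rewrite (ExZ _ _ b1234) (ExD _ b123 (bmf_cst _)) (ExD _ b12 b3) (ExD _ b1 b2).
rewrite (ExZ _ _ (b _ mi)) (ExZ _ _ (b _ mj)) !Ex_indic ?Ex_cst // -/p -/q; last exact: measurableI.
by congr (_ * _); ring.
Qed.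

Lemma Dval_bound k j x : 0 < k -> `|Dval k j x| <= (Num.sqrt k)^-1.
Proof.
move=> k0; rewrite /Dval normrM ger0_norm ?invr_ge0 ?sqrtr_ge0//.
rewrite ler_piMr ?invr_ge0 ?sqrtr_ge0// ler_norml.
have := pr_ge0 P (A j 0%N); have := pr_le1 P (Obs_measurable mxi 0 (oA j)).
by case: (x j) => /= ? ?; apply/andP; split; lra.
Qed.

End vector.

(** Bernstein's inequality for the difference of two indicators: terms are bounded by [2 / sqrt k],
    the total variance by [n / k] times the probability of the symmetric difference, and the regime
    condition becomes [lam <= sqrt k * V]. *)
Lemma Dn_deviation (A B : nat -> set Om) (k V lam : R) n :
  Obs xi A -> Obs xi B -> 0 < k -> 0 < V ->
  n%:R / k * (pr P (A 0%N `\` B 0%N) + pr P (B 0%N `\` A 0%N)) <= V ->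
  0 <= lam -> lam <= Num.sqrt k * V ->
  measurable [set w | lam <= `|Dn k n A w - Dn k n B w|] /\
  pr P [set w | lam <= `|Dn k n A w - Dn k n B w|] <= 2 * expR (- (lam ^+ 2 / (8 * V))).
Proof.
move=> oA oB k0 V0 hV l0 lV.
pose AB (j : 'I_2) := if j == ord0 then A else B.
have oAB j : Obs xi (AB j) by rewrite /AB; case: ifP.
pose g x := Dval AB k ord0 x - Dval AB k (lift ord0 ord0) x.
have EA n' w : Dn k n' A w - Dn k n' B w =
    \sum_(i < n') g ([ffun i : 'I_n' => obsv AB i w] i).
  by rewrite -[A]/(AB ord0) -[B]/(AB (lift ord0 ord0)) !DnE -sumrB.
have mE : measurable [set w | lam <= `|Dn k n A w - Dn k n B w|].
  have [mf _] := bmfB (bmf_Dn oAB k n ord0) (bmf_Dn oAB k n (lift ord0 ord0)).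
  have := measurable_fun_ler (measurable_cst lam) (measurableT_comp (@normr_measurable R setT) mf).
  by move=> /(_ measurableT [set true] _); rewrite setTI; apply.
split => //.
rewrite -Ex_indic //.
have -> : Ex P \1_[set w | lam <= `|Dn k n A w - Dn k n B w|] =
   prodE (law P (obsv AB)) (fun ka : {ffun 'I_n -> _} => (lam <= `|\sum_i g (ka i)|)%R%:R).
  rewrite -(Ex_law mxi indep ident (obs_obsv oAB)); congr Ex; apply/funext => w.
  by rewrite indicE -EA -asbool_mem /= asboolb.
have mA := Obs_measurable mxi 0 oA; have mB := Obs_measurable mxi 0 oB.
apply: (bernstein_prod (law_ge0 P (obsv AB)) (sum_law mxi ident (obs_obsv oAB))
  (b := 2 * (Num.sqrt k)^-1)) => //.
- move=> x; apply: le_trans (ler_normB _ _) _; rewrite mulr_natl mulr2n.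
  by apply: lerD; exact: Dval_bound.
- by under eq_bigr do rewrite mulrBl; rewrite sumrB !Dval_mean // subrr.
- rewrite (eq_bigr (fun x =>
    Dval AB k ord0 x * Dval AB k ord0 x * law P (obsv AB) x
    - (Dval AB k ord0 x * Dval AB k (lift ord0 ord0) x * law P (obsv AB) x) *+ 2
    + Dval AB k (lift ord0 ord0) x * Dval AB k (lift ord0 ord0) x * law P (obsv AB) x));
    last by move=> x _; rewrite /g; ring.
  have k0' := ltW k0; rewrite big_split /= sumrB sumrMnl !(Dval_cov oAB) // !setIid /AB /=.
  apply: le_trans hV; rewrite -mulrA ler_wpM2l // -mulrnAr -mulrBr -mulrDr ler_wpM2l ?invr_ge0//.
  (* The variance of the difference of indicators is the probability of the symmetric difference
     minus [(pA - pB)^2]. *)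
  have := pr_split P mA mB; have := pr_split P mB mA; rewrite [B 0%N `&` _]setIC.
  move: (pr P (A 0%N)) (pr P (B 0%N)) => pA pB.
  have := sqr_ge0 (pA - pB); rewrite expr2 mulr2n; nra.
rewrite mulrCA ler_pM2l // ler_pdivrMr ?sqrtr_gt0 // mulrC //.
Qed.

Lemma expR_quad_le (x : R) : 0 <= x -> `|1 - x - expR (- x)| <= x ^+ 2.
Proof.
move=> x0; have h1 := expR_ge1Dx (- x); have h2 := expR_ge1Dx x.
have e0 := expR_gt0 (- x).
have h3 : expR (- x) * (1 + x) <= 1.
  have : expR (- x) * expR x = 1 by rewrite -expRD addNr expR0.
  nra.
rewrite ler_norml; apply/andP; split; last nra.
have : expR (- x) <= 1 - x + x ^+ 2.
  rewrite -(ler_pM2r (_ : 0 < 1 + x)); last lra.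
  by apply: (le_trans h3); nra.
lra.
Qed.

(** [tau] is the variance of the linear combination. The characteristic function of one term is
    compared with [exp (- tau / (2 n))], whose [n]-th power is the Gaussian value. The three parts
    of [err] are [n] times the remainders of the cosine (order 4), of the exponential (order 2) and
    of the sine (order 3). *)
Lemma Dn_chf_bound m (A : 'I_m -> nat -> set Om) (a : 'I_m -> R) (k : R) n :
  (forall j, Obs xi (A j)) -> 0 < k -> (0 < n)%N ->
  let B := \sum_j `|a j| in
  let tau := n%:R / k * \sum_i \sum_j a i * a j *
     (pr P (A i 0%N `&` A j 0%N) - pr P (A i 0%N) * pr P (A j 0%N)) in
  let err := B ^+ 2 * tau / k + tau ^+ 2 / n%:R + B * tau / Num.sqrt k in
  `|Ex P (fun w => cos (\sum_j a j * Dn k n (A j) w)) - expR (- tau / 2)| <= err /\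
  `|Ex P (fun w => sin (\sum_j a j * Dn k n (A j) w))| <= err.
Proof.
move=> oA k0 n0 B tau err.
have sk0 : 0 < Num.sqrt k by rewrite sqrtr_gt0.
have nR : 0 < n%:R :> R by rewrite ltr0n.
pose g x := \sum_j a j * Dval A k j x.
have B0 : 0 <= B by apply: sumr_ge0.
have gb x : `|g x| <= B / Num.sqrt k.
  apply: le_trans (ler_norm_sum _ _ _) _; rewrite /B mulr_suml; apply: ler_sum => j _.
  by rewrite normrM ler_wpM2l // Dval_bound.
have l0 := law_ge0 P (obsv A); have l1 := sum_law mxi ident (obs_obsv oA).
have g1 : \sum_x g x * law P (obsv A) x = 0.
  under eq_bigr do rewrite mulr_suml.
  rewrite exchange_big big1 //= => j _.
  by under eq_bigr do rewrite -mulrA; rewrite -big_distrr /= Dval_mean // mulr0.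
have g2 : \sum_x g x ^+ 2 * law P (obsv A) x = tau / n%:R.
  under eq_bigr => x _ do rewrite expr2 big_distrlr /= mulr_suml.
  rewrite exchange_big /= /tau mulrC -mulrA mulKf ?gt_eqF // big_distrr /=.
  apply: eq_bigr => i _; under eq_bigr do rewrite mulr_suml.
  rewrite exchange_big /= big_distrr /=; apply: eq_bigr => j _.
  rewrite (mulrCA k^-1) -(Dval_cov oA) ?ltW // big_distrr /=.
  by apply: eq_bigr => x _; ring.
have tau0 : 0 <= tau.
  have : 0 <= tau / n%:R.
    by rewrite -g2; apply: sumr_ge0 => x _; rewrite mulr_ge0 ?sqr_ge0.
  by rewrite pmulr_lge0 // invr_gt0.
have sumE w : \sum_j a j * Dn k n (A j) w = \sum_(i < n) g ([ffun i : 'I_n => obsv A i w] i).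
  under eq_bigr do rewrite DnE // big_distrr /=.
  by rewrite exchange_big.
pose rho := expR (- (tau / (2 * n%:R))).
have r01 : 0 <= rho <= 1.
  by rewrite expR_ge0 expR_le1 oppr_le0 divr_ge0 // mulr_ge0 // ltW.
have [h1 h2] := prodE_cis_approx l0 l1 n g r01.
have -> : - tau / 2 = n%:R * (- (tau / (2 * n%:R))) by field; rewrite gt_eqF.
rewrite expRM_natl -/rho.
rewrite (_ : (fun w => cos _) = (fun w => cos (\sum_(i < n) g ([ffun i : 'I_n => obsv A i w] i)))); last first.
  by apply/funext => w; rewrite sumE.
rewrite (_ : (fun w => sin _) = (fun w => sin (\sum_(i < n) g ([ffun i : 'I_n => obsv A i w] i)))); last first.
  by apply/funext => w; rewrite sumE.
rewrite (Ex_law mxi indep ident (obs_obsv oA) (fun x : {ffun 'I_n -> _} => cos (\sum_(i < n) g (x i)))).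
rewrite (Ex_law mxi indep ident (obs_obsv oA) (fun x : {ffun 'I_n -> _} => sin (\sum_(i < n) g (x i)))).
suff h : n%:R * (`|\sum_x cos (g x) * law P (obsv A) x - rho| +
    `|\sum_x sin (g x) * law P (obsv A) x|) <= err.
  by split; [exact: le_trans h1 h|exact: le_trans h2 h].
have c1 : `|\sum_x cos (g x) * law P (obsv A) x - rho| <=
    (B / Num.sqrt k) ^+ 2 * (tau / n%:R) + (tau / (2 * n%:R)) ^+ 2.
  have -> : \sum_x cos (g x) * law P (obsv A) x - rho =
     \sum_x (cos (g x) - 1 + g x ^+ 2 / 2) * law P (obsv A) x + (1 - tau / (2 * n%:R) - rho).
    have -> : \sum_x cos (g x) * law P (obsv A) x = \sum_x ((cos (g x) - 1 + g x ^+ 2 / 2) * law P (obsv A) x + law P (obsv A) x - 2^-1 * (g x ^+ 2 * law P (obsv A) x)).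
      by apply: eq_bigr => x _; field.
    by rewrite sumrB big_split /= -big_distrr /= l1 g2; field; rewrite gt_eqF.
  apply: le_trans (ler_normD _ _) _; apply: lerD; last first.
    by apply: expR_quad_le; rewrite divr_ge0 // mulr_ge0 // ltW.
  apply: le_trans (ler_norm_sum _ _ _) _; rewrite -g2 big_distrr /=; apply: ler_sum => x _.
  rewrite normrM (ger0_norm (l0 x)) mulrA ler_wpM2r //.
  apply: le_trans (norm_cos_quad_le _) _.
  rewrite (_ : 4 = 2 + 2)%N // exprD ler_wpM2r ?sqr_ge0 // -[leLHS]real_normK ?num_real //.
  by rewrite lerXn2r // nnegrE // divr_ge0 // ltW.
have c2 : `|\sum_x sin (g x) * law P (obsv A) x| <= B / Num.sqrt k * (tau / n%:R).
  have -> : \sum_x sin (g x) * law P (obsv A) x = \sum_x (sin (g x) - g x) * law P (obsv A) x.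
    by under [RHS]eq_bigr do rewrite mulrBl; rewrite sumrB g1 subr0.
  apply: le_trans (ler_norm_sum _ _ _) _; rewrite -g2 big_distrr /=; apply: ler_sum => x _.
  rewrite normrM (ger0_norm (l0 x)) mulrA ler_wpM2r //.
  apply: le_trans (norm_sin_subid_le _) _.
  by rewrite exprS real_normK ?num_real // ler_wpM2r ?sqr_ge0.
apply: le_trans (ler_wpM2l (ltW nR) (lerD c1 c2)) _.
have -> : n%:R * ((B / Num.sqrt k) ^+ 2 * (tau / n%:R) + (tau / (2 * n%:R)) ^+ 2 + B / Num.sqrt k * (tau / n%:R))
   = B ^+ 2 * tau / k + tau ^+ 2 / n%:R / 4 + B * tau / Num.sqrt k.
  rewrite expr_div_n sqr_sqrtr ?ltW //; field.
  by rewrite !gt_eqF.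
rewrite /err lerD2r lerD2l ler_pdivrMr // ler_peMr ?ler1n //.
by rewrite divr_ge0 ?sqr_ge0 // ltW.
Qed.

Lemma Dn_chf_cvg m (A : nat -> 'I_m -> nat -> set Om) (k : nat -> R) (G : 'I_m -> 'I_m -> R)
    (a : 'I_m -> R) :
  (forall n j, Obs xi (A n j)) -> (forall n, (0 < n)%N -> 0 < k n) ->
  k @ \oo --> +oo -> (fun n => k n / n%:R) @ \oo --> (0 : R) ->
  (forall i j, (fun n => n%:R / k n * pr P (A n i 0%N `&` A n j 0%N)) @ \oo --> G i j) ->
  (fun n => Ex P (fun w => cos (\sum_j a j * Dn (k n) n (A n j) w))) @ \oo -->
     expR (- (\sum_i \sum_j a i * a j * G i j) / 2) /\
  (fun n => Ex P (fun w => sin (\sum_j a j * Dn (k n) n (A n j) w))) @ \oo --> (0 : R).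
Proof.
move=> oA k0 koo kn hG.
pose tau n := n%:R / k n * \sum_i \sum_j a i * a j *
     (pr P (A n i 0%N `&` A n j 0%N) - pr P (A n i 0%N) * pr P (A n j 0%N)).
pose B := \sum_j `|a j|.
pose err n := B ^+ 2 * tau n / k n + tau n ^+ 2 / n%:R + B * tau n / Num.sqrt (k n).
(* Scaled by [n / k], a product of two probabilities retains a factor [k / n]: the centring
   disappears from the limiting covariance. *)
have ptw n (i j : 'I_m) : (0 < n)%N -> n%:R / k n * (pr P (A n i 0%N) * pr P (A n j 0%N)) =
    (n%:R / k n * pr P (A n i 0%N `&` A n i 0%N)) * (n%:R / k n * pr P (A n j 0%N `&` A n j 0%N)) * (k n / n%:R).
  move=> n0; rewrite !setIid; field; by rewrite !lt0r_neq0 ?k0 ?ltr0n.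
have tauE n : (0 < n)%N -> tau n = \sum_i \sum_j a i * a j * (n%:R / k n * pr P (A n i 0%N `&` A n j 0%N) -
  (n%:R / k n * pr P (A n i 0%N `&` A n i 0%N)) * (n%:R / k n * pr P (A n j 0%N `&` A n j 0%N)) * (k n / n%:R)).
  move=> n0; rewrite /tau big_distrr /=; apply: eq_bigr => i _; rewrite big_distrr /=.
  by apply: eq_bigr => j _; rewrite -ptw //; ring.
have ctau : tau @ \oo --> \sum_i \sum_j a i * a j * G i j.
  apply: cvg_eqn tauE _; apply: cvg_finsum2 => i j; apply: cvgM; first exact: cvg_cst.
  rewrite -[G i j]subr0; apply: cvgB; first exact: hG.
  rewrite -(mulr0 (G i i * G j j)); apply: cvgM => //.
  by apply: cvgM; exact: hG.
have kinv : (fun n => (k n)^-1) @ \oo --> (0 : R).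
  by apply/gtr0_cvgV0; [near=> n; apply: k0; near: n; exact: nbhs_infty_gt|].
have skinv : (fun n => (Num.sqrt (k n))^-1) @ \oo --> (0 : R).
  have := cvg_comp _ _ kinv (@sqrt_continuous R 0).
  by rewrite sqrtr0; apply: cvg_eqn => n n0; rewrite /= sqrtrV // ltW // k0.
have ninv : (fun n => (n%:R)^-1) @ \oo --> (0 : R).
  apply/gtr0_cvgV0; last exact: cvgr_idn.
  by near=> n; rewrite ltr0n; near: n; exact: nbhs_infty_gt.
have cerr : err @ \oo --> (0 : R).
  rewrite -[X in _ --> X]addr0 -[X in _ --> X + _]addr0; apply: cvgD; first apply: cvgD.
  - rewrite -(mulr0 (B ^+ 2 * \sum_i \sum_j a i * a j * G i j)); apply: cvgM => //.
    by apply: cvgM => //; exact: cvg_cst.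
  - rewrite -(mulr0 ((\sum_i \sum_j a i * a j * G i j) ^+ 2)); apply: cvgM => //.
    by rewrite expr2; under eq_fun do rewrite expr2; exact: cvgM.
  - rewrite -(mulr0 (B * \sum_i \sum_j a i * a j * G i j)); apply: cvgM => //.
    by apply: cvgM => //; exact: cvg_cst.
have ctau2 : (fun n => expR (- tau n / 2)) @ \oo --> expR (- (\sum_i \sum_j a i * a j * G i j) / 2).
  apply: continuous_cvg; first exact: continuous_expR.
  by apply: cvgM; [exact: cvgN|exact: cvg_cst].
have bound n : (0 < n)%N -> _ := fun n0 => Dn_chf_bound a (oA n) (k0 n n0) n0.
split; first by apply: (cvg_err cerr) ctau2 => n n0; have [] := bound n n0.
by apply: (cvg_err cerr (v := fun=> 0)) => [n n0|]; [rewrite subr0; have [] := bound n n0|exact: cvg_cst].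
Unshelve. all: by end_near.
Qed.

End deviation.

(** * Convergence of finite-dimensional laws *)

Lemma eq_ler {R : realType} (x y : R) : x = y -> x <= y.
Proof. by move=> ->. Qed.

(** * Binomial weights and their absolute deviation *)

Section binomial_weights.
Context {R : realType}.

(** The probability of [k] successes in [N] trials, by conditioning on one trial; moment identities
    then follow by induction on [N]. *)
Fixpoint bw (p : R) (N k : nat) : R :=
  match N with
  | 0 => (k == 0%N)%:R
  | N'.+1 => p * (if k is k'.+1 then bw p N' k' else 0) + (1 - p) * bw p N' k
  end.

Lemma bw_big p N k : (N < k)%N -> bw p N k = 0.
Proof.
elim: N k => [|N ih] [|k] //=; rewrite ltnS => Nk.
by rewrite !ih ?mulr0 ?addr0 // ltnW.
Qed.

Lemma bw_ge0 p N k : 0 <= p <= 1 -> 0 <= bw p N k.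
Proof.
move=> /andP[p0 p1]; elim: N k => [|N ih] k /=; first by case: eqP.
by apply: addr_ge0; apply: mulr_ge0 => //; [case: k|rewrite subr_ge0].
Qed.

Lemma sum_bwS p N (f : nat -> R) :
  \sum_(k < N.+2) bw p N.+1 k * f k =
  p * (\sum_(k < N.+1) bw p N k * f k.+1) + (1 - p) * \sum_(k < N.+1) bw p N k * f k.
Proof.
under eq_bigr do rewrite /= mulrDl -!mulrA.
rewrite big_split /= -!big_distrr /=; congr (_ * _ + _ * _).
  by rewrite big_ord_recl /= mul0r add0r.
by rewrite big_ord_recr /= bw_big // mul0r addr0.
Qed.

Lemma sum_bw p N : \sum_(k < N.+1) bw p N k = 1.
Proof.
have h M : \sum_(k < M.+1) bw p M k * (fun=> 1) (k : nat) = 1.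
  elim: M => [|M ih]; first by rewrite big_ord1 /= mulr1.
  by rewrite (sum_bwS p M (fun=> 1)) ih; ring.
by rewrite -[RHS](h N); apply: eq_bigr => k _; rewrite mulr1.
Qed.

(** The centre [a] is arbitrary because a success in the induction step shifts it by one. *)
Lemma sum_bw_sqr p N (a : R) :
  \sum_(k < N.+1) bw p N k * (k%:R - a) ^+ 2 = (N%:R * p - a) ^+ 2 + N%:R * p * (1 - p).
Proof.
elim: N a => [|N ih] a; first by rewrite big_ord1 /=; ring.
rewrite (sum_bwS p N (fun k => (k%:R - a) ^+ 2)) ih.
have -> : \sum_(k < N.+1) bw p N k * (k.+1%:R - a) ^+ 2 =
    \sum_(k < N.+1) bw p N k * (k%:R - (a - 1)) ^+ 2.
  by apply: eq_bigr => k _; rewrite -natr1; congr (_ * _ ^+ 2); ring.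
by rewrite ih -natr1; ring.
Qed.

(** Instead of the Cauchy-Schwarz inequality, [|u| <= (s u^2 + 1/s) / 2] with [s = sqrt N] reduces
    the absolute deviation to the variance. *)
Lemma sum_bw_dev p N : 0 <= p <= 1 -> (0 < N)%N ->
  \sum_(k < N.+1) bw p N k * `|k%:R / N%:R - p| <= (Num.sqrt N%:R)^-1.
Proof.
move=> p01 N0; have NR : 0 < N%:R :> R by rewrite ltr0n.
set s := Num.sqrt N%:R; have s0 : 0 < s by rewrite sqrtr_gt0.
have s2 : s ^+ 2 = N%:R by rewrite sqr_sqrtr // ltW.
have amgm (u : R) : `|u| <= (s * u ^+ 2 + s^-1) / 2.
  rewrite -(ler_pM2l s0) -real_normK ?num_real //.
  have -> : s * ((s * `|u| ^+ 2 + s^-1) / 2) = ((s * `|u|) ^+ 2 + 1) / 2.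
    by field; rewrite gt_eqF.
  have := sqr_ge0 (s * `|u| - 1); nra.
apply: (@le_trans _ _ (\sum_(k < N.+1) ((s / (2 * N%:R ^+ 2)) * (bw p N k * (k%:R - N%:R * p) ^+ 2)
     + (s^-1 / 2) * bw p N k))).
  apply: ler_sum => k _; apply: le_trans (ler_wpM2l (bw_ge0 _ _ p01) (amgm _)) _.
  apply: eq_ler; field; by rewrite !gt_eqF.
rewrite big_split /= -!big_distrr /= sum_bw sum_bw_sqr subrr.
have -> : s / (2 * N%:R ^+ 2) * (0 ^+ 2 + N%:R * p * (1 - p)) = s^-1 / 2 * (p * (1 - p)).
  by rewrite -s2; field; rewrite gt_eqF.
have si : 0 < s^-1 by rewrite invr_gt0.
have := mulr_ge0 (ltW si) (sqr_ge0 (p - 2^-1)); move/andP: p01 => [? ?]; nra.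
Qed.

End binomial_weights.

(** * Approximation by trigonometric polynomials *)

Section trig_approx.
Context {R : realType} {m : nat}.
Implicit Types (F G h : ('I_m -> R) -> R) (x : 'I_m -> R).

(* The functions whose expectations are determined by the characteristic function. *)
Inductive trig : (('I_m -> R) -> R) -> Prop :=
| trig_cos a : trig (fun x => cos (\sum_i a i * x i))
| trig_sin a : trig (fun x => sin (\sum_i a i * x i))
| trigD F G : trig F -> trig G -> trig (fun x => F x + G x)
| trigZ c F : trig F -> trig (fun x => c * F x).

Lemma trig_ext F G : trig F -> (forall x, F x = G x) -> trig G.
Proof. by move=> tF FG; rewrite (_ : G = F) //; apply/funext => x. Qed.

Lemma trig_cst c : trig (fun=> c).
Proof.
apply: trig_ext (trigZ c (trig_cos (fun=> 0))) _ => x /=.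
by rewrite big1 ?cos0 ?mulr1 // => i _; rewrite mul0r.
Qed.

(** The product-to-sum formulas settle the four cases of sines and cosines; the rest is
    bilinearity. *)
Lemma trigM F G : trig F -> trig G -> trig (fun x => F x * G x).
Proof.
have sumD (a b : 'I_m -> R) x : \sum_i (a i + b i) * x i = \sum_i a i * x i + \sum_i b i * x i.
  by rewrite -big_split; apply: eq_bigr => i _; rewrite mulrDl.
have sumB (a b : 'I_m -> R) x : \sum_i (a i - b i) * x i = \sum_i a i * x i - \sum_i b i * x i.
  by rewrite -sumrB; apply: eq_bigr => i _; rewrite mulrBl.
move=> tF; elim: tF G => [a|a|F1 F2 t1 ih1 t2 ih2|c F1 t1 ih1] G tG.
- elim: tG => [b|b|G1 G2 t1 ih1 t2 ih2|c G1 t1 ih1].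
  + apply: trig_ext (trigZ 2^-1 (trigD (trig_cos (fun i => a i + b i)) (trig_cos (fun i => a i - b i)))) _ => x.
    by rewrite sumD sumB cosD cosB; field.
  + apply: trig_ext (trigZ 2^-1 (trigD (trig_sin (fun i => a i + b i)) (trigZ (-1) (trig_sin (fun i => a i - b i))))) _ => x.
    by rewrite sumD sumB sinD sinB; field.
  + by apply: trig_ext (trigD ih1 ih2) _ => x; rewrite mulrDr.
  + by apply: trig_ext (trigZ c ih1) _ => x; rewrite mulrCA.
- elim: tG => [b|b|G1 G2 t1 ih1 t2 ih2|c G1 t1 ih1].
  + apply: trig_ext (trigZ 2^-1 (trigD (trig_sin (fun i => a i + b i)) (trig_sin (fun i => a i - b i)))) _ => x.
    by rewrite sumD sumB sinD sinB; field.
  + apply: trig_ext (trigZ 2^-1 (trigD (trig_cos (fun i => a i - b i)) (trigZ (-1) (trig_cos (fun i => a i + b i))))) _ => x.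
    by rewrite sumB sumD cosB cosD; field.
  + by apply: trig_ext (trigD ih1 ih2) _ => x; rewrite mulrDr.
  + by apply: trig_ext (trigZ c ih1) _ => x; rewrite mulrCA.
- by apply: trig_ext (trigD (ih1 _ tG) (ih2 _ tG)) _ => x; rewrite mulrDl.
- by apply: trig_ext (trigZ c (ih1 _ tG)) _ => x; rewrite mulrA.
Qed.

Lemma trig_sum (I : Type) (r : seq I) (f : I -> ('I_m -> R) -> R) :
  (forall i, trig (f i)) -> trig (fun x => \sum_(i <- r) f i x).
Proof.
move=> tf; elim: r => [|i r ih]; first by apply: trig_ext (trig_cst 0) _ => x; rewrite big_nil.
by apply: trig_ext (trigD (tf i) ih) _ => x; rewrite big_cons.
Qed.

Lemma trig_prod (I : Type) (r : seq I) (f : I -> ('I_m -> R) -> R) :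
  (forall i, trig (f i)) -> trig (fun x => \prod_(i <- r) f i x).
Proof.
move=> tf; elim: r => [|i r ih]; first by apply: trig_ext (trig_cst 1) _ => x; rewrite big_nil.
by apply: trig_ext (trigM (tf i) ih) _ => x; rewrite big_cons.
Qed.

(** A trigonometric expression with values in [[0, 1]], hence a success probability. Its affine
    image [(2 * psin c y - 1) / c] is [sin (c * y) / c], which tends to [y] as [c] tends to 0. *)
Definition psin (c y : R) : R := (1 + sin (c * y)) / 2.

Lemma psin01 c y : 0 <= psin c y <= 1.
Proof.
have := sin_le1 (c * y); have := sin_geN1 (c * y); rewrite /psin => ? ?.
by apply/andP; split; lra.
Qed.

Lemma trig_bw c N k i : trig (fun x => bw (psin c (x i)) N k).
Proof.
have tp : trig (fun x => psin c (x i)).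
  apply: trig_ext (trigZ 2^-1 (trigD (trig_cst 1) (trig_sin (fun j => if j == i then c else 0)))) _ => x.
  rewrite /psin (bigD1 i) //= eqxx big1 ?addr0; first by rewrite mulrC.
  by move=> j /negbTE ->; rewrite mul0r.
elim: N k => [|N ih] k; first exact: trig_cst.
apply: trigD.
  by apply: trigM => //; case: k => [|k]; [exact: trig_cst|exact: ih].
apply: trigM => //; apply: trig_ext (trigD (trig_cst 1) (trigZ (-1) tp)) _ => x.
by rewrite mulN1r.
Qed.

(* Bernstein polynomial in the variables [(1 + sin (c * x i)) / 2]: a trigonometric polynomial,
   close to [h] when [c] is small and [c^2 * N] is large. *)
Definition Bpoly h (c : R) (N : nat) x : R :=
  \sum_(ka : {ffun 'I_m -> 'I_N.+1}) h (fun i => (2 * ((ka i)%:R / N%:R) - 1) / c) *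
     \prod_i bw (psin c (x i)) N (ka i).

Lemma trig_Bpoly h c N : trig (Bpoly h c N).
Proof.
apply: trig_sum => ka; apply: trigM; first exact: trig_cst.
by apply: trig_prod => i; exact: trig_bw.
Qed.

Lemma sum_prod_bw c N x :
  \sum_(ka : {ffun 'I_m -> 'I_N.+1}) \prod_i bw (psin c (x i)) N (ka i) = 1.
Proof.
rewrite -(bigA_distr_bigA (fun i (k : 'I_N.+1) => bw (psin c (x i)) N k)).
by rewrite big1 // => i _; exact: sum_bw.
Qed.

Lemma prod_bw_ge0 c N x (ka : 'I_m -> 'I_N.+1) : 0 <= \prod_i bw (psin c (x i)) N (ka i).
Proof. by apply: prodr_ge0 => i _; apply: bw_ge0; exact: psin01. Qed.

Lemma Bpoly_bound h c N x C : (forall y, `|h y| <= C) -> `|Bpoly h c N x| <= C.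
Proof.
move=> hC; apply: le_trans (ler_norm_sum _ _ _) _.
rewrite -[leRHS]mulr1 -[X in _ <= _ * X](sum_prod_bw c N x) big_distrr /=; apply: ler_sum => ka _.
by rewrite normrM (ger0_norm (prod_bw_ge0 _ _ _)) ler_wpM2r // prod_bw_ge0.
Qed.

(** In each coordinate the first term is the random error of a binomial frequency, magnified by
    [2 / c], and the second is the systematic error [|sin (c x) / c - x|]. *)
Lemma Bpoly_approx h c N x L : 0 <= L ->
  (forall y z, `|h y - h z| <= L * \sum_i `|y i - z i|) -> 0 < c -> (0 < N)%N ->
  `|Bpoly h c N x - h x| <= L * \sum_i (2 / (c * Num.sqrt N%:R) + c ^+ 2 * `|x i| ^+ 3).
Proof.
move=> L0 hL c0 N0.
have -> : Bpoly h c N x - h x = \sum_(ka : {ffun 'I_m -> 'I_N.+1})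
    (h (fun i => (2 * ((ka i)%:R / N%:R) - 1) / c) - h x) * \prod_i bw (psin c (x i)) N (ka i).
  under [RHS]eq_bigr do rewrite mulrBl.
  by rewrite sumrB -[in X in _ = _ - X]big_distrr /= sum_prod_bw mulr1.
apply: le_trans (ler_norm_sum _ _ _) _.
apply: (@le_trans _ _ (\sum_(ka : {ffun 'I_m -> 'I_N.+1}) \sum_j
   L * (`|(2 * ((ka j)%:R / N%:R) - 1) / c - x j| * \prod_i bw (psin c (x i)) N (ka i)))).
  apply: ler_sum => ka _; rewrite normrM (ger0_norm (prod_bw_ge0 _ _ _)).
  apply: le_trans (ler_wpM2r (prod_bw_ge0 _ _ _) (hL _ _)) _.
  rewrite -mulrA mulr_suml big_distrr /=.
  by apply: eq_ler; apply: eq_bigr.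
rewrite exchange_big big_distrr /=; apply: ler_sum => j _.
rewrite -big_distrr /= ler_wpM2l //.
(* Coordinates other than [j] are summed out, their weights having total 1. *)
have -> : \sum_(ka : {ffun 'I_m -> 'I_N.+1}) `|(2 * ((ka j)%:R / N%:R) - 1) / c - x j| *
    \prod_i bw (psin c (x i)) N (ka i) =
   \sum_(k < N.+1) bw (psin c (x j)) N k * `|(2 * (k%:R / N%:R) - 1) / c - x j|.
  pose f i (k : 'I_N.+1) := (if i == j then `|(2 * (k%:R / N%:R) - 1) / c - x j| else 1) *
     bw (psin c (x i)) N k.
  transitivity (\sum_(ka : {ffun 'I_m -> 'I_N.+1}) \prod_i f i (ka i)).
    apply: eq_bigr => ka _; rewrite /f big_split /=; congr (_ * _).
    by rewrite (bigD1 j) //= eqxx big1 ?mulr1 // => i /negbTE ->.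
  rewrite -bigA_distr_bigA (bigD1 j) //= [X in _ * X]big1 ?mulr1.
    by apply: eq_bigr => k _; rewrite /f eqxx mulrC.
  move=> i /negbTE ij; under eq_bigr do rewrite /f ij mul1r; exact: sum_bw.
set p := psin c (x j).
have tri (k : nat) : `|(2 * (k%:R / N%:R) - 1) / c - x j| <=
    2 / c * `|k%:R / N%:R - p| + c ^+ 2 * `|x j| ^+ 3.
  have -> : (2 * (k%:R / N%:R) - 1) / c - x j = 2 / c * (k%:R / N%:R - p) +
      c^-1 * (sin (c * x j) - c * x j).
    by rewrite /p /psin; field; rewrite !gt_eqF // ltr0n.
  apply: le_trans (ler_normD _ _) _; rewrite !normrM (ger0_norm (_ : 0 <= 2)) //.
  have ci0 : 0 <= c^-1 by rewrite invr_ge0 ltW.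
  rewrite (ger0_norm ci0) lerD2l.
  apply: le_trans (ler_wpM2l ci0 (norm_sin_subid_le _)) _.
  rewrite normrM (gtr0_norm c0); apply: eq_ler; field; by rewrite gt_eqF.
apply: (@le_trans _ _ (\sum_(k < N.+1) (2 / c * (bw p N k * `|k%:R / N%:R - p|) +
    c ^+ 2 * `|x j| ^+ 3 * bw p N k))).
  apply: ler_sum => k _; apply: le_trans (ler_wpM2l (bw_ge0 _ _ (psin01 _ _)) (tri k)) _.
  by apply: eq_ler; ring.
rewrite big_split /= -!big_distrr /= sum_bw mulr1 lerD2r invfM mulrA.
apply: ler_wpM2l; first by rewrite divr_ge0 // ltW.
exact: sum_bw_dev (psin01 _ _) N0.
Qed.

End trig_approx.

(** * From characteristic functions to Lipschitz functionals *)

Section fidi.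
Context {R : realType} {d : measure_display} {Om : measurableType d} (P : probability Om R).
Context {m : nat}.
Implicit Types (h : ('I_m -> R) -> R).

Lemma measurable_sum_lin (X : 'I_m -> Om -> R) (a : 'I_m -> R) :
  (forall i, measurable_fun setT (X i)) ->
  measurable_fun setT (fun w => \sum_i a i * X i w).
Proof.
move=> mX; elim: (index_enum _) => [|i r ih].
  by under eq_fun do rewrite big_nil; exact: measurable_cst.
under eq_fun do rewrite big_cons; apply: measurable_funD => //.
by apply: measurable_funM => //; exact: measurable_cst.
Qed.

Lemma bmf_trig (X : 'I_m -> Om -> R) F : (forall i, measurable_fun setT (X i)) ->
  trig F -> bmf (fun w => F (fun i => X i w)).
Proof.
move=> mX; elim=> [a|a|F1 G1 _ h1 _ h2|c F1 _ h1].
- split; last by exists 1 => w; exact: cos_max.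
  apply: measurableT_comp; last exact: measurable_sum_lin.
  by apply: continuous_measurable_fun => x; exact: continuous_cos.
- split; last by exists 1 => w; exact: sin_max.
  apply: measurableT_comp; last exact: measurable_sum_lin.
  by apply: continuous_measurable_fun => x; exact: continuous_sin.
- exact: bmfD.
- exact: bmfZ.
Qed.

Definition lipf h (L : R) := 0 <= L /\ forall y z, `|h y - h z| <= L * \sum_i `|y i - z i|.

(** [h] is a pointwise limit of trigonometric polynomials: with [c = 1 / (l+1)] and [N = (l+1)^4]
    one has [c * sqrt N = l+1], and both error terms of [Bpoly_approx] vanish. *)
Lemma measurable_lipf (X : 'I_m -> Om -> R) h L : (forall i, measurable_fun setT (X i)) ->
  lipf h L -> measurable_fun setT (fun w => h (fun i => X i w)).
Proof.
move=> mX [L0 hL].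
apply: (@measurable_fun_cvg _ _ R setT (fun l w => Bpoly h l.+1%:R^-1 (l.+1 ^ 4) (fun i => X i w))) => //.
  by move=> l; have [] := bmf_trig mX (trig_Bpoly h l.+1%:R^-1 (l.+1 ^ 4)).
move=> w _; set x := fun i => X i w.
apply: (@cvg_err R _ (fun=> h x) (fun l => L * \sum_i (2 * l.+1%:R^-1 + l.+1%:R^-1 ^+ 2 * `|x i| ^+ 3))); last exact: cvg_cst.
  have ci : (fun l : nat => l.+1%:R^-1 : R) @ \oo --> (0 : R) by exact: cvg_harmonic.
  have c1 : (fun l => \sum_i (2 * l.+1%:R^-1 + l.+1%:R^-1 ^+ 2 * `|x i| ^+ 3)) @ \oo -->
      \sum_(i < m) (2 * 0 + 0 ^+ 2 * `|x i| ^+ 3).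
    apply: cvg_finsum => i; apply: cvgD; apply: cvgM => //; try exact: cvg_cst.
    by rewrite expr2; under eq_fun do rewrite expr2; exact: cvgM.
  have h0 : \sum_(i < m) (2 * 0 + 0 ^+ 2 * `|x i| ^+ 3) = 0.
    by rewrite big1 // => i _; rewrite mulr0 expr0n mul0r addr0.
  rewrite h0 in c1; rewrite -[X in _ --> X](mulr0 L).
  by apply: cvgM => //; exact: cvg_cst.
move=> l _; apply: le_trans (Bpoly_approx x L0 hL _ _) _; rewrite ?invr_gt0 ?expn_gt0 //.
rewrite ler_wpM2l //; apply: ler_sum => i _; rewrite lerD2r ler_wpM2l //.
have -> : Num.sqrt (l.+1 ^ 4)%:R = l.+1%:R ^+ 2 :> R.
  by rewrite natrX (_ : 4 = 2 * 2)%N // exprM sqrtr_sqr ger0_norm ?sqr_ge0.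
by apply: eq_ler; field; rewrite gt_eqF // addr_gt0.
Qed.

Lemma bmf_lipf (X : 'I_m -> Om -> R) h L C : (forall i, measurable_fun setT (X i)) ->
  lipf h L -> (forall x, `|h x| <= C) -> bmf (fun w => h (fun i => X i w)).
Proof. by move=> mX hL hC; split; [exact: measurable_lipf hL|exists C => w]. Qed.

Lemma tail_cvg0 (Y : Om -> R) : measurable_fun setT Y ->
  forall e, 0 < e -> exists2 A, 0 < A & pr P [set w | A <= `|Y w|] <= e.
Proof.
move=> mY e e0.
have mS (n : nat) : measurable [set w | n.+1%:R <= `|Y w|].
  have := measurable_fun_ler (measurable_cst (n.+1%:R : R)) (measurableT_comp (@normr_measurable R setT) mY).
  by move=> /(_ measurableT [set true] _); rewrite setTI; apply.
have : (fun n => Ex P (\1_[set w | n.+1%:R <= `|Y w|])) @ \oo --> Ex P (fun=> 0).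
  apply: (@Ex_cvg _ _ _ P _ _ 1) => //.
  - by move=> n w; rewrite indicE; case: (_ \in _); rewrite ?normr0 ?normr1.
  move=> w; apply: cvg_near_cst; near=> n.
  rewrite indicE memNset //= leNgt; apply/negP; rewrite negbK.
  near: n; have := nbhs_infty_gtr `|Y w|; apply: filterS => n h.
  by apply: lt_trans h _; rewrite ltr_nat.
rewrite Ex_cst => /cvgr0Pnorm_le /(_ _ e0) [N _ hN]; exists N.+1%:R => //.
have := hN N (leqnn N); rewrite /= Ex_indic //.
by apply: le_trans; exact: ler_norm.
Unshelve. all: by end_near.
Qed.

Lemma measurable_tail (Y : Om -> R) A : measurable_fun setT Y ->
  measurable [set w | A <= `|Y w|].
Proof.
move=> mY; have := measurable_fun_ler (measurable_cst A) (measurableT_comp (@normr_measurable R setT) mY).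
by move=> /(_ measurableT [set true] _); rewrite setTI; apply.
Qed.

(** A form of the continuity theorem for characteristic functions. [h] is replaced by one polynomial
    [Bpoly h c N], whose expectations converge by hypothesis; the replacement is accurate on a cube,
    and tightness makes the complement of the cube cheap. *)
Lemma fidi_cvg (X : nat -> 'I_m -> Om -> R) (Y : 'I_m -> Om -> R) :
  (forall n i, measurable_fun setT (X n i)) -> (forall i, measurable_fun setT (Y i)) ->
  (forall a, (fun n => Ex P (fun w => cos (\sum_i a i * X n i w))) @ \oo -->
      Ex P (fun w => cos (\sum_i a i * Y i w))) ->
  (forall a, (fun n => Ex P (fun w => sin (\sum_i a i * X n i w))) @ \oo -->
      Ex P (fun w => sin (\sum_i a i * Y i w))) ->
  (forall e, 0 < e -> exists2 A, 0 < A &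
      \forall n \near \oo, forall i, pr P [set w | A <= `|X n i w|] <= e) ->
  forall h L C, lipf h L -> (forall x, `|h x| <= C) ->
  (fun n => Ex P (fun w => h (fun i => X n i w))) @ \oo --> Ex P (fun w => h (fun i => Y i w)).
Proof.
move=> mX mY hc hs tX h L C hL hC.
have C0 : 0 <= C by apply: le_trans (hC (fun=> 0)).
have ctrig F : trig F -> (fun n => Ex P (fun w => F (fun i => X n i w))) @ \oo -->
    Ex P (fun w => F (fun i => Y i w)).
  elim=> [a|a|F1 G1 t1 h1 t2 h2|c F1 t1 h1] //.
  - rewrite ExD; [|exact: bmf_trig|exact: bmf_trig].
    under eq_fun do rewrite (ExD _ (bmf_trig (mX _) t1) (bmf_trig (mX _) t2)).
    exact: cvgD.
  - rewrite ExZ; last exact: bmf_trig.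
    under eq_fun do rewrite (ExZ _ _ (bmf_trig (mX _) t1)).
    by apply: cvgM => //; exact: cvg_cst.
have [L0 hLip] := hL.
apply/cvgrPdist_le => e e0.
(* Two replacements by [Bpoly] and one convergence error amount to [(1 + 4 C m + 4 L m) * e1], which
   the factor 5 covers. *)
pose e1 := e / (5 * (1 + 2 * C * m%:R + L * m%:R)).
have D0 : 0 < 1 + 2 * C * m%:R + L * m%:R.
  by rewrite -addrA ltr_pwDl // addr_ge0 ?mulr_ge0.
have e10 : 0 < e1 by rewrite divr_gt0 // mulr_gt0.
have eE : e = 5 * (1 + 2 * C * m%:R + L * m%:R) * e1.
  by rewrite /e1 [RHS]mulrC divfK // gt_eqF // mulr_gt0.
clearbody e1.
have [A A0 hA] := tX _ e10.
have [A' A'0 hA'] : exists2 A', 0 < A' & forall i, pr P [set w | A' <= `|Y i w|] <= e1.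
  have /choice[f hf] : forall i, exists A', 0 < A' /\ pr P [set w | A' <= `|Y i w|] <= e1.
    by move=> i; have [A' ? ?] := tail_cvg0 (mY i) e10; exists A'.
  exists (1 + \sum_i f i).
    by rewrite ltr_pwDl // sumr_ge0 // => i _; apply: ltW; have [] := hf i.
  move=> i; have [_ hi] := hf i; apply: le_trans hi; apply: pr_le.
  - exact: measurable_tail.
  - exact: measurable_tail.
  - move=> w /=; apply: le_trans; rewrite (bigD1 i) //= addrCA lerDl addr_ge0 //.
    by apply: sumr_ge0 => j _; apply: ltW; have [] := hf j.
have [B1 [AB AB' BA]] : exists B, [/\ A <= B, A' <= B & 1 <= B].
  by exists (1 + A + A'); split; lra.
have B30 : 0 < B1 ^+ 3 by rewrite exprn_gt0 //; lra.
(* On the cube [|x i| <= B1] the systematic error is at most [c^2 * B1^3], hence at most [e1] since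
   [c <= 1]. Only afterwards is [N] taken large, depending on [c]. *)
pose c := Num.min 1 e1 / B1 ^+ 3.
have m10 : 0 < Num.min 1 e1 by rewrite lt_min ltr01.
have c0 : 0 < c by rewrite divr_gt0.
have c1 : c <= 1.
  rewrite ler_pdivrMr // mul1r; apply: (@le_trans _ _ 1); first by rewrite ge_min lexx.
  by rewrite -(expr1n R 3) lerXn2r // nnegrE; lra.
have cB : c ^+ 2 * B1 ^+ 3 <= e1.
  apply: (@le_trans _ _ (c * B1 ^+ 3)).
    by rewrite ler_pM2r // expr2 ler_piMl // ltW.
  by rewrite divfK ?gt_eqF // ge_min lexx orbT.
have [N N0 hN] : exists2 N : nat, (0 < N)%N & 2 / (c * Num.sqrt N%:R) <= e1.
  have := archi_boundP (sqr_ge0 (2 / (c * e1))); set N := Num.bound _ => hN.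
  have NR : 0 < N%:R :> R by apply: le_lt_trans hN; rewrite sqr_ge0.
  exists N; first by rewrite ltr0n in NR.
  have sN : 0 < Num.sqrt N%:R :> R by rewrite sqrtr_gt0.
  rewrite invfM mulrA ler_pdivrMr // [leRHS]mulrC -ler_pdivrMr //.
  have -> : 2 / c / e1 = Num.sqrt ((2 / (c * e1)) ^+ 2).
    have ce : 0 <= 2 / (c * e1) by apply: divr_ge0 => //; apply: mulr_ge0; apply: ltW.
    by rewrite sqrtr_sqr (ger0_norm ce); field; rewrite (gt_eqF c0) (gt_eqF e10).
  by rewrite ler_wsqrtr // ltW.
have close (Z : 'I_m -> Om -> R) : (forall i, measurable_fun setT (Z i)) ->
    (forall i, pr P [set w | B1 <= `|Z i w|] <= e1) ->
    `|Ex P (fun w => h (fun i => Z i w)) - Ex P (fun w => Bpoly h c N (fun i => Z i w))| <=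
     L * m%:R * (2 * e1) + 2 * C * (m%:R * e1).
  move=> mZ hZ; pose E := \big[setU/set0]_(i < m) [set w | B1 <= `|Z i w|].
  have mE : measurable E.
    by apply: bigsetU_measurable => i _; exact: measurable_tail.
  have pE : pr P E <= m%:R * e1.
    apply: le_trans (pr_bigU P (Q := predT) mE (fun i => measurable_tail B1 (mZ i)) _) _.
      by move=> w; rewrite /E -bigcup_seq => -[i /= _ hi]; exists i.
    apply: (@le_trans _ _ (\sum_(i < m) e1)); first by apply: ler_sum => i _; exact: hZ.
    by rewrite sumr_const card_ord mulr_natl.
  apply: le_trans (Ex_dist P (a := L * m%:R * (2 * e1)) (b := 2 * C) _ _ mE _ _ _ _) _.
  - exact: bmf_lipf hL hC.
  - exact: bmf_trig mZ (trig_Bpoly h c N).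
  - move=> w nE; rewrite distrC; apply: le_trans (Bpoly_approx _ L0 hLip c0 N0) _.
    rewrite -mulrA ler_wpM2l //; apply: (@le_trans _ _ (\sum_(i < m) (2 * e1))); last first.
      by rewrite sumr_const card_ord -[leLHS]mulr_natl.
    apply: ler_sum => i _.
    rewrite (_ : 2 * e1 = e1 + e1); last by ring.
    apply: lerD => //; apply: le_trans cB.
    rewrite ler_wpM2l ?sqr_ge0 // lerXn2r // ?nnegrE //; first lra.
    rewrite leNgt; apply/negP => /ltW hi; apply: nE; rewrite /E -bigcup_seq.
    by exists i => //=; rewrite mem_index_enum.
  - move=> w; apply: le_trans (ler_normB _ _) _; rewrite (_ : 2 * C = C + C); last by ring.
    by apply: lerD => //; exact: Bpoly_bound.
  - by rewrite !mulr_ge0 // ltW.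
  - by rewrite mulr_ge0.
  by rewrite lerD2l ler_wpM2l // mulr_ge0.
have hY := close Y mY _; have cvt := ctrig _ (trig_Bpoly h c N).
move/cvgrPdist_le: cvt => /(_ _ e10) cvt; near=> n.
have tr (i : 'I_m) (Z : 'I_m -> Om -> R) A2 : (forall i, measurable_fun setT (Z i)) -> A2 <= B1 ->
    pr P [set w | A2 <= `|Z i w|] <= e1 -> pr P [set w | B1 <= `|Z i w|] <= e1.
  move=> mZ AB2; apply: le_trans; apply: pr_le; try exact: measurable_tail.
  by move=> w /=; exact: le_trans.
have h1 := close Y mY (fun i => tr i Y _ mY AB' (hA' i)).
have h2 : `|Ex P (fun w => Bpoly h c N (fun i => Y i w)) - Ex P (fun w => Bpoly h c N (fun i => X n i w))| <= e1.
  by near: n.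
have h3 : `|Ex P (fun w => h (fun i => X n i w)) - Ex P (fun w => Bpoly h c N (fun i => X n i w))| <=
     L * m%:R * (2 * e1) + 2 * C * (m%:R * e1).
  apply: close => // i; apply: tr AB _ => //; move: i; near: n.
  by apply: hA.
rewrite eE.
set a := Ex P _ in h1 *; set b := Ex P _ in h1 h2; set b' := Ex P _ in h2 h3; set a' := Ex P _ in h3 *.
have -> : a - a' = (a - b) + (b - b') + (b' - a') by ring.
rewrite distrC in h3.
apply: le_trans (ler_normD _ _) _; apply: le_trans (lerD (ler_normD _ _) (lexx _)) _.
apply: le_trans (lerD (lerD h1 h2) h3) _.
have := mulr_ge0 (mulr_ge0 C0 (ler0n R m)) (ltW e10).
have := mulr_ge0 (mulr_ge0 L0 (ler0n R m)) (ltW e10); nra.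
Unshelve. all: by end_near.
Qed.

End fidi.

(** * Normal quantile transform *)

Section quantile.
Context {R : realType}.
Variable N : probability (measurableTypeR R) R.

Definition Ncdf (x : R) : R := fine (N `]-oo, x]%classic).

Lemma NcdfE x : N `]-oo, x]%classic = (Ncdf x)%:E.
Proof. by rewrite /Ncdf fineK // fin_num_measure. Qed.

(** The identity as a random variable, so that [Ncdf] is a distribution function to which the
    general facts apply. *)
Let idR : measurableTypeR R -> R := idfun.

#[local] HB.instance Definition _ :=
  @isMeasurableFun.Build _ _ _ _ idR (@measurable_id _ _ setT).

Lemma cdf_idfunE x : cdf (idR : {RV N >-> R}) x = (Ncdf x)%:E.
Proof. exact: NcdfE. Qed.

Lemma Ncdf_le x y : x <= y -> Ncdf x <= Ncdf y.
Proof. by move=> xy; rewrite -lee_fin -!cdf_idfunE cdf_nondecreasing. Qed.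

Lemma Ncdf_cvgy : Ncdf @ +oo --> (1 : R).
Proof.
have := @cvg_cdfy1 _ _ _ N (idR : {RV N >-> R}).
by move=> /fine_cvg.
Qed.

Lemma Ncdf_cvgNy : Ncdf @ -oo --> (0 : R).
Proof.
have := @cvg_cdfNy0 _ _ _ N (idR : {RV N >-> R}).
by move=> /fine_cvg.
Qed.

Lemma Ncdf_right (x u : R) : (forall y, x < y -> u <= Ncdf y) -> u <= Ncdf x.
Proof.
move=> h; have := @cdf_right_continuous _ _ _ N (idR : {RV N >-> R}) x.
rewrite cdf_idfunE => /fine_cvg cv.
apply: (cvgr_to_ge cv); near=> y; apply: h; near: y; exact: nbhs_right_gt.
Unshelve. all: by end_near.
Qed.

(** The generalised inverse of the distribution function. Outside [(0, 1)] the set may be empty or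
    unbounded below, and 0 is a conventional value. *)
Definition quantile (u : R) : R :=
  if (0 < u < 1) then inf [set x | u <= Ncdf x] else 0.

(** Right continuity makes the infimum attained, whence a Galois connection; it determines both the
    measurability of [quantile] and the law of its composition with a uniform variable. *)
Lemma quantile_le u x : 0 < u < 1 -> (quantile u <= x) = (u <= Ncdf x).
Proof.
move=> u01; rewrite /quantile u01; move/andP: u01 => [u0 u1].
set S := [set y | u <= Ncdf y].
have S0 : S !=set0.
  have /cvgr_ge := Ncdf_cvgy; move=> /(_ _ u1) [M [_ hM]].
  by exists (M + 1); apply: hM; rewrite ltrDl.
have Slb : has_lbound S.
  have /cvgr_lt := Ncdf_cvgNy; move=> /(_ _ u0) [M [_ hM]].
  exists (M - 1) => y uy; rewrite leNgt; apply/negP => yM.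
  have := hM y (lt_trans yM _); rewrite gtrDl ltrN10 => /(_ isT).
  by rewrite ltNge uy.
apply/idP/idP => h; last exact: ge_inf.
apply: Ncdf_right => y xy.
have [z Sz zy] := inf_lt S0 (le_lt_trans h xy).
by apply: le_trans Sz _; exact/Ncdf_le/ltW.
Qed.

Lemma measurable_quantile : measurable_fun setT quantile.
Proof.
apply: (measurability _ (RGenOInfty.measurableE R)) => //= _ [_ [x ->] <-].
rewrite setTI; have -> : quantile @^-1` `]x, +oo[ =
   (`]0, 1[ `&` `]Ncdf x, +oo[) `|` (~` `]0, 1[ `&` [set _ | x < 0]).
  apply/seteqP; split => u /=; rewrite !in_itv /= !andbT.
    case: (boolP (0 < u < 1)) => h; rewrite ltNge.
      by rewrite quantile_le // -ltNge; left.
    by rewrite /quantile (negbTE h) -ltNge; right.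
  move=> [[u01 ux]|[/negP u01 x0]]; first by rewrite ltNge quantile_le // -ltNge.
  by rewrite /quantile (negbTE u01).
apply: measurableU; apply: measurableI => //.
- exact: measurableC.
- by case: (boolP (x < 0)) => h; [rewrite (_ : [set _ | _] = setT)|rewrite (_ : [set _ | _] = set0)] => //; apply/seteqP; split.
Qed.

End quantile.

(** Half-open intervals generate the Borel sets and are stable under intersection; their
    probabilities are differences of distribution functions. *)
Lemma prob_cdf_unique {R : realType} (N1 N2 : probability (measurableTypeR R) R) :
  (forall x, N1 `]-oo, x]%classic = N2 `]-oo, x]%classic) ->
  forall A, measurable A -> N1 A = N2 A.
Proof.
move=> h A mA.
have G1 (N : probability (measurableTypeR R) R) (a b : R) : a < b ->
    N `]a, b]%classic = (N `]-oo, b]%classic - N `]-oo, a]%classic)%E.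
  move=> ab; have -> : `]a, b]%classic = `]-oo, b] `\` `]-oo, a] :> set R.
    by rewrite -[RHS]setCK setCD setCitvl setUC -[LHS]setCK setCitv.
  rewrite measureD ?setIidr//; first by apply: subset_itvl; rewrite bnd_simp ltW.
  by rewrite -ge0_fin_numE// fin_num_measure.
apply: (@g_sigma_algebra_measure_unique _ R (measurableTypeR R) (@ocitv R) _
  (fun k => `](- k.+1%:R)%R, k.+1%:R]%classic) _ _ N1 N2 (@ocitvI R)) => //.
- by move=> X oX; exact: sub_sigma_algebra.
- by move=> k; exact: is_ocitv.
- apply/seteqP; split => // x _.
  have := archi_boundP (normr_ge0 x); set n := Num.bound _ => hn.
  exists n => //=; rewrite in_itv /=.
  have hn1 : `|x| < n.+1%:R by apply: lt_trans hn _; rewrite ltr_nat.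
  by move: hn1; rewrite ltr_norml => /andP[-> /ltW ->].
- move=> _ /ocitvP[->|[[a b] /= ab ->]]; first by rewrite !measure0.
  by rewrite !G1 // !h.
- by move=> k; rewrite (le_lt_trans (probability_le1 _ _)) ?ltry //; apply: sub_sigma_algebra; exact: is_ocitv.
Qed.

(** * Characteristic function of the standard normal law *)

Section normal_chf.
Context {R : realType}.
Local Notation mu := (@lebesgue_measure R).
Local Notation phi := (@normal_pdf R 0 1).

Lemma phiE x : phi x = normal_peak 1 * expR (- (x ^+ 2 / 2)).
Proof.
by rewrite normal_pdfE ?oner_neq0 // /normal_fun subr0 expr1n mulNr.
Qed.

Lemma is_derive_phi (x : R) : is_derive x 1 phi (- (x * phi x)).
Proof.
rewrite (_ : phi = fun x => normal_peak 1 * expR (- (x ^+ 2 / 2))); last first.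
  by apply/funext => y; rewrite phiE.
have d1 : is_derive x 1 (fun x : R => - (x ^+ 2 / 2)) (- x).
  by apply: is_derive_eq; rewrite /GRing.scale /=; field.
have d2 := @is_derive1_comp _ expR _ x _ _ (is_derive_expR _) d1.
have d3 := is_deriveM (is_derive_cst (normal_peak 1) x 1) d2.
by apply: is_derive_eq; rewrite /GRing.scale /=; ring.
Qed.

(** Integrability of [|x| * phi x] is borrowed from the normal density of standard deviation 2: the
    ratio of the exponentials is [exp (3 x^2 / 8)], which is at least [1 + 3 x^2 / 8 >= |x|]. *)
Lemma phi_xbound (x : R) : `|x| * phi x <= (normal_peak 1 / normal_peak 2) * normal_pdf 0 2 x.
Proof.
rewrite phiE normal_pdfE // /normal_fun subr0.
rewrite mulrA divfK ?gt_eqF ?normal_peak_gt0 // mulrCA ler_wpM2l ?normal_peak_ge0 //.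
have -> : - x ^+ 2 / (2 ^+ 2 *+ 2) = - (x ^+ 2 / 2) + 3 * (x ^+ 2 / 8) by field.
rewrite expRD mulrC ler_wpM2l ?expR_ge0 //.
apply: le_trans (expR_ge1Dx _).
rewrite -(real_normK (num_real x)); have := sqr_ge0 (`|x| - 4/3); nra.
Qed.

Lemma integrable_xphi : mu.-integrable setT (EFin \o (fun x => `|x| * phi x)).
Proof.
have mphi := @measurable_normal_pdf R 0 1.
have H : mu.-integrable setT (fun x => ((normal_peak 1 / normal_peak 2)%:E * (normal_pdf 0 2 x)%:E)%E).
  by apply: integrableZl => //; exact: integrable_normal_pdf.
apply: (le_integrable measurableT _ _ H).
- by apply/measurable_EFinP; apply: measurable_funM => //; exact: normr_measurable.
- move=> x _; rewrite /= lee_fin ger0_norm ?mulr_ge0 ?normal_pdf_ge0 //.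
  apply: le_trans (phi_xbound x) _.
  by rewrite ger0_norm // mulr_ge0 ?divr_ge0 ?normal_peak_ge0 ?normal_pdf_ge0.
Qed.

Lemma integrable_bphi (f : R -> R) : measurable_fun setT f -> (forall x, `|f x| <= 1) ->
  mu.-integrable setT (EFin \o (fun x => f x * phi x)).
Proof.
move=> mf f1; apply: (le_integrable measurableT _ _ (integrable_normal_pdf 0 1)).
- by apply/measurable_EFinP; apply: measurable_funM => //; exact: measurable_normal_pdf.
- move=> x _; rewrite /= lee_fin normrM ler_piMl //.
Qed.

Lemma integrable_bxphi (f : R -> R) : measurable_fun setT f -> (forall x, `|f x| <= 1) ->
  mu.-integrable setT (EFin \o (fun x => f x * (x * phi x))).
Proof.
move=> mf f1; apply: (le_integrable measurableT _ _ integrable_xphi).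
- apply/measurable_EFinP; apply: measurable_funM => //; apply: measurable_funM => //.
  exact: measurable_normal_pdf.
- move=> x _; rewrite /= lee_fin !normrM normr_id; apply: ler_piMl => //.
Qed.

Lemma measurable_sin_lin (a th : R) : measurable_fun setT (fun x => sin (a * x + th)).
Proof.
apply: continuous_measurable_fun => x; apply: continuous_comp; last exact: continuous_sin.
by apply: cvgD; [apply: cvgM; [exact: cvg_cst|exact: cvg_id]|exact: cvg_cst].
Qed.

Lemma measurable_cos_lin (a th : R) : measurable_fun setT (fun x => cos (a * x + th)).
Proof.
apply: continuous_measurable_fun => x; apply: continuous_comp; last exact: continuous_cos.
by apply: cvgD; [apply: cvgM; [exact: cvg_cst|exact: cvg_id]|exact: cvg_cst].
Qed.

(* Stein's identity yields the linear differential equation [cos_moment' = - a * cos_moment] in [a]. *)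
Definition cos_moment (th a : R) : R := \int[mu]_x (cos (a * x + th) * phi x).

(** Integration by parts with [phi' = - x phi]: the derivative of [H = sin (a x + th) * phi] has
    integral 0 over the line, because its integrals over growing symmetric intervals are boundary
    terms bounded by [2 * phi n.+1]. *)
Lemma stein_sin (th a : R) :
  \int[mu]_x (sin (a * x + th) * (x * phi x)) = a * cos_moment th a.
Proof.
pose H (x : R) := sin (a * x + th) * phi x.
pose H' (x : R) := a * (cos (a * x + th) * phi x) - sin (a * x + th) * (x * phi x).
have dH (x : R) : is_derive x 1 H (H' x).
  have dp := is_derive_phi x; rewrite /H.
  have ds : is_derive x 1 (fun x => sin (a * x + th)) (cos (a * x + th) * a).
    apply: (@is_derive1_comp _ sin (fun x : R => a * x + th)).
    by apply: is_derive_eq; rewrite /GRing.scale /=; ring.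
  by apply: is_derive_eq; rewrite /GRing.scale /H' /=; ring.
have i1 := integrable_bphi (measurable_cos_lin a th) (fun x => cos_max _).
have i2 := integrable_bxphi (measurable_sin_lin a th) (fun x => sin_max _).
have iH' : mu.-integrable setT (EFin \o H').
  rewrite (_ : EFin \o H' = (fun x => (a%:E * (cos (a * x + th) * phi x)%:E) - (sin (a * x + th) * (x * phi x))%:E)%E); last by apply/funext.
  apply: integrableB => //; exact: integrableZl.
have E : \int[mu]_x H' x = a * cos_moment th a - \int[mu]_x (sin (a * x + th) * (x * phi x)).
  rewrite /H' RintegralB // ?RintegralZl //.
  rewrite (_ : EFin \o _ = (fun x => (a%:E * (cos (a * x + th) * phi x)%:E))%E); last by apply/funext.
  exact: integrableZl.
suff h : \int[mu]_x H' x = 0 by apply/eqP; rewrite -subr_eq0 -opprB oppr_eq0 -E h.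
have cH' : continuous H'.
  have cphi := @continuous_normal_pdf R 0 1 (oner_neq0 _).
  have clin (x : R) : {for x, continuous (fun x : R => a * x + th)}.
    by apply: cvgD; [apply: cvgM; [exact: cvg_cst|exact: cvg_id]|exact: cvg_cst].
  move=> x; apply: cvgB; apply: cvgM; try exact: cvg_cst.
  - apply: cvgM; last exact: cphi.
    by apply: continuous_comp; [exact: clin|exact: continuous_cos].
  - by apply: continuous_comp; [exact: clin|exact: continuous_sin].
  - by apply: cvgM; [exact: cvg_id|exact: cphi].
have FTC (n : nat) : (\int[mu]_(x in `[(- n.+1%:R)%R, n.+1%:R]) (H' x)%:E = (H n.+1%:R - H (- n.+1%:R))%:E)%E.
  rewrite EFinB; apply: continuous_FTC2.
  - by rewrite gtrN.
  - by apply: continuous_subspaceT.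
  - have dc (x : R) : {for x, continuous H}.
      by apply: differentiable_continuous; apply/derivable1_diffP; have [] := dH x.
    split; [by move=> x _; have [] := dH x|exact/cvg_at_right_filter/dc|exact/cvg_at_left_filter/dc].
  - by move=> x _; rewrite derive1E; have [_ ->] := dH x.
have Hphi (x : R) : `|H x| <= phi x.
  by rewrite normrM (ger0_norm (normal_pdf_ge0 _ _ _)) ler_piMl ?normal_pdf_ge0 // sin_max.
(* A crude decay from [exp y >= 1 + y]; convergence to 0 is all that is wanted. *)
have phi_le (n : nat) : phi n.+1%:R <= normal_peak 1 * (2 / n.+1%:R).
  rewrite phiE ler_wpM2l ?normal_peak_ge0 // expRN -[leRHS]invrK lef_pV2 ?posrE ?expR_gt0 ?invr_gt0 ?divr_gt0 //.
  rewrite invf_div; apply: le_trans (expR_ge1Dx _).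
  have := ler1n R n.+1; rewrite ltn0Sn expr2; set N := n.+1%:R; nra.
have cH : (fun n : nat => H n.+1%:R - H (- n.+1%:R)) @ \oo --> (0 : R).
  apply: (@cvg_err R _ (fun=> 0) (fun n => normal_peak 1 * (2 / n.+1%:R) *+ 2)); last exact: cvg_cst.
    rewrite -(mul0rn _ 2) -(mulr0 (normal_peak 1)) -(mulr0 2); apply: cvgMn.
    by apply: cvgM; [exact: cvg_cst|apply: cvgM; [exact: cvg_cst|exact: cvg_harmonic]].
  move=> n _; rewrite subr0; apply: le_trans (ler_normB _ _) _; rewrite mulr2n; apply: lerD.
    exact: le_trans (Hphi _) (phi_le n).
  apply: le_trans (Hphi _) _; apply: le_trans _ (phi_le n).
  by rewrite !phiE sqrrN.
have iH'n n : (\int[mu]_(x in `[(- n.+1%:R)%R, n.+1%:R]) (H' x)%:E = \int[mu]_x (H' x * \1_(`[(- n.+1%:R)%R, n.+1%:R]%classic : set R) x)%:E)%E.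
  rewrite integral_mkcond; apply: eq_integral => x _; rewrite patchE indicE.
  by case: (_ \in _); rewrite ?mulr1 ?mulr0.
have [|||||_ _ cv] := @dominated_convergence _ _ R mu setT measurableT
  (fun n x => (H' x * \1_(`[(- n.+1%:R)%R, n.+1%:R]%classic : set R) x)%:E) (fun x => (H' x)%:E)
  (fun x => (`|H' x|)%:E).
- move=> n; apply/measurable_EFinP; apply: measurable_funM => //.
  by apply: continuous_measurable_fun.
- by apply/measurable_EFinP; apply: continuous_measurable_fun.
- apply: aeW => x _; apply: cvg_near_cst; near=> n.
  rewrite indicE mem_set ?mulr1 //= in_itv /= -ler_norml.
  apply: le_trans (_ : n%:R <= _); last by rewrite ler_nat.
  by apply: ltW; near: n; exact: nbhs_infty_gtr.
- exact: integrable_norm.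
- apply: aeW => x n _; rewrite /= lee_fin normrM ler_piMr // indicE.
  by case: (_ \in _); rewrite ?normr1 ?normr0.
apply: (cvg_unique (@Rhausdorff R) _ cH).
have cv' : (fun n : nat => (H n.+1%:R - H (- n.+1%:R))%:E) @ \oo --> (\int[mu]_x H' x)%:E.
  rewrite /Rintegral fineK; last exact: (integrable_fin_num measurableT iH').
  apply: cvg_trans cv; apply: near_eq_cvg; apply: nearW => n.
  by rewrite /= -iH'n FTC.
exact: (fine_cvg cv').
Unshelve. all: by end_near.
Qed.

(** After differentiation under the integral, [cos_moment th a * exp (a^2 / 2)] has derivative 0 in
    [a] and equals [cos th] at 0. The phase [th] also delivers the sine moment, at
    [th = - pi / 2]. *)
Lemma cos_momentE (th a : R) : cos_moment th a = cos th * expR (- (a ^+ 2 / 2)).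
Proof.
have dG (x : R) : is_derive x 1 (cos_moment th) (- (x * cos_moment th x)).
  pose f (a : R) (x : R) := cos (a * x + th) * phi x.
  have df (u y : R) : is_derive u 1 (f ^~ y) (- (sin (u * y + th) * (y * phi y))).
    have dc : is_derive u 1 (fun u => cos (u * y + th)) (- sin (u * y + th) * y).
      apply: (@is_derive1_comp _ cos (fun u : R => u * y + th)).
      by apply: is_derive_eq; rewrite /GRing.scale /=; ring.
    have d3 := is_deriveM dc (is_derive_cst (phi y) u 1).
    by apply: is_derive_eq; rewrite /GRing.scale /=; ring.
  have Ix : `]x - 1, x + 1[%classic x by rewrite /= in_itv /=; apply/andP; split; lra.
  have intf (u : R) : `]x - 1, x + 1[%classic u -> mu.-integrable setT (EFin \o f u).
    by move=> _; exact: (integrable_bphi (measurable_cos_lin u th) (fun x => cos_max _)).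
  have der (u y : R) : `]x - 1, x + 1[%classic u -> setT y -> derivable (f ^~ y) u 1.
    by move=> _ _; have [] := df u y.
  have p1 (u y : R) : partial1of2 f u y = - (sin (u * y + th) * (y * phi y)).
    by rewrite partial1of2E; have [_ ->] := df u y.
  have ub (u y : R) : `]x - 1, x + 1[%classic u -> setT y -> `|partial1of2 f u y| <= `|y| * phi y.
    move=> _ _; rewrite p1 normrN !normrM (ger0_norm (normal_pdf_ge0 _ _ _)).
    by rewrite ler_piMl ?sin_max // mulr_ge0 // normal_pdf_ge0.
  have G0 (y : R) : 0 <= `|y| * phi y by rewrite mulr_ge0 // normal_pdf_ge0.
  have d1 := derivable_under_integral measurableT Ix intf der G0 integrable_xphi ub.
  have d2 := differentiation_under_integral measurableT Ix intf der G0 integrable_xphi ub.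
  apply: DeriveDef; first exact: d1.
  rewrite -derive1E [LHS]d2 -stein_sin -mulN1r -RintegralZl //; last first.
    exact: (integrable_bxphi (measurable_sin_lin x th) (fun x => sin_max _)).
  by apply: eq_Rintegral => y _; rewrite p1 mulN1r.
have dK (x : R) : is_derive x 1 (fun x => cos_moment th x * expR (x ^+ 2 / 2)) 0.
  have d1 : is_derive x 1 (fun x : R => x ^+ 2 / 2) x.
    by apply: is_derive_eq; rewrite /GRing.scale /=; field.
  have d2 := @is_derive1_comp _ expR _ x _ _ (is_derive_expR _) d1.
  have d3 := is_deriveM (dG x) d2.
  by apply: is_derive_eq; rewrite /GRing.scale /=; ring.
have := is_derive_0_is_cst a 0 dK; rewrite expr0n mul0r expR0 mulr1.
have -> : cos_moment th 0 = cos th.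
  rewrite /cos_moment; under eq_Rintegral do rewrite mul0r add0r.
  rewrite RintegralZl // ?integrable_normal_pdf // /Rintegral integral_normal_pdf /= mulr1 //.
by move=> <-; rewrite -mulrA -expRD subrr expR0 mulr1.
Qed.

Lemma integral_normal_prob01 (f : R -> \bar R) : measurable_fun setT f ->
  (\int[normal_prob 0 1]_x `|f x| < +oo)%E ->
  (\int[normal_prob 0 1]_x f x = \int[mu]_x (f x * (phi x)%:E))%E.
Proof.
move=> mf finf.
have dom := @normal_prob_dominates R 0 1.
rewrite -(Radon_Nikodym_change_of_variables dom)//=; last first.
  by apply/integrableP; split.
apply: ae_eq_integral => //.
- apply: emeasurable_funM => //; apply: (measurable_int mu).
- apply: emeasurable_funM => //=; apply/measurable_EFinP; exact: measurable_normal_pdf.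
- apply: ae_eqe_mul2l => /=.
  rewrite Radon_NikodymE//=.
  case: cid => /= h [h1 h2 h3].
  apply: integral_ae_eq => //=.
  + by apply/measurable_EFinP; exact: measurable_normal_pdf.
  + by move=> E E01 mE; rewrite -h3.
Qed.

Lemma normal_integral_cos (th a : R) :
  (\int[normal_prob 0 1]_x (cos (a * x + th))%:E = (cos th * expR (- (a ^+ 2 / 2)))%:E)%E.
Proof.
have mc := measurable_cos_lin a th.
rewrite integral_normal_prob01 //.
- rewrite -cos_momentE /cos_moment /Rintegral fineK; first by apply: eq_integral => x _; rewrite EFinM.
  by apply: (integrable_fin_num measurableT (integrable_bphi mc _)) => x; exact: cos_max.
- exact/measurable_EFinP.
- apply: (@le_lt_trans _ _ (\int[normal_prob 0 1]_x 1%:E)%E).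
    apply: ge0_le_integral => //.
    + by apply/measurable_EFinP; apply: measurableT_comp.
    + by move=> x _; rewrite /= lee_fin cos_max.
  by rewrite integral_cst //= mul1e (le_lt_trans (probability_le1 _ _)) ?ltry.
Qed.

End normal_chf.

(** * Normal variables from uniform ones *)

Section normal_rv.
Context {R : realType} {d : measure_display} {Om : measurableType d} (P : probability Om R).
Variable U : Om -> R.
Hypothesis mU : measurable_fun setT U.
Hypothesis uU : forall y, 0 <= y <= 1 -> pr P [set w | U w <= y] = y.

Definition gaussq : R -> R := quantile (normal_prob 0 1).

(** Makes the conventional value of [quantile] outside [(0, 1)] immaterial. *)
Lemma uniform_ae : pr P [set w | ~ (0 < U w < 1)] = 0.
Proof.
have mle y : measurable [set w | U w <= y].
  have := measurable_fun_ler mU (measurable_cst y).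
  by move=> /(_ measurableT [set true] _); rewrite setTI; apply.
have mlt y : measurable [set w | U w < y].
  have := measurable_fun_ltr mU (measurable_cst y).
  by move=> /(_ measurableT [set true] _); rewrite setTI; apply.
have h0 : pr P [set w | U w <= 0] = 0 by apply: uU; rewrite lexx ler01.
have h1 : pr P [set w | U w < 1] = 1.
  apply/eqP; rewrite eq_le pr_le1 //=; apply/ler_addgt0Pr => e e0.
  have [e1|e1] := leP e 1; last by have := pr_ge0 P [set w | U w < 1]; lra.
  rewrite -lerBlDr -[leLHS]uU; last by apply/andP; split; lra.
  by apply: pr_le => // w /=; move=> h; apply: le_lt_trans h _; lra.
apply/eqP; rewrite eq_le pr_ge0 andbT.
apply: (@le_trans _ _ (pr P ([set w | U w <= 0] `|` ~` [set w | U w < 1]))).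
  apply: pr_le.
  - have -> : [set w | ~ (0 < U w < 1)] = [set w | U w <= 0] `|` ~` [set w | U w < 1].
      apply/seteqP; split => w /=.
        by move=> /negP; rewrite negb_and -leNgt => /orP[?|/negP]; [left|right].
      by move=> [h|h] /andP[h1' h2']; [move: h; rewrite leNgt h1'|].
    by apply: measurableU => //; exact: measurableC.
  - by apply: measurableU => //; exact: measurableC.
  - move=> w /= /negP; rewrite negb_and -leNgt => /orP[?|/negP]; [by left|by right].
apply: le_trans (prU P _ _) _ => //; first exact: measurableC.
by rewrite h0 prC // h1 subrr addr0.
Qed.

Lemma measurable_gaussq_comp : measurable_fun setT (gaussq \o U).
Proof. by apply: measurableT_comp => //; exact: measurable_quantile. Qed.

(** By [quantile_le] the event coincides, off the null set above, with [U] being at most the normal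
    distribution function at [x]. *)
Lemma gaussq_law x : P [set w | gaussq (U w) <= x] = normal_prob 0 1 `]-oo, x]%classic.
Proof.
have mle y : measurable [set w | U w <= y].
  have := measurable_fun_ler mU (measurable_cst y).
  by move=> /(_ measurableT [set true] _); rewrite setTI; apply.
have mq : measurable [set w | gaussq (U w) <= x].
  have := measurable_fun_ler measurable_gaussq_comp (measurable_cst x).
  by move=> /(_ measurableT [set true] _); rewrite setTI; apply.
have mO : measurable [set w | ~ (0 < U w < 1)].
  have m0 : measurable [set w | 0 < U w].
    have := measurable_fun_ltr (measurable_cst (0 : R)) mU.
    by move=> /(_ measurableT [set true] _); rewrite setTI; apply.
  have m1 : measurable [set w | U w < 1].
    have := measurable_fun_ltr mU (measurable_cst (1 : R)).
    by move=> /(_ measurableT [set true] _); rewrite setTI; apply.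
  rewrite (_ : [set w | _] = ~` ([set w | 0 < U w] `&` [set w | U w < 1])).
    by apply: measurableC; exact: measurableI.
  by apply/seteqP; split => w /= h; [move=> [h1 h2]; apply: h; rewrite h1|move=> /andP].
rewrite NcdfE prE //; congr EFin.
set F := Ncdf _ x.
have F01 : 0 <= F <= 1.
  rewrite /F /Ncdf fine_ge0 //= -lee_fin fineK ?fin_num_measure //; exact: probability_le1.
rewrite -[RHS]uU //.
have sub (A B : set Om) : measurable A -> measurable B ->
    (forall w, 0 < U w < 1 -> A w -> B w) -> pr P A <= pr P B.
  move=> mA mB AB; apply: (@le_trans _ _ (pr P (B `|` [set w | ~ (0 < U w < 1)]))).
    apply: pr_le => //; first exact: measurableU.
    by move=> w Aw; have [h|h] := pselect (0 < U w < 1); [left; exact: AB|right].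
  by apply: le_trans (prU P mB mO) _; rewrite uniform_ae addr0.
apply/eqP; rewrite eq_le; apply/andP; split; apply: sub => // w h /=.
  by rewrite /gaussq quantile_le.
by rewrite /gaussq quantile_le.
Qed.

Lemma Ex_gaussq_cos (th a : R) :
  Ex P (fun w => cos (a * gaussq (U w) + th)) = cos th * expR (- (a ^+ 2 / 2)).
Proof.
pose Z : Om -> measurableTypeR R := gaussq \o U.
have mZ' : measurable_fun setT Z by exact: measurable_gaussq_comp.
pose mZ := @mfun_Sub _ _ Om (measurableTypeR R) Z (mem_set mZ').
have law A : measurable A -> distribution P mZ A = normal_prob 0 1 A.
  by apply: prob_cdf_unique => x; exact: gaussq_law.
have bf : bmf (fun w => cos (a * gaussq (U w) + th)).
  split; last by exists 1 => w; exact: cos_max.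
  exact: measurableT_comp (measurable_cos_lin a th) measurable_gaussq_comp.
apply: EFin_inj; rewrite -normal_integral_cos -ExE //.
rewrite -(@eq_measure_integral _ _ R setT (normal_prob 0 1) (distribution P mZ)); last first.
  by move=> A mA _; exact: law.
rewrite integral_distribution //; last exact: bmf_integrable bf.
by apply/measurable_EFinP; exact: measurable_cos_lin.
Qed.

End normal_rv.

(** * Gaussian sequences *)

Section cholesky.
Context {R : realType}.

(** The quadratic form of [K] at a finitely supported vector, given as a list of weighted indices.
    Repetitions are allowed, so a vector is modified by prepending an entry. *)
Definition qform (K : nat -> nat -> R) (s : seq (R * nat)) : R :=
  \sum_(p <- s) \sum_(q <- s) p.1 * q.1 * K p.2 q.2.

Variable G : nat -> nat -> R.
Hypothesis symG : forall a b, G a b = G b a.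
Hypothesis psdG : forall s, 0 <= qform G s.

(* When the pivot vanishes the division yields 0, which is consistent: positive semidefiniteness
   then forces the whole row to vanish. *)
Fixpoint schur (l : nat) (a b : nat) : R :=
  match l with
  | 0 => G a b
  | l'.+1 => schur l' a b - schur l' a l' * schur l' b l' / schur l' l' l'
  end.

Lemma qform_cons K t l s : (forall a b, K a b = K b a) ->
  qform K ((t, l) :: s) = t ^+ 2 * K l l + 2 * t * (\sum_(p <- s) p.1 * K p.2 l) + qform K s.
Proof.
move=> symK; rewrite /qform !big_cons /=.
under [X in _ + X]eq_bigr do rewrite big_cons /=.
rewrite big_split /= (addrA (_ + _)); congr (_ + _).
have -> : \sum_(j <- s) t * j.1 * K l j.2 = t * \sum_(p <- s) p.1 * K p.2 l.
  by rewrite big_distrr /=; apply: eq_bigr => p _; rewrite symK mulrA.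
have -> : \sum_(i <- s) i.1 * t * K i.2 l = t * \sum_(p <- s) p.1 * K p.2 l.
  by rewrite big_distrr /=; apply: eq_bigr => p _; rewrite -mulrA mulrCA.
ring.
Qed.

(** At the vector [(t, l), (1, a)] a zero pivot leaves an expression affine in [t]. Were its slope
    nonzero, the [t] chosen below would give it the value -1. *)
Lemma psd_diag0 K l a : (forall a b, K a b = K b a) -> (forall s, 0 <= qform K s) ->
  K l l = 0 -> K a l = 0.
Proof.
move=> symK psdK K0; have h t := psdK [:: (t, l); (1, a)].
have {}h t : 0 <= 2 * t * K a l + K a a.
  have := h t; rewrite qform_cons // K0 mulr0 add0r big_cons big_nil /= /qform.
  by rewrite !big_cons !big_nil /= !addr0 !mul1r.
apply/eqP; apply: contraT => Kn.
have := h (- (K a a + 1) / (2 * K a l)).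
have -> : 2 * (- (K a a + 1) / (2 * K a l)) * K a l + K a a = -1 by field.
by rewrite oppr_ge0 ler10.
Qed.

Lemma schur_sym l a b : schur l a b = schur l b a.
Proof. by elim: l a b => [|l ih] a b //=; rewrite ih (mulrC (schur l a l)). Qed.

(** Completing the square: the form of the Schur complement is the minimum of the original form over
    the weight of index [l], attained at [- S / schur l l l]. *)
Lemma schur_psd l s : 0 <= qform (schur l) s.
Proof.
elim: l s => [|l ih] s //.
have -> : qform (schur l.+1) s = qform (schur l) s -
    (\sum_(p <- s) p.1 * schur l p.2 l) ^+ 2 / schur l l l.
  rewrite /qform expr2 mulr_suml mulr_suml -sumrB; apply: eq_bigr => p _.
  rewrite big_distrr /= mulr_suml -sumrB; apply: eq_bigr => q _ /=.
  by rewrite mulrBr; congr (_ - _); rewrite !mulrA; congr (_ / _); ring.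
set S := \sum_(p <- s) _.
have [K0|Kn] := eqVneq (schur l l l) 0.
  by rewrite K0 invr0 mulr0 subr0.
have := ih ((- S / schur l l l, l) :: s); rewrite qform_cons; last exact: schur_sym.
by rewrite -/S; congr (0 <= _); field.
Qed.

(** Step [l] cancels row [l] when the pivot is nonzero; otherwise the row is already zero by
    [psd_diag0]. Rows that vanish keep vanishing. *)
Lemma schur0 l a b : (a < l)%N -> schur l a b = 0.
Proof.
elim: l a b => [|l ih] a b //=; rewrite ltnS leq_eqVlt => /orP[/eqP->|al]; last first.
  by rewrite (ih a b al) (ih a l al) !mul0r subr0.
have [K0|Kn] := eqVneq (schur l l l) 0.
  rewrite K0 mul0r mul0r subr0 schur_sym; apply: psd_diag0 K0; [exact: schur_sym|exact: schur_psd].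
by rewrite mulrAC divff // mul1r schur_sym subrr.
Qed.

Definition chol (a l : nat) : R := schur l a l / Num.sqrt (schur l l l).

(** Each elimination step removes the rank-one kernel of one column of [chol]; after [n > a] steps
    nothing of row [a] is left. *)
Lemma cholE a b n : (a < n)%N -> G a b = \sum_(l < n) chol a l * chol b l.
Proof.
move=> an.
have h m : G a b = \sum_(l < m) chol a l * chol b l + schur m a b.
  elim: m => [|m ih]; first by rewrite big_ord0 add0r.
  rewrite big_ord_recr /= {}[in LHS]ih -addrA; congr (_ + _).
  have d0 : 0 <= schur m m m.
    by have := schur_psd m [:: (1, m)]; rewrite /qform !big_cons !big_nil /= !addr0 !mul1r.
  rewrite /chol mulrACA -invfM -expr2 sqr_sqrtr //; ring.
by rewrite [LHS](h n) schur0 // addr0.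
Qed.

Lemma chol0 a l : (a < l)%N -> chol a l = 0.
Proof. by move=> al; rewrite /chol schur0 // mul0r. Qed.

End cholesky.

(** * Discretisation of a real variable by finitely many thresholds *)

Section step_approx.
Context {R : realType}.

(** A ceiling truncated at [m], written with indicators so as to depend on finitely many events. *)
Definition stepc (m : nat) (y : R) : R := \sum_(j < m) (j%:R < y)%R%:R.

Lemma stepc_bounds m y : 0 <= y ->
  Num.min m%:R y <= stepc m y /\ stepc m y <= m%:R /\ stepc m y <= y + 1.
Proof.
move=> y0; elim: m => [|m [ih1 [ih2 ih3]]].
  rewrite /stepc big_ord0 ge_min lexx; split => //; split => //; lra.
have -> : stepc m.+1 y = stepc m y + (m%:R < y)%R%:R by rewrite /stepc big_ord_recr.
rewrite -natr1; have [my|ym] := ltP m%:R y.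
  rewrite min_l in ih1; last exact: ltW.
  by rewrite /= ge_min; split; [apply/orP; left; lra|split; lra].
rewrite min_r // in ih1.
by rewrite /= ge_min addr0; split; [apply/orP; right|split; lra].
Qed.

(** Rounding on the grid of mesh [1 / (N+1)] in [[-(N+1), N+1]], whence [2 (N+1)^2] thresholds. *)
Definition stepv (N : nat) (z : R) : R :=
  (N.+1%:R)^-1 * stepc (2 * N.+1 * N.+1) ((z + N.+1%:R) * N.+1%:R) - N.+1%:R.

Lemma stepv_cvg z : (fun N => stepv N z) @ \oo --> z.
Proof.
apply/subr_cvg0; apply/cvgr0Pnorm_le => e e0; near=> N.
have NR : 0 < N.+1%:R :> R by [].
have zN : `|z| < N.+1%:R.
  by apply: (@lt_trans _ _ N%:R); [near: N; exact: nbhs_infty_gtr|rewrite ltr_nat].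
have eN : N.+1%:R^-1 <= e.
  by near: N; have /cvgr0Pnorm_le/(_ _ e0) := @cvg_harmonic R; apply: filterS => n /=; apply: le_trans; exact: ler_norm.
apply: le_trans eN.
move: zN; rewrite ltr_norml => /andP[z1 z2].
set y := (z + N.+1%:R) * N.+1%:R.
have y0 : 0 <= y by rewrite mulr_ge0 //; lra.
have y2 : y <= (2 * N.+1 * N.+1)%:R.
  by rewrite !natrM /y; nra.
have [h1 [_ h3]] := stepc_bounds (2 * N.+1 * N.+1) y0; rewrite min_r // in h1.
have zE : z = N.+1%:R^-1 * y - N.+1%:R by rewrite /y; field; rewrite gt_eqF.
rewrite {2}zE /stepv -/y.
have -> : N.+1%:R^-1 * stepc (2 * N.+1 * N.+1) y - N.+1%:R - (N.+1%:R^-1 * y - N.+1%:R) =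
   N.+1%:R^-1 * (stepc (2 * N.+1 * N.+1) y - y) by ring.
rewrite normrM ger0_norm ?invr_ge0 // ler_piMr ?invr_ge0 // ler_norml; apply/andP; split; lra.
Unshelve. all: by end_near.
Qed.

End step_approx.

(** * Gaussian sequences with prescribed covariance *)

Section gaussian_sequence.
Context {R : realType} {T : Type} {d : measure_display} {Om : measurableType d}.
Variables (P : probability Om R) (xi : nat -> Om -> T -> R).
Hypothesis mxi : forall i t, measurable_fun setT (fun w => xi i w t).
Hypothesis indep : forall n (E : nat -> set Om),
  (forall i, (i < n)%N -> exists2 B, @cylm R T B & E i = xi i @^-1` B) ->
  fine (P [set w | forall i, (i < n)%N -> E i w]) = \prod_(i < n) fine (P (E i)).
Hypothesis ident : forall i B, @cylm R T B -> P (xi i @^-1` B) = P (xi 0%N @^-1` B).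
Variables (t0 : T) (z : R -> R).
Hypothesis mz : measurable_fun setT z.
Let Z i w := z (xi i w t0).
Hypothesis chfZ : forall th a, Ex P (fun w => cos (a * Z 0 w + th)) = cos th * expR (- (a ^+ 2 / 2)).

Lemma measurable_Z i : measurable_fun setT (Z i).
Proof. exact: measurableT_comp. Qed.

Lemma chfZ_sin a : Ex P (fun w => sin (a * Z 0 w)) = 0.
Proof.
have := chfZ (- (pi / 2)) a; rewrite cosN cos_pihalf mul0r => <-; congr Ex.
by apply/funext => w; rewrite cosB cos_pihalf sin_pihalf mulr0 add0r mulr1.
Qed.

Lemma chfZ_cos a : Ex P (fun w => cos (a * Z 0 w)) = expR (- (a ^+ 2 / 2)).
Proof.
have := chfZ 0 a; rewrite cos0 mul1r => <-; congr Ex.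
by apply/funext => w; rewrite addr0.
Qed.

Let thr N (j : 'I_(2 * N.+1 * N.+1)) : nat -> set Om :=
  fun i => [set w | j%:R < (Z i w + N.+1%:R) * N.+1%:R].

Lemma Obs_thr N j : Obs xi (@thr N j).
Proof.
apply: (Obs_eval xi t0 (B := [set x | j%:R < (z x + N.+1%:R) * N.+1%:R])).
have mf : measurable_fun setT (fun x => (z x + N.+1%:R) * N.+1%:R).
  by apply: measurable_funM => //; apply: measurable_funD.
have := measurable_fun_ltr (measurable_cst (j%:R : R)) mf.
by move=> /(_ measurableT [set true] _); rewrite setTI; apply.
Qed.

Let sval_ N (x : {ffun 'I_(2 * N.+1 * N.+1) -> bool}) : R :=
  (N.+1%:R)^-1 * (\sum_j (x j)%:R) - N.+1%:R.

Lemma sval_obsv N i w : sval_ (obsv (@thr N) i w) = stepv N (Z i w).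
Proof.
rewrite /sval_ /stepv; congr (_ * _ - _); apply: eq_bigr => j _; rewrite ffunE.
by rewrite /thr /= asboolb.
Qed.

Lemma cvg_re_prod (I : finType) (a b : I -> nat -> R) (al : I -> R) :
  (forall i, a i @ \oo --> al i) -> (forall i, b i @ \oo --> (0 : R)) ->
  (fun N => complex.Re (\prod_i Complex (a i N) (b i N))) @ \oo --> \prod_i al i /\
  (fun N => complex.Im (\prod_i Complex (a i N) (b i N))) @ \oo --> (0 : R).
Proof.
move=> ha hb; elim: (index_enum I) => [|i r [ih1 ih2]].
  rewrite big_nil; split.
    by under eq_fun do rewrite big_nil /=; exact: cvg_cst.
  by under eq_fun do rewrite big_nil /=; exact: cvg_cst.
rewrite big_cons.
have reM (u v : R[i]) : complex.Re (u * v) = complex.Re u * complex.Re v - complex.Im u * complex.Im v by case: u; case: v.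
have imM (u v : R[i]) : complex.Im (u * v) = complex.Re u * complex.Im v + complex.Im u * complex.Re v by case: u; case: v.
split.
  rewrite (_ : (fun N => complex.Re _) = (fun N =>
    a i N * complex.Re (\prod_(j <- r) Complex (a j N) (b j N)) -
    b i N * complex.Im (\prod_(j <- r) Complex (a j N) (b j N)))); last first.
    by apply/funext => N; rewrite big_cons reM.
  rewrite -[X in _ --> X]subr0; apply: cvgB; first exact: cvgM.
  by rewrite -(mulr0 (0 : R)); exact: cvgM.
rewrite (_ : (fun N => complex.Im _) = (fun N =>
    a i N * complex.Im (\prod_(j <- r) Complex (a j N) (b j N)) +
    b i N * complex.Re (\prod_(j <- r) Complex (a j N) (b j N)))); last first.
  by apply/funext => N; rewrite big_cons imM.
rewrite -[X in _ --> X]addr0; apply: cvgD.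
  by rewrite -[X in _ --> X](mulr0 (al i)); exact: cvgM.
by rewrite -[X in _ --> X](mul0r (\prod_(j <- r) al j)); exact: cvgM.
Qed.

(** The product law covers finite-valued variables only. The characteristic function therefore
    factorises for the roundings [stepv N (Z i w)] first, and bounded convergence removes the
    rounding. *)
Lemma iid_normal_chf n (b : 'I_n -> R) :
  Ex P (fun w => cos (\sum_i b i * Z i w)) = expR (- (\sum_i b i ^+ 2) / 2) /\
  Ex P (fun w => sin (\sum_i b i * Z i w)) = 0.
Proof.
have mcos (f : Om -> R) : measurable_fun setT f -> measurable_fun setT (fun w => cos (f w)).
  by apply: measurableT_comp; apply: continuous_measurable_fun => x; exact: continuous_cos.
have msin (f : Om -> R) : measurable_fun setT f -> measurable_fun setT (fun w => sin (f w)).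
  by apply: measurableT_comp; apply: continuous_measurable_fun => x; exact: continuous_sin.
have mst N i : measurable_fun setT (fun w => stepv N (Z i w)).
  apply: measurable_funB => //; apply: measurable_funM => //.
  rewrite (_ : (fun _ => _) = fun w => \sum_(j < 2 * N.+1 * N.+1) 1 * \1_(@thr N j i) w); last first.
    by apply/funext => w; apply: eq_bigr => j _; rewrite mul1r indicE -asbool_mem /= asboolb.
  apply: measurable_sum_lin => j; apply: measurable_indic; exact: Obs_measurable (Obs_thr _).
pose g N (i : 'I_n) (x : {ffun 'I_(2 * N.+1 * N.+1) -> bool}) := b i * sval_ x.
have sumE N w : \sum_(i < n) g N i ([ffun i : 'I_n => obsv (@thr N) i w] i) = \sum_(i < n) b i * stepv N (Z i w).
  by apply: eq_bigr => i _; rewrite /g ffunE sval_obsv.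
have mlin N : measurable_fun setT (fun w => \sum_(i < n) b i * stepv N (Z i w)).
  exact: (measurable_sum_lin (X := fun i w => stepv N (Z i w))).
have mlinZ : measurable_fun setT (fun w => \sum_(i < n) b i * Z i w).
  by apply: (measurable_sum_lin (X := fun (i : 'I_n) w => Z i w)) => i; exact: measurable_Z.
have clin w : (fun N => \sum_(i < n) b i * stepv N (Z i w)) @ \oo --> \sum_(i < n) b i * Z i w.
  by apply: cvg_finsum => i; apply: cvgM; [exact: cvg_cst|exact: stepv_cvg].
have cisN N : Complex (Ex P (fun w => cos (\sum_(i < n) b i * stepv N (Z i w))))
    (Ex P (fun w => sin (\sum_(i < n) b i * stepv N (Z i w)))) =
    \prod_i Complex (Ex P (fun w => cos (b i * stepv N (Z 0 w)))) (Ex P (fun w => sin (b i * stepv N (Z 0 w)))).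
  have e1 (f : R -> R) : Ex P (fun w => f (\sum_(i < n) b i * stepv N (Z i w))) =
      prodE (law P (obsv (@thr N))) (fun ka : {ffun 'I_n -> _} => f (\sum_i g N i (ka i))).
    rewrite -(Ex_law mxi indep ident (obs_obsv (@Obs_thr N)) (fun ka : {ffun 'I_n -> _} => f (\sum_i g N i (ka i)))).
    by congr Ex; apply/funext => w; rewrite sumE.
  have e2 (f : R -> R) i : Ex P (fun w => f (b i * stepv N (Z 0 w))) =
      \sum_x f (g N i x) * law P (obsv (@thr N)) x.
    rewrite -(Ex_law1 mxi ident (obs_obsv (@Obs_thr N)) 0 (fun x => f (g N i x))).
    by congr Ex; apply/funext => w; rewrite /g sval_obsv.
  rewrite !e1 (prodE_cis (law P (obsv (@thr N))) (g N)); apply: eq_bigr => i _.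
  by rewrite /cisE !e2.
have ccos (c : R) : (fun N => Ex P (fun w => cos (c * stepv N (Z 0 w)))) @ \oo --> expR (- (c ^+ 2 / 2)).
  rewrite -chfZ_cos; apply: (@Ex_cvg _ _ _ P _ _ 1).
  - by move=> N; apply: mcos; apply: measurable_funM.
  - by move=> N w; exact: cos_max.
  - by apply: mcos; apply: measurable_funM => //; exact: measurable_Z.
  - move=> w; apply: continuous_cvg; first exact: continuous_cos.
    by apply: cvgM; [exact: cvg_cst|exact: stepv_cvg].
have csin (c : R) : (fun N => Ex P (fun w => sin (c * stepv N (Z 0 w)))) @ \oo --> (0 : R).
  rewrite -(chfZ_sin c); apply: (@Ex_cvg _ _ _ P _ _ 1).
  - by move=> N; apply: msin; apply: measurable_funM.
  - by move=> N w; exact: sin_max.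
  - by apply: msin; apply: measurable_funM => //; exact: measurable_Z.
  - move=> w; apply: continuous_cvg; first exact: continuous_sin.
    by apply: cvgM; [exact: cvg_cst|exact: stepv_cvg].
have [p1 p2] := cvg_re_prod (fun i => ccos (b i)) (fun i => csin (b i)).
have prE0 : \prod_i expR (- (b i ^+ 2 / 2)) = expR (- (\sum_i b i ^+ 2) / 2).
  by rewrite -expR_sum sumrN -mulr_suml mulNr.
rewrite -prE0; split.
  have q1 : (fun N => Ex P (fun w => cos (\sum_(i < n) b i * stepv N (Z i w)))) @ \oo -->
      \prod_i expR (- (b i ^+ 2 / 2)).
    by apply: cvg_trans p1; apply: near_eq_cvg; apply: nearW => N; rewrite -cisN.
  apply: (cvg_unique (@Rhausdorff R) _ q1).
  apply: (@Ex_cvg _ _ _ P _ _ 1) => [N|N w||w]; [exact: mcos|exact: cos_max|exact: mcos|].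
  by apply: continuous_cvg; [exact: continuous_cos|exact: clin].
have q2 : (fun N => Ex P (fun w => sin (\sum_(i < n) b i * stepv N (Z i w)))) @ \oo --> (0 : R).
  by apply: cvg_trans p2; apply: near_eq_cvg; apply: nearW => N; rewrite -cisN.
apply: (cvg_unique (@Rhausdorff R) _ q2).
apply: (@Ex_cvg _ _ _ P _ _ 1) => [N|N w||w]; [exact: msin|exact: sin_max|exact: msin|].
by apply: continuous_cvg; [exact: continuous_sin|exact: clin].
Qed.

Variable G : nat -> nat -> R.
Hypothesis symG : forall a b, G a b = G b a.
Hypothesis psdG : forall s, 0 <= qform G s.

(** Row [i] of the Cholesky factor applied to the i.i.d. normal variables; by triangularity it has
    [i + 1] entries. *)
Definition gseq (i : nat) (w : Om) : R := \sum_(l < i.+1) chol G i l * z (xi l w t0).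

Lemma measurable_gseq i : measurable_fun setT (gseq i).
Proof.
by apply: (measurable_sum_lin (X := fun (l : 'I_i.+1) w => z (xi l w t0))) => l; exact: measurable_Z.
Qed.

Lemma gseq_chf m (s : 'I_m -> nat) (a : 'I_m -> R) :
  Ex P (fun w => cos (\sum_j a j * gseq (s j) w)) =
    expR (- (\sum_i \sum_j a i * a j * G (s i) (s j)) / 2) /\
  Ex P (fun w => sin (\sum_j a j * gseq (s j) w)) = 0.
Proof.
(* A common length exceeding every [s j], to which all rows are extended by zeros. *)
pose n := (\sum_j (s j).+1)%N.
have sn j : (s j < n)%N by rewrite /n (bigD1 j) //= leq_addr.
pose b (l : 'I_n) := \sum_j a j * chol G (s j) l.
have gE w : \sum_j a j * gseq (s j) w = \sum_(l < n) b l * z (xi l w t0).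
  under [RHS]eq_bigr do rewrite mulr_suml.
  rewrite exchange_big /=; apply: eq_bigr => j _.
  under [RHS]eq_bigr do rewrite -mulrA.
  rewrite -big_distrr /= /gseq; congr (_ * _).
  rewrite (big_ord_widen_cond n xpredT (fun l => chol G (s j) l * z (xi l w t0))) //.
  rewrite [LHS]big_mkcond /=; apply: eq_bigr => l _; rewrite ltnS leqNgt.
  by case: ltnP => //= h; rewrite chol0 ?mul0r.
have bE : \sum_l b l ^+ 2 = \sum_i \sum_j a i * a j * G (s i) (s j).
  under eq_bigr do rewrite expr2 big_distrlr /=.
  rewrite exchange_big /=; apply: eq_bigr => i _.
  rewrite exchange_big /=; apply: eq_bigr => j _.
  rewrite (cholE symG psdG _ (sn i)) big_distrr /=.
  by apply: eq_bigr => l _; rewrite mulrACA.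
by rewrite -bE; under eq_fun do rewrite gE; under [X in _ /\ Ex P X = _]eq_fun do rewrite gE; exact: iid_normal_chf.
Qed.

End gaussian_sequence.

(** * Chaining *)

Lemma near_fin (I : finType) (Q : I -> nat -> Prop) :
  (forall i, \forall n \near \oo, Q i n) -> \forall n \near \oo, forall i, Q i n.
Proof.
move=> h; have /choice[N hN] : forall i, exists N, forall n, (N <= n)%N -> Q i n.
  by move=> i; have [N _ hN] := h i; exists N.
exists (\sum_i N i)%N => // n /= hn i; apply: hN; apply: leq_trans hn.
by rewrite (bigD1 i) //= leq_addr.
Qed.

Lemma bounded_series_tail {R : realType} (tau : nat -> R) (B : R) :
  (forall q, 0 <= tau q) -> (forall N, \sum_(q < N) tau q <= B) ->
  forall e, 0 < e -> exists q0, forall q1 N, (q0 <= q1)%N -> \sum_(q1 <= q < N) tau q <= e.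
Proof.
move=> t0 tB e e0.
pose S := [set \sum_(q < N) tau q | N in [set: nat]].
have hS : has_sup S.
  by split; [exists (\sum_(q < 0) tau q); exists 0%N|exists B => _ [N _ <-]].
have [_ [q0 _ <-] hq0] := sup_adherent e0 hS.
exists q0 => q1 N q01.
have [Nq|qN] := leqP N q1; first by rewrite big_geq // ltW.
have hN : \sum_(q < N) tau q <= sup S by apply: ub_le_sup; [case: hS|exists N].
have : \sum_(q < q0) tau q <= \sum_(q < q1) tau q.
  rewrite -!(big_mkord xpredT tau) [in X in _ <= X](big_cat_nat (n := q0)) //= lerDl.
  by apply: sumr_ge0.
move: hN; rewrite -!(big_mkord xpredT tau) [in X in X <= _ -> _](big_cat_nat (n := q1)) //=; last exact: ltnW.
by move: hq0; rewrite -(big_mkord xpredT tau); lra.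
Qed.

(** * Probabilities of symmetric differences *)

Section symdiff.
Context {R : realType} {d : measure_display} {Om : measurableType d} (P : probability Om R).

Definition sd (E F : set Om) : R := pr P (E `\` F) + pr P (F `\` E).

Lemma sd_triangle E F G : measurable E -> measurable F -> measurable G ->
  sd E G <= sd E F + sd F G.
Proof.
move=> mE mF mG; have mD A B : measurable A -> measurable B -> measurable (A `\` B : set Om).
  exact: measurableD.
have h A B C : measurable A -> measurable B -> measurable C ->
    pr P (A `\` C) <= pr P (A `\` B) + pr P (B `\` C).
  move=> mA mB mC; apply: le_trans (prU _ _ _); [|exact: mD|exact: mD].
  apply: pr_le; [exact: mD|by apply: measurableU; exact: mD|].
  by move=> w [Aw Cw]; have [Bw|Bw] := pselect (B w); [right|left].
have := h E F G mE mF mG; have := h G F E mG mF mE; rewrite /sd; lra.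
Qed.

Lemma sd_bracket (L U E F : set Om) : measurable L -> measurable U -> measurable E -> measurable F ->
  L `<=` E -> E `<=` U -> L `<=` F -> F `<=` U -> sd E F <= pr P (U `\` L).
Proof.
move=> mL mU mE mF LE EU LF FU.
rewrite /sd -prUD; [|exact: measurableD|exact: measurableD|].
  apply: pr_le; [by apply: measurableU; exact: measurableD|exact: measurableD|].
  by move=> w [[a b]|[a b]]; split; [exact: EU|by move/LF|exact: FU|by move/LE].
by rewrite -subset0 => w [[? ?] [? ?]].
Qed.

Lemma sd_prI E F : measurable E -> measurable F ->
  sd E F = pr P E - 2 * pr P (E `&` F) + pr P F.
Proof.
move=> mE mF; have := pr_split P mE mF; have := pr_split P mF mE.
by rewrite [F `&` E]setIC /sd => -> ->; ring.
Qed.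

End symdiff.

(** * Chaining with brackets *)

Section chaining.
Context {R : realType} {T : Type} {d : measure_display} {Om : measurableType d}.
Variables (P : probability Om R) (xi : nat -> Om -> T -> R).
Hypothesis mxi : forall i t, measurable_fun setT (fun w => xi i w t).
Hypothesis indep : forall n (E : nat -> set Om),
  (forall i, (i < n)%N -> exists2 B, @cylm R T B & E i = xi i @^-1` B) ->
  fine (P [set w | forall i, (i < n)%N -> E i w]) = \prod_(i < n) fine (P (E i)).
Hypothesis ident : forall i B, @cylm R T B -> P (xi i @^-1` B) = P (xi 0%N @^-1` B).

(** The counts of [E] and [F] differ by at most the number of points between [L] and [U]. Centring
    [E] and [F], and centring that number, each cost at most the expected mass of the bracket,
    whence the factor 2. *)
Lemma Dn_bracket (k : R) n (L U E F : nat -> set Om) w : 0 < k ->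
  Obs xi L -> Obs xi U -> Obs xi E -> Obs xi F ->
  (forall i, L i `<=` E i) -> (forall i, E i `<=` U i) ->
  (forall i, L i `<=` F i) -> (forall i, F i `<=` U i) ->
  `|Dn P k n E w - Dn P k n F w| <= `|Dn P k n U w - Dn P k n L w| +
     2 * Num.sqrt k * (n%:R / k * pr P (U 0%N `\` L 0%N)).
Proof.
move=> k0 oL oU oE oF LE EU LF FU.
have s0 : 0 < Num.sqrt k by rewrite sqrtr_gt0.
have mm (X : nat -> set Om) : Obs xi X -> measurable (X 0%N) by move=> o; exact: (Obs_measurable mxi 0 o).
have LU i : L i `<=` U i by move=> x /LE/EU.
have pUL : pr P (U 0%N) = pr P (L 0%N) + pr P (U 0%N `\` L 0%N).
  by rewrite (pr_split P (mm _ oU) (mm _ oL)) setIidr.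
set p := pr P (U 0%N `\` L 0%N) in pUL *.
have pE1 : pr P (L 0%N) <= pr P (E 0%N) by apply: pr_le (LE _); exact: mm.
have pE2 : pr P (E 0%N) <= pr P (U 0%N) by apply: pr_le (EU _); exact: mm.
have pF1 : pr P (L 0%N) <= pr P (F 0%N) by apply: pr_le (LF _); exact: mm.
have pF2 : pr P (F 0%N) <= pr P (U 0%N) by apply: pr_le (FU _); exact: mm.
have DE (X Y : nat -> set Om) : Dn P k n X w - Dn P k n Y w =
    (Num.sqrt k)^-1 * (\sum_(i < n) (\1_(X i) w - \1_(Y i) w) - n%:R * (pr P (X 0%N) - pr P (Y 0%N))).
  rewrite /Dn -mulrBr -sumrB; congr (_ * _).
  rewrite (eq_bigr (fun i : 'I_n => (\1_(X i) w - \1_(Y i) w) - (pr P (X 0%N) - pr P (Y 0%N)))); last by move=> i _; ring.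
  by rewrite sumrB sumr_const card_ord [in RHS]mulr_natl.
have ind_le (A B : set Om) : A `<=` B -> (\1_A w : R) <= \1_B w.
  move=> AB; rewrite !indicE; case: (boolP (w \in A)) => // wA.
  by rewrite mem_set //; apply: AB; rewrite inE in wA.
pose SU : R := \sum_(i < n) (\1_(U i) w - \1_(L i) w).
have sEF : `|\sum_(i < n) (\1_(E i) w - \1_(F i) w) : R| <= SU.
  apply: le_trans (ler_norm_sum _ _ _) _; apply: ler_sum => i _.
  have := ind_le _ _ (LE i); have := ind_le _ _ (EU i); have := ind_le _ _ (LF i); have := ind_le _ _ (FU i).
  by move=> *; rewrite ler_norml; apply/andP; split; lra.
have -> : 2 * Num.sqrt k * (n%:R / k * p) = (Num.sqrt k)^-1 * (2 * (n%:R * p)).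
  rewrite -[in X in _ / X](sqr_sqrtr (ltW k0)); field; by rewrite gt_eqF.
rewrite !DE !normrM (ger0_norm (_ : 0 <= (Num.sqrt k)^-1)) ?invr_ge0 ?sqrtr_ge0//.
rewrite -mulrDr ler_wpM2l ?invr_ge0 ?sqrtr_ge0//.
have n0 : 0 <= n%:R :> R by [].
have hP : `|n%:R * (pr P (E 0%N) - pr P (F 0%N))| <= n%:R * p.
  rewrite normrM ger0_norm // ler_wpM2l // ler_norml; apply/andP; split; lra.
apply: le_trans (ler_normB _ _) _; apply: le_trans (lerD sEF hP) _.
have -> : pr P (U 0%N) - pr P (L 0%N) = p by rewrite pUL; ring.
have := ler_norm (SU - n%:R * p); lra.
Qed.

Unset Implicit Arguments.
Variables (V : Type) (v0 : V) (k : nat -> R) (A : nat -> V -> nat -> set Om).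
Hypothesis k0 : forall n, (0 < n)%N -> 0 < k n.
Hypothesis koo : k @ \oo --> +oo.
Hypothesis oA : forall n v, Obs xi (A n v).
Variables (K : nat -> finType) (cell : forall q, V -> K q).
Variables (lo up : nat -> forall q, K q -> nat -> set Om).
Hypothesis olo : forall n q c, Obs xi (lo n q c).
Hypothesis oup : forall n q c, Obs xi (up n q c).
Hypothesis loA : forall n q v i, lo n q (cell q v) i `<=` A n v i.
Hypothesis upA : forall n q v i, A n v i `<=` up n q (cell q v) i.
Variables (C : R) (n1 : nat).
Hypothesis C0 : 0 < C.
Hypothesis hbr : forall n q v, (n1 <= n)%N -> n%:R / k n *
   pr P (up n q (cell q v) 0%N `\` lo n q (cell q v) 0%N) <= C * (1/4) ^+ q.
Variables (be : nat -> R) (B : R).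
Hypothesis be1 : forall q, 1 <= be q.
(** The product of cardinalities dominates the three unions taken at level [q]: over cells, over
    pairs of cells, and over links to level [q+1]. One factor 2 pays for the two tails in
    Bernstein's inequality, and [2 ^+ q] makes the exceptional probabilities summable. *)
Hypothesis hbe : forall q, 2 ^+ q.+1 * (#|K q| * #|K q| * #|K q.+1|)%:R <= expR (be q ^+ 2).
Hypothesis sumbe : forall N, \sum_(q < N) (1/2) ^+ q * be q <= B.
Variable r : V -> V -> R.
Hypothesis hr : forall v w, (fun n => n%:R / k n * sd P (A n v 0%N) (A n w 0%N)) @ \oo --> r v w.

Set Implicit Arguments.
Unset Strict Implicit.
Let W n (w : Om) v := Dn P (k n) n (A n v) w.

Let mA n v : measurable (A n v 0%N). Proof. exact: Obs_measurable (oA n v). Qed.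

(** Before the limit this is the triangle inequality for symmetric differences, so the squared
    semimetric may be chained directly. *)
Lemma limit_dist_triangle u v w : r u w <= r u v + r v w.
Proof.
apply: (ler_cvg_to (hr u w) (cvgD (hr u v) (hr v w))); near=> n.
have n0 : (0 < n)%N by near: n; exact: nbhs_infty_gt.
rewrite [X in _ <= X](_ : _ = n%:R / k n * (sd P (A n u 0%N) (A n v 0%N) + sd P (A n v 0%N) (A n w 0%N))); last by rewrite mulrDr.
rewrite ler_wpM2l ?divr_ge0 ?ler0n ?(ltW (k0 n n0)) //.
by apply: sd_triangle; exact: mA.
Unshelve. all: by end_near.
Qed.

Lemma nu_same_cell n q v w : (n1 <= n)%N -> (0 < n)%N -> cell q v = cell q w ->
  n%:R / k n * sd P (A n v 0%N) (A n w 0%N) <= C * (1/4) ^+ q.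
Proof.
move=> n1n n0 e; apply: le_trans (hbr n q v n1n).
rewrite ler_wpM2l ?divr_ge0 ?ler0n ?(ltW (k0 n n0)) //.
apply: sd_bracket => //; try exact: mA.
- exact: Obs_measurable (olo _ _ _).
- exact: Obs_measurable (oup _ _ _).
- by rewrite e; exact: loA.
- by rewrite e; exact: upA.
Qed.

Lemma limit_dist_same_cell q v w : cell q v = cell q w -> r v w <= C * (1/4) ^+ q.
Proof.
move=> e; apply: (cvgr_to_le (hr v w)); near=> n; apply: nu_same_cell => //.
- by near: n; exact: nbhs_infty_ge.
- by near: n; exact: nbhs_infty_gt.
Unshelve. all: by end_near.
Qed.

(** A chosen index in the cell [c], or [v0] if the cell is empty. *)
Definition rep q (c : K q) : V :=
  if pselect (exists v, cell q v = c) is left h then sval (cid h) else v0.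

Lemma cell_rep q v : cell q (rep (cell q v)) = cell q v.
Proof.
rewrite /rep; case: pselect => [h|[]]; last by exists v.
exact: (svalP (cid h)).
Qed.

(* Bernstein's inequality is in its Gaussian regime at level [q]. *)
Definition good n q := 2 * be q * 2 ^+ q <= Num.sqrt (k n) * Num.sqrt C.

(** Consecutive representatives are within [V = 2 C 4^-q] of each other, and [lam q] is such that
    [lam q ^ 2 / (8 V) = be q ^ 2]. *)
Let lam q : R := 4 * Num.sqrt C * ((1/2) ^+ q * be q).

Lemma half_sqr q : ((1/2) ^+ q) ^+ 2 = (1/4) ^+ q :> R.
Proof. by rewrite -exprM mulnC exprM; congr (_ ^+ _); field. Qed.

Lemma half_inv q : 2 ^+ q * (1/2) ^+ q = 1 :> R.
Proof. by rewrite -exprMn (_ : 2 * (1/2) = 1 :> R) ?expr1n //; field. Qed.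

(** The factor [cc] scales deviation and variance alike, so the exponent is multiplied by
    [cc^2 / cc = cc >= 1]. It is 1 along the chain and 2 for the comparison at the starting
    level. *)
Lemma dev_good n q (E F : nat -> set Om) (cc : R) : (0 < n)%N -> Obs xi E -> Obs xi F ->
  1 <= cc -> good n q ->
  n%:R / k n * sd P (E 0%N) (F 0%N) <= cc * (2 * C * (1/4) ^+ q) ->
  measurable [set w | cc * lam q <= `|Dn P (k n) n E w - Dn P (k n) n F w|] /\
  pr P [set w | cc * lam q <= `|Dn P (k n) n E w - Dn P (k n) n F w|] <= 2 * expR (- be q ^+ 2).
Proof.
move=> n0 oE oF cc1 gq nuV.
have sC : 0 < Num.sqrt C by rewrite sqrtr_gt0.
have C2 : Num.sqrt C ^+ 2 = C by rewrite sqr_sqrtr // ltW.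
have h0 : 0 < (1/2) ^+ q :> R by rewrite exprn_gt0.
have q0 : 0 < (1/4) ^+ q :> R by rewrite exprn_gt0.
have b1 := be1 q.
have V0 : 0 < cc * (2 * C * (1/4) ^+ q) by rewrite !mulr_gt0 //; lra.
have l0 : 0 <= cc * lam q by rewrite !mulr_ge0 ?ltW //; lra.
have reg : cc * lam q <= Num.sqrt (k n) * (cc * (2 * C * (1/4) ^+ q)).
  rewrite [X in _ <= X]mulrCA ler_wpM2l //; [lra|].
  have := ler_wpM2r (ltW (mulr_gt0 sC q0)) gq; rewrite /lam (_ : 2 * C * _ = 2 * Num.sqrt C ^+ 2 * (1/4) ^+ q); last by rewrite C2.
  rewrite -half_sqr; have := half_inv q; set a := 2 ^+ q; set b := (1/2) ^+ q => ab.
  have -> : 2 * be q * a * (Num.sqrt C * b ^+ 2) = 2 * be q * (a * b) * b * Num.sqrt C by ring.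
  rewrite ab => h; move: h; set s := Num.sqrt C; set kk := Num.sqrt (k n); nra.
have [m h] := Dn_deviation mxi indep ident oE oF (k0 n n0) V0 nuV l0 reg.
split => //; apply: le_trans h _; rewrite ler_pM2l // ler_expR lerN2.
rewrite /lam -half_sqr in V0 *; rewrite ler_pdivlMr; last by rewrite mulr_gt0.
set b := (1/2) ^+ q in h0 *; rewrite !exprMn C2.
have -> : cc ^+ 2 * (4 ^+ 2 * C * (b ^+ 2 * be q ^+ 2)) =
   cc * (cc * (16 * C * b ^+ 2 * be q ^+ 2)) by ring.
have -> : be q ^+ 2 * (8 * (cc * (2 * C * b ^+ 2))) =
   cc * (16 * C * b ^+ 2 * be q ^+ 2) by ring.
rewrite ler_wpM2l //; first lra.
by rewrite ler_peMl // !mulr_ge0 ?sqr_ge0 ?(ltW C0) ?(ltW h0) //; lra.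
Qed.

Lemma union_dev q (m : nat) : (m <= #|K q| * #|K q| * #|K q.+1|)%N ->
  m%:R * (2 * expR (- be q ^+ 2)) <= (1/2) ^+ q.
Proof.
move=> hm; rewrite expRN -(ler_pM2r (expR_gt0 (be q ^+ 2))) -!mulrA mulVf ?gt_eqF ?expR_gt0 // mulr1.
have h2 : 0 < (1/2) ^+ q :> R by rewrite exprn_gt0.
apply: le_trans (ler_wpM2l (ltW h2) (hbe q)).
rewrite exprS -!mulrA [in X in _ <= X]mulrCA [(1/2)^+q * _]mulrA [(1/2)^+q * _]mulrC half_inv mul1r mulrC ler_pM2l //.
by rewrite ler_nat.
Qed.

(** The union is restricted to [Q] because only cells, or pairs of cells, that actually occur have
    controlled distances. *)
Lemma pr_bigU_dev q (I : finType) (Q : pred I) (F : I -> set Om) :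
  (#|I| <= #|K q| * #|K q| * #|K q.+1|)%N ->
  (forall i, Q i -> measurable (F i) /\ pr P (F i) <= 2 * expR (- be q ^+ 2)) ->
  measurable (\big[setU/set0]_(i | Q i) F i) /\ pr P (\big[setU/set0]_(i | Q i) F i) <= (1/2) ^+ q.
Proof.
move=> hI hF; have mB : measurable (\big[setU/set0]_(i | Q i) F i).
  by apply: bigsetU_measurable => c /hF[].
split => //; apply: le_trans (union_dev hI).
apply: le_trans (pr_bigU (B := fun i => if Q i then F i else set0) (Q := Q) P mB _ _) _.
- by move=> i; case: ifP => [/hF[]|].
- move=> w; elim/big_rec: _ => // i X Qi ih [Fi|/ih//].
  by exists i => //; rewrite Qi.
rewrite (eq_bigr (fun i => pr P (F i))); last by move=> i ->.
apply: le_trans (ler_sum _ (fun i Qi => (hF i Qi).2)) _.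
rewrite sumr_const -[X in X <= _]mulr_natl ler_wpM2r ?mulr_ge0 ?expR_ge0 // ler_nat.
exact: max_card.
Qed.

(** Cells of successive levels need not be nested. A link is a pair of cells containing a common
    index, which bounds the distance of their representatives by the triangle inequality. The
    probability bound is the geometric sum of the [(1/2)^q]. *)
Lemma chain_links n q0 Q : (n1 <= n)%N -> (0 < n)%N -> (q0 <= Q)%N ->
  (forall q, (q0 <= q < Q)%N -> good n q) ->
  exists Bd, [/\ measurable Bd, pr P Bd <= 2 * (1/2) ^+ q0 - 2 * (1/2) ^+ Q &
   forall w, ~ Bd w -> forall v, `|W n w (rep (cell q0 v)) - W n w (rep (cell Q v))| <=
      \sum_(q0 <= q < Q) lam q].
Proof.
move=> n1n n0 q0Q; rewrite -(subnKC q0Q); elim: (Q - q0)%N => {Q q0Q} [|j ih] gd.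
  exists set0; split => //; first by rewrite pr0 addn0 subrr.
  by move=> w _ v; rewrite addn0 subrr normr0 big_geq.
have [|Bd [mB pB hB]] := ih.
  by move=> q /andP[h1 h2]; apply: gd; rewrite h1 /= (ltn_trans h2) // ltn_add2l.
set q := (q0 + j)%N in ih mB pB hB *.
have gq : good n q by apply: gd; rewrite leq_addr /= /q ltn_add2l.
rewrite addnS -/q.
pose ev (c : K q * K q.+1) := [set w | 1 * lam q <= `|Dn P (k n) n (A n (rep c.1)) w - Dn P (k n) n (A n (rep c.2)) w|].
pose Qp (c : K q * K q.+1) := `[< exists v, c = (cell q v, cell q.+1 v) >].
have evP c : Qp c -> measurable (ev c) /\ pr P (ev c) <= 2 * expR (- be q ^+ 2).
  move=> /asboolP[v ->]; apply: dev_good => //.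
  apply: le_trans (ler_wpM2l _ (sd_triangle P (mA _ _) (mA n v) (mA _ _))) _.
    by rewrite divr_ge0 // ltW // k0.
  rewrite mulrDr /=; have h1 := nu_same_cell n1n n0 (cell_rep q v).
  have h2 := nu_same_cell n1n n0 (esym (cell_rep q.+1 v)).
  apply: le_trans (lerD h1 h2) _.
  have h3 : 0 < C * (1/4) ^+ q by rewrite mulr_gt0 // exprn_gt0.
  rewrite exprS; lra.
pose Bl := \big[setU/set0]_(c | Qp c) ev c.
have [mBl pBl] : measurable Bl /\ pr P Bl <= (1/2) ^+ q.
  apply: pr_bigU_dev => //; rewrite card_prod leq_mul2r leq_pmulr ?orbT //.
  by apply/card_gt0P; exists (cell q v0).
exists (Bd `|` Bl); split.
- exact: measurableU.
- apply: le_trans (prU _ mB mBl) _; apply: le_trans (lerD pB pBl) _.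
  rewrite exprS; lra.
move=> w nB v; rewrite big_nat_recr /=; last by rewrite leq_addr.
apply: le_trans (ler_distD (W n w (rep (cell q v))) _ _) _; apply: lerD.
  by apply: hB => hb; apply: nB; left.
rewrite leNgt; apply/negP => /ltW h; apply: nB; right.
rewrite /Bl (bigD1 (cell q v, cell q.+1 v)) /=; last by apply/asboolP; exists v.
by left; rewrite /ev /= mul1r.
Qed.

(** For fixed [n] the left side of [good] grows at least like [2^q], as [be q >= 1]; [Q] precedes
    the first failure after [q0]. *)
Lemma stopping_level n q0 : (0 < n)%N -> good n q0 ->
  exists Q, [/\ (q0 <= Q)%N, forall q, (q0 <= q <= Q)%N -> good n q & ~ good n Q.+1].
Proof.
move=> n0 g0.
have ex : exists j, ~~ `[< good n (q0 + j).+1 >].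
  pose m := Num.bound (Num.sqrt (k n) * Num.sqrt C).
  exists m; apply/asboolP; rewrite /good => h.
  have h1 : Num.sqrt (k n) * Num.sqrt C < m%:R by apply: archi_boundP; rewrite mulr_ge0 ?sqrtr_ge0.
  have h2 : m%:R <= 2 ^+ (q0 + m).+1 :> R.
    by rewrite -natrX ler_nat; apply: leq_trans (ltnW (ltn_expl m (ltnSn 1))) _; rewrite leq_exp2l //; lia.
  have := be1 (q0 + m).+1; set b := be _ in h *; set X := 2 ^+ _ in h h2 *.
  have : 0 <= X by exact: le_trans h2.
  nra.
case: (ex_minnP ex) => j /asboolPn bad hmin.
exists (q0 + j)%N; split => //; first exact: leq_addr.
move=> q /andP[h1 h2]; case: (leqP q q0) => [h3|h3].
  by rewrite (_ : q = q0) //; apply/eqP; rewrite eqn_leq h1 h3.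
have -> : q = (q0 + (q - q0.+1)).+1 by lia.
apply: contrapT => nb; have := hmin (q - q0.+1)%N.
rewrite (asboolF nb) => /(_ isT); lia.
Qed.

(** Here the remaining chain is cut off. The fluctuation of the bracket is at most [lam Q] since [Q]
    is good, and its mean term [2 sqrt k * C 4^-Q] is at most [4 * lam Q.+1] precisely because level
    [Q+1] is not good. *)
Lemma last_link n Q : (n1 <= n)%N -> (0 < n)%N -> good n Q -> ~ good n Q.+1 ->
  exists Bd, [/\ measurable Bd, pr P Bd <= (1/2) ^+ Q &
   forall w, ~ Bd w -> forall v, `|W n w v - W n w (rep (cell Q v))| <= lam Q + 4 * lam Q.+1].
Proof.
move=> n1n n0 gQ bQ; have k0n := k0 n n0.
pose ev (c : K Q) := [set w | 1 * lam Q <= `|Dn P (k n) n (up n Q c) w - Dn P (k n) n (lo n Q c) w|].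
pose Qp (c : K Q) := `[< exists v, c = cell Q v >].
have [mB pB] : measurable (\big[setU/set0]_(c | Qp c) ev c) /\
    pr P (\big[setU/set0]_(c | Qp c) ev c) <= (1/2) ^+ Q.
  apply: pr_bigU_dev.
    have h q : (0 < #|K q|)%N by apply/card_gt0P; exists (cell q v0).
    by rewrite -mulnA leq_pmulr // muln_gt0 !h.
  move=> c /asboolP[v ->]; apply: dev_good => //.
  rewrite mul1r /sd.
  have -> : lo n Q (cell Q v) 0%N `\` up n Q (cell Q v) 0%N = set0.
    by rewrite -subset0 => w [/loA/upA].
  rewrite pr0 addr0; apply: le_trans (hbr n Q v n1n) _.
  have : 0 < C * (1/4) ^+ Q by rewrite mulr_gt0 // exprn_gt0.
  lra.
exists (\big[setU/set0]_(c | Qp c) ev c); split => // w nB v.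
have := cell_rep Q v; set v' := rep _ => e.
apply: le_trans (@Dn_bracket (k n) n (lo n Q (cell Q v)) (up n Q (cell Q v)) _ _ w k0n _ _ _ _ _ _ _ _) _ => //.
- by rewrite -e.
- by rewrite -e.
apply: lerD.
  rewrite leNgt; apply/negP => /ltW h; apply: nB.
  rewrite (bigD1 (cell Q v)) /=; last by apply/asboolP; exists v.
  by left; rewrite /ev /= mul1r.
have s0 := sqrtr_ge0 (k n).
have h1 : 2 * Num.sqrt (k n) * (n%:R / k n * pr P (up n Q (cell Q v) 0%N `\` lo n Q (cell Q v) 0%N)) <=
   2 * Num.sqrt (k n) * (C * (1/4) ^+ Q).
  by rewrite ler_wpM2l ?mulr_ge0 //; exact: hbr.
apply: le_trans h1 _.
have /ltW hb : Num.sqrt (k n) * Num.sqrt C < 2 * be Q.+1 * 2 ^+ Q.+1.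
  by rewrite ltNge; apply/negP => h; apply: bQ.
have sC : 0 < Num.sqrt C by rewrite sqrtr_gt0.
have q1 : 0 < (1/4) ^+ Q :> R by rewrite exprn_gt0.
have := ler_wpM2r (ltW (mulr_gt0 sC q1)) hb.
have C2 : C = Num.sqrt C ^+ 2 by rewrite sqr_sqrtr // ltW.
rewrite /lam [C * _](_ : _ = Num.sqrt C ^+ 2 * (1/4) ^+ Q); last by rewrite -C2.
rewrite -half_sqr.
have := half_inv Q; rewrite ![_ ^+ Q.+1]exprS; set a := 2 ^+ Q; set b := (1/2) ^+ Q => ab.
have -> : 2 * be Q.+1 * (2 * a) * (Num.sqrt C * b ^+ 2) = 4 * be Q.+1 * (a * b) * b * Num.sqrt C by ring.
rewrite ab => h; lra.
Qed.

(** Indices closer than [C 4^-q0] have level-[q0] representatives closer than [3 C 4^-q0]. The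
    increment is split into the step between these representatives and two chains from them, through
    level [Q], to the indices themselves. *)
Lemma asymptotic_equicontinuity eta eps : 0 < eta -> 0 < eps -> exists2 Delta, 0 < Delta &
  \forall n \near \oo, exists Bd, [/\ measurable Bd, pr P Bd <= eps &
    forall w, ~ Bd w -> forall v v', r v v' < Delta -> `|W n w v - W n w v'| <= eta].
Proof.
move=> eta0 eps0; have sC : 0 < Num.sqrt C by rewrite sqrtr_gt0.
have t0 q : 0 <= (1/2) ^+ q * be q.
  by rewrite mulr_ge0 ?exprn_ge0 //; have := be1 q; lra.
(* Each chain costs at most 4 and the middle step at most 2 times the tail sum of [lam]; with the
   factor [4 sqrt C] in [lam] this gives [40 sqrt C]. *)
have [qa hqa] := bounded_series_tail t0 sumbe (divr_gt0 eta0 (mulr_gt0 (ltr0Sn R 39) sC)).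
(* Links and last brackets together fail with probability at most [2 (1/2)^q0], the comparison at
   level [q0] with probability at most [(1/2)^q0]. *)
have [qb hqb] : exists q, 3 * (1/2) ^+ q <= eps.
  have : (fun q => 3 * (1/2) ^+ q : R) @ \oo --> (3 * 0 : R).
    by apply: cvgM; [exact: cvg_cst|apply: cvg_expr; rewrite ger0_norm; lra].
  rewrite mulr0 => /cvgr_le /(_ eps eps0)[q _ hq]; by exists q; apply: hq => /=; exact: leqnn.
pose q0 := maxn qa qb.
have hq0 : 3 * (1/2) ^+ q0 <= eps.
  apply: le_trans hqb; rewrite ler_pM2l // ler_wiXn2l ?leq_maxr //; lra.
have c0 : 0 < C * (1/4) ^+ q0 by rewrite mulr_gt0 // exprn_gt0.
exists (C * (1/4) ^+ q0) => //.
pose Qp (c : K q0 * K q0) := `[< r (rep c.1) (rep c.2) < 3 * (C * (1/4) ^+ q0) >].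
near=> n.
have n0 : (0 < n)%N by near: n; exact: nbhs_infty_gt.
have n1n : (n1 <= n)%N by near: n; exact: nbhs_infty_ge.
have k0n := k0 n n0.
have g0 : good n q0.
  rewrite /good -ler_pdivrMr //.
  have h : (2 * be q0 * 2 ^+ q0 / Num.sqrt C) ^+ 2 <= k n.
    by near: n; move/cvgryPge : koo; exact.
  rewrite -(ler_pXn2r (ltn0Sn 1)) ?nnegrE ?sqrtr_ge0 ?divr_ge0 ?sqrtr_ge0 ?mulr_ge0 ?exprn_ge0 //; last first.
    by have := be1 q0; lra.
  by rewrite sqr_sqrtr // ltW.
(* Finitely many pairs of cells, so the convergence to [r] is uniform over them; the gap between
   [3 C 4^-q0] and [4 C 4^-q0] absorbs the error. *)
have hp : forall c, Qp c -> n%:R / k n * sd P (A n (rep c.1) 0%N) (A n (rep c.2) 0%N) <= 2 * (2 * C * (1/4) ^+ q0).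
  near: n; apply: near_fin => c; have [hc|hc] := pselect (Qp c); last by near=> n => /hc.
  move/asboolP: (hc) => hc'; near=> n => _; apply: ltW.
  near: n; apply: (cvgr_lt _ (hr _ _)); lra.
have [Q [q0Q hg hb]] := stopping_level n0 g0.
have [|B1 [mB1 pB1 hB1]] := chain_links n1n n0 q0Q.
  by move=> q /andP[h1 h2]; apply: hg; rewrite h1 ltnW.
have [|B2 [mB2 pB2 hB2]] := last_link n1n n0 _ hb; first by apply: hg; rewrite q0Q leqnn.
pose ev (c : K q0 * K q0) := [set w | 2 * lam q0 <= `|Dn P (k n) n (A n (rep c.1)) w - Dn P (k n) n (A n (rep c.2)) w|].
pose B3 := \big[setU/set0]_(c | Qp c) ev c.
have [mB3 pB3] : measurable B3 /\ pr P B3 <= (1/2) ^+ q0.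
  apply: pr_bigU_dev.
    by rewrite card_prod leq_pmulr //; apply/card_gt0P; exists (cell q0.+1 v0).
  by move=> c Qc; apply: dev_good => //; [rewrite ler1n|exact: hp].
exists (B1 `|` B2 `|` B3); split.
- by apply: measurableU => //; exact: measurableU.
- apply: (le_trans _ hq0); apply: le_trans (prU P _ mB3) _; first exact: measurableU.
  have := prU P mB1 mB2; have : 0 <= (1/2) ^+ Q :> R by rewrite exprn_ge0.
  lra.
move=> w nB v v' rvv.
have h1 u : `|W n w u - W n w (rep (cell q0 u))| <= lam Q + 4 * lam Q.+1 + \sum_(q0 <= q < Q) lam q.
  apply: le_trans (ler_distD (W n w (rep (cell Q u))) _ _) _; apply: lerD.
    by apply: hB2 => h; apply: nB; left; right.
  by rewrite distrC; apply: hB1 => h; apply: nB; left; left.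
have h2 : `|W n w (rep (cell q0 v)) - W n w (rep (cell q0 v'))| <= 2 * lam q0.
  rewrite leNgt; apply/negP => /ltW h; apply: nB; right.
  rewrite /B3 (bigD1 (cell q0 v, cell q0 v')) /=; first by left.
  apply/asboolP => /=.
  have e1 := limit_dist_same_cell (cell_rep q0 v).
  have e2 := limit_dist_same_cell (esym (cell_rep q0 v')).
  rewrite (_ : 3 * (C * (1/4) ^+ q0) = C * (1/4) ^+ q0 + (C * (1/4) ^+ q0 + C * (1/4) ^+ q0)); last by ring.
  apply: le_lt_trans (limit_dist_triangle _ v _) _; apply: ler_ltD e1 _.
  apply: le_lt_trans (limit_dist_triangle v v' _) _; exact: ltr_leD rvv e2.
have hs : 40 * Num.sqrt C * \sum_(q0 <= q < Q.+2) (1/2) ^+ q * be q <= eta.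
  by rewrite mulrC -ler_pdivlMr ?mulr_gt0 //; apply: hqa; exact: leq_maxl.
have l0 q : 0 <= lam q by rewrite /lam mulr_ge0 // mulr_ge0 // ltW.
have hs' : 10 * \sum_(q0 <= q < Q.+2) lam q <= eta.
  by rewrite /lam -mulr_sumr mulrA (_ : 10 * (4 * Num.sqrt C) = 40 * Num.sqrt C) //; ring.
have S1 : \sum_(q0 <= q < Q.+2) lam q = \sum_(q0 <= q < Q) lam q + lam Q + lam Q.+1.
  by rewrite !big_nat_recr //= ltnW.
have S2 : lam q0 <= \sum_(q0 <= q < Q.+2) lam q.
  by rewrite big_ltn ?lerDl ?sumr_ge0 //; rewrite ltnS ltnW.
have S3 : lam Q + 4 * lam Q.+1 + \sum_(q0 <= q < Q) lam q <= 4 * \sum_(q0 <= q < Q.+2) lam q.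
  have le4 (x : R) : 0 <= x -> x <= 4 * x by move=> x0; rewrite ler_peMl // ler1n.
  rewrite S1 (_ : forall a b c : R, 4 * (a + b + c) = 4 * b + 4 * c + 4 * a); last by move=> *; ring.
  by apply: lerD; [rewrite lerD2r le4|rewrite le4 // sumr_ge0].
have := h1 v; have := h1 v'; rewrite [X in X <= _ -> _]distrC => hv' hv.
apply: le_trans (ler_distD (W n w (rep (cell q0 v))) _ _) _.
apply: le_trans (lerD hv (ler_distD (W n w (rep (cell q0 v'))) _ _)) _.
apply: le_trans (lerD (le_trans (lexx _) S3) (lerD h2 (le_trans hv' S3))) _.
apply: le_trans hs'; set S := \sum_(_ <= _ < _) _ in S2 *.
rewrite (_ : 10 * S = 4 * S + (2 * S + 4 * S)); last by ring.
by rewrite lerD2l lerD2r ler_pM2l.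
Unshelve. all: by end_near.
Qed.

End chaining.

(** * The limit process *)

Section limit_process.
Context {R : realType} {T : Type} {d : measure_display} {Om : measurableType d}.
Variables (P : probability Om R) (xi : nat -> Om -> T -> R).
Hypothesis mxi : forall i t, measurable_fun setT (fun w => xi i w t).
Hypothesis indep : forall n (E : nat -> set Om),
  (forall i, (i < n)%N -> exists2 B, @cylm R T B & E i = xi i @^-1` B) ->
  fine (P [set w | forall i, (i < n)%N -> E i w]) = \prod_(i < n) fine (P (E i)).
Hypothesis ident : forall i B, @cylm R T B -> P (xi i @^-1` B) = P (xi 0%N @^-1` B).
Variables (V : Type) (v0 : V) (k : nat -> R) (A : nat -> V -> nat -> set Om).
Hypothesis k0 : forall n, (0 < n)%N -> 0 < k n.
Hypothesis koo : k @ \oo --> +oo.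
Hypothesis kn0 : (fun n => k n / n%:R) @ \oo --> (0 : R).
Hypothesis oA : forall n v, Obs xi (A n v).
Variable G : V -> V -> R.
Unset Implicit Arguments.
Hypothesis hG : forall v w,
  (fun n => n%:R / k n * pr P (A n v 0%N `&` A n w 0%N)) @ \oo --> G v w.
Set Implicit Arguments.

(** The square of the standard deviation semimetric. *)
Definition sqdist v w := G v v - 2 * G v w + G w w.
Local Notation r := sqdist.

Let mA n v : measurable (A n v 0%N). Proof. exact: Obs_measurable (oA n v). Qed.

Lemma sqdist_cvg v w : (fun n => n%:R / k n * sd P (A n v 0%N) (A n w 0%N)) @ \oo --> r v w.
Proof.
rewrite (_ : (fun n => _) = fun n => n%:R / k n * pr P (A n v 0%N `&` A n v 0%N) -
    2 * (n%:R / k n * pr P (A n v 0%N `&` A n w 0%N)) + n%:R / k n * pr P (A n w 0%N `&` A n w 0%N)).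
  by apply: cvgD; [apply: cvgB; [exact: hG|apply: cvgM; [exact: cvg_cst|exact: hG]]|exact: hG].
by apply/funext => n; rewrite sd_prI // !setIid; ring.
Qed.

Arguments sqdist_cvg : clear implicits.

Lemma covC v w : G v w = G w v.
Proof.
rewrite -(cvg_lim (@Rhausdorff R) (hG v w)) -(cvg_lim (@Rhausdorff R) (hG w v)).
by congr (lim (_ @ \oo)); apply/funext => n; rewrite setIC.
Qed.

Lemma sqdistC v w : r v w = r w v.
Proof. by rewrite /r (covC w v); ring. Qed.

Lemma sqdist_triangle u v w : r u w <= r u v + r v w.
Proof. exact: (limit_dist_triangle mxi k0 oA sqdist_cvg). Qed.

(** Before the limit, two intersections with the same third event differ in probability by at most
    the probability of a symmetric difference. Covariances are thus Lipschitz for the squared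
    semimetric. *)
Lemma cov_dist u v w : `|G u w - G v w| <= r u v.
Proof.
apply: (ler_cvg_to (cvg_norm (cvgB (hG u w) (hG v w))) (sqdist_cvg u v)); near=> n.
have n0 : (0 < n)%N by near: n; exact: nbhs_infty_gt.
have nk : 0 <= n%:R / k n by rewrite divr_ge0 // ltW // k0.
rewrite [X in `|X|](_ : _ = n%:R / k n * (pr P (A n u 0%N `&` A n w 0%N) - pr P (A n v 0%N `&` A n w 0%N))); last by rewrite mulrBr.
rewrite normrM ger0_norm // ler_wpM2l //.
have h (B C D : set Om) : measurable B -> measurable C -> measurable D ->
    pr P (B `&` D) <= pr P (C `&` D) + pr P (B `\` C).
  move=> mB mC mD; apply: le_trans (prU _ _ _); [|exact: measurableI|exact: measurableD].
  apply: pr_le; [exact: measurableI|by apply: measurableU; [exact: measurableI|exact: measurableD]|].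
  by move=> w' [Bw Dw]; have [Cw|Cw] := pselect (C w'); [left|right].
have h1 := h _ _ _ (mA n u) (mA n v) (mA n w).
have h2 := h _ _ _ (mA n v) (mA n u) (mA n w).
have p1 := pr_ge0 P (A n u 0%N `\` A n v 0%N).
have p2 := pr_ge0 P (A n v 0%N `\` A n u 0%N).
rewrite /sd ler_norml; apply/andP; split; lra.
Unshelve. all: by end_near.
Qed.

Lemma cvg_seqsum {X : Type} {F : set_system X} {FF : Filter F} (I : Type) (s : seq I)
    (f : I -> X -> R) (l : I -> R) :
  (forall i, f i @ F --> l i) -> (fun x => \sum_(i <- s) f i x) @ F --> \sum_(i <- s) l i.
Proof.
move=> h; elim: s => [|i s ih].
  by under eq_fun do rewrite big_nil; rewrite big_nil; exact: cvg_cst.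
by under eq_fun do rewrite big_cons; rewrite big_cons; exact: cvgD.
Qed.

(** Before the limit the form is [n / k n] times the second moment of a linear combination of
    indicators. *)
Lemma cov_psd (s : nat -> V) l : 0 <= qform (fun a b => G (s a) (s b)) l.
Proof.
have h : (fun n => \sum_(p <- l) \sum_(q <- l) p.1 * q.1 *
    (n%:R / k n * pr P (A n (s p.2) 0%N `&` A n (s q.2) 0%N))) @ \oo --> qform (fun a b => G (s a) (s b)) l.
  by apply: cvg_seqsum => p; apply: cvg_seqsum => q; apply: cvgM; [exact: cvg_cst|exact: hG].
apply: (cvgr_to_ge h); near=> n.
have n0 : (0 < n)%N by near: n; exact: nbhs_infty_gt.
have nk : 0 <= n%:R / k n by rewrite divr_ge0 // ltW // k0.
rewrite (eq_bigr (fun p => n%:R / k n * \sum_(q <- l) p.1 * q.1 * pr P (A n (s p.2) 0%N `&` A n (s q.2) 0%N))); last first.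
  by move=> p _; rewrite mulr_sumr; apply: eq_bigr => q _; ring.
rewrite -mulr_sumr mulr_ge0 //.
have bI (v : V) : bmf (\1_(A n v 0%N)) by exact: bmf_indic.
have bs : bmf (fun w => \sum_(p <- l) p.1 * \1_(A n (s p.2) 0%N) w) by apply: bmf_sum => p; exact: bmfZ.
suff -> : \sum_(p <- l) \sum_(q <- l) p.1 * q.1 * pr P (A n (s p.2) 0%N `&` A n (s q.2) 0%N) =
    Ex P (fun w => (\sum_(p <- l) p.1 * \1_(A n (s p.2) 0%N) w) * (\sum_(p <- l) p.1 * \1_(A n (s p.2) 0%N) w)).
  rewrite -[leLHS](Ex_cst P); apply: Ex_le; [exact: bmf_cst|exact: bmfM|].
  by move=> w; rewrite -expr2 sqr_ge0.
rewrite (_ : (fun w => _) = fun w => \sum_(p <- l) \sum_(q <- l) (p.1 * q.1) * \1_(A n (s p.2) 0%N `&` A n (s q.2) 0%N) w); last first.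
  apply/funext => w; rewrite mulr_suml; apply: eq_bigr => p _; rewrite mulr_sumr; apply: eq_bigr => q _.
  by rewrite indicI /=; ring.
have bI2 (u v : V) : bmf (\1_(A n u 0%N `&` A n v 0%N)) by apply: bmf_indic; exact: measurableI.
rewrite Ex_sum; last by move=> p; apply: bmf_sum => q; exact: bmfZ.
apply: eq_bigr => p _; rewrite Ex_sum; last by move=> q; exact: bmfZ.
by apply: eq_bigr => q _; rewrite ExZ // Ex_indic //; exact: measurableI.
Unshelve. all: by end_near.
Qed.

Lemma bmf_Dn1 n v : bmf (Dn P (k n) n (A n v)).
Proof. exact: (bmf_Dn mxi indep ident (A := fun _ : 'I_1 => A n v) (fun=> oA n v) (k n) n ord0). Qed.

Lemma Dn_bound (c : R) n (E : nat -> set Om) w : measurable (E 0%N) -> `|Dn P c n E w| <= (Num.sqrt c)^-1 * n%:R.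
Proof.
move=> mE; rewrite /Dn normrM ger0_norm ?invr_ge0 ?sqrtr_ge0 // ler_wpM2l ?invr_ge0 ?sqrtr_ge0 //.
apply: le_trans (ler_norm_sum _ _ _) _.
rewrite -[X in _ <= X%:R]card_ord -sumr_const; apply: ler_sum => i _.
have := pr_ge0 P (E 0%N); have := pr_le1 P mE; rewrite indicE ler_norml.
by case: (_ \in _) => /= ? ?; apply/andP; split; lra.
Qed.

(** Bernstein's inequality against the empty event, for which [Dn] vanishes. [V0] exceeds all
    limiting variances, and [B] is such that [2 * exp (- B^2 / (8 V0)) <= e]. *)
Lemma Dn_tight m (vs : 'I_m -> V) e : 0 < e -> exists2 B, 0 < B &
  \forall n \near \oo, forall i, pr P [set w | B <= `|Dn P (k n) n (A n (vs i)) w|] <= e.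
Proof.
move=> e0; pose V0 := \sum_i (`|G (vs i) (vs i)| + 1) + 1.
have V1 : 0 < V0 by rewrite /V0 ltr_wpDl // sumr_ge0 // => i _; rewrite addr_ge0.
have VG i : G (vs i) (vs i) < V0.
  rewrite /V0 (bigD1 i) //=.
  have : 0 <= \sum_(j | j != i) (`|G (vs j) (vs j)| + 1) by rewrite sumr_ge0 // => j _; rewrite addr_ge0.
  by have := ler_norm (G (vs i) (vs i)); lra.
pose Lg := `|ln (2 / e)| + 1.
have Lg0 : 0 < Lg by rewrite /Lg ltr_wpDl.
pose B := Num.sqrt (8 * V0 * Lg).
have B2 : B ^+ 2 = 8 * V0 * Lg by rewrite sqr_sqrtr // !mulr_ge0 // ltW.
have B0 : 0 < B by rewrite sqrtr_gt0 !mulr_gt0.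
exists B => //.
near=> n.
have n0 : (0 < n)%N by near: n; exact: nbhs_infty_gt.
have k0n := k0 n0.
have hB : B <= Num.sqrt (k n) * V0.
  rewrite -ler_pdivrMr //.
  have h : (B / V0) ^+ 2 <= k n by near: n; move/cvgryPge : koo; exact.
  by rewrite -(ger0_norm (ltW (divr_gt0 B0 V1))) -sqrtr_sqr ler_sqrt // ltW.
have hV : forall i, n%:R / k n * pr P (A n (vs i) 0%N `&` A n (vs i) 0%N) <= V0.
  near: n; apply: near_fin => i; near=> n; apply: ltW.
  near: n; exact: (cvgr_lt _ (hG _ _) _ (VG i)).
move=> i.
have hV' : n%:R / k n * (pr P (A n (vs i) 0%N `\` set0) + pr P (set0 `\` A n (vs i) 0%N)) <= V0.
  by rewrite set0D setD0 pr0 addr0; have := hV i; rewrite setIid.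
have [_ h] := Dn_deviation mxi indep ident (oA n (vs i)) (@Obs0 _ _ _ _ _) k0n V1 hV' (ltW B0) hB.
rewrite (_ : [set w | _] = [set w | B <= `|Dn P (k n) n (A n (vs i)) w - Dn P (k n) n (fun=> set0) w|]); last first.
  by apply/seteqP; split => w /=; rewrite [X in _ - X](_ : _ = 0) ?subr0 // /Dn big1 ?mulr0 // => j _; rewrite indic0 pr0 subr0.
apply: le_trans h _; rewrite B2 (_ : 8 * V0 * Lg / (8 * V0) = Lg); last by field; rewrite gt_eqF.
have : expR (- Lg) <= expR (- ln (2 / e)).
  by rewrite ler_expR lerN2 /Lg; have := ler_norm (ln (2 / e)); lra.
rewrite [X in _ <= X]expRN lnK ?posrE ?divr_gt0 // invf_div.
by move=> h1; lra.
Unshelve. all: by end_near.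
Qed.

Lemma Dn_fidi m (vs : 'I_m -> V) (Y : 'I_m -> Om -> R) :
  (forall i, measurable_fun setT (Y i)) ->
  (forall a, Ex P (fun w => cos (\sum_i a i * Y i w)) =
     expR (- (\sum_i \sum_j a i * a j * G (vs i) (vs j)) / 2) /\
     Ex P (fun w => sin (\sum_i a i * Y i w)) = 0) ->
  forall h L C, lipf h L -> (forall x, `|h x| <= C) ->
  (fun n => Ex P (fun w => h (fun i => Dn P (k n) n (A n (vs i)) w))) @ \oo --> Ex P (fun w => h (fun i => Y i w)).
Proof.
move=> mY cY; apply: (fidi_cvg (X := fun n i => Dn P (k n) n (A n (vs i)))) => //.
- by move=> n i; have [] := bmf_Dn1 n (vs i).
- move=> a; rewrite (cY a).1.
  have [h _] := @Dn_chf_cvg _ _ _ _ P xi mxi indep ident m (fun n i => A n (vs i)) k (fun i j => G (vs i) (vs j)) a (fun n j => oA n (vs j)) k0 koo kn0 (fun i j => hG (vs i) (vs j)).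
  exact: h.
- move=> a; rewrite (cY a).2.
  have [_ h] := @Dn_chf_cvg _ _ _ _ P xi mxi indep ident m (fun n i => A n (vs i)) k (fun i j => G (vs i) (vs j)) a (fun n j => oA n (vs j)) k0 koo kn0 (fun i j => hG (vs i) (vs j)).
  exact: h.
- exact: Dn_tight.
Qed.

Hypothesis TB : forall e, 0 < e -> exists m (c : 'I_m -> V), forall v, exists j, r v (c j) < e.
Hypothesis aec : forall eta eps : R, 0 < eta -> 0 < eps -> exists2 Delta : R, 0 < Delta &
  \forall n \near \oo, exists Bd, [/\ measurable Bd, pr P Bd <= eps &
    forall w, ~ Bd w -> forall v v', r v v' < Delta ->
      `|Dn P (k n) n (A n v) w - Dn P (k n) n (A n v') w| <= eta].

Lemma dense_seq : exists s : nat -> V, forall v e, 0 < e -> exists i, r v (s i) < e.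
Proof.
have /choice[f hf] : forall l : nat, exists f : nat -> V, forall v, exists j, r v (f j) < l.+1%:R^-1.
  move=> l; have [//|m [c hc]] := TB (_ : 0 < l.+1%:R^-1).
  exists (fun j => if insub j is Some j' then c j' else v0) => v.
  by have [j hj] := hc v; exists j; rewrite valK.
exists (fun n => if unpickle n is Some p then f p.1 p.2 else v0) => v e e0.
have [l hl] : exists l : nat, l.+1%:R^-1 < e.
  have [l _ hl] := cvgr_lt _ (@cvg_harmonic R) _ e0; exists l; exact: (hl l (leqnn l)).
have [j hj] := hf l v; exists (pickle (l, j)); rewrite pickleK /=; exact: lt_trans hl.
Qed.

(** * Extension of a Gaussian sequence from a dense set of indices *)

Section extension.
Variables (s : nat -> V) (Z : nat -> Om -> R).
Hypothesis s_dense : forall v e, 0 < e -> exists i, r v (s i) < e.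
Hypothesis mZ : forall i, measurable_fun setT (Z i).
Hypothesis chfZ : forall m (i : 'I_m -> nat) a,
  Ex P (fun w => cos (\sum_j a j * Z (i j) w)) =
    expR (- (\sum_l \sum_j a l * a j * G (s (i l)) (s (i j))) / 2) /\
  Ex P (fun w => sin (\sum_j a j * Z (i j) w)) = 0.

(* Asymptotic equicontinuity only controls finitely many coordinates of [Z] at a time, hence the
   truncation at [m]. *)
Definition osc (eta Delta : R) (m : nat) : set Om :=
  \bigcup_a \bigcup_b (if [&& (a < m)%N, (b < m)%N & r (s a) (s b) < Delta]
     then [set w | eta <= `|Z a w - Z b w|] else set0).

Lemma measurable_osc eta Delta m : measurable (osc eta Delta m).
Proof.
apply: bigcup_measurable => a _; apply: bigcup_measurable => b _; case: ifP => // _.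
by apply: (measurable_tail (Y := fun w => Z a w - Z b w)); exact: measurable_funB.
Qed.

(** The ramp [tm] rises from 0 at increment [eta / 2] to 1 at [eta]. The Lipschitz functional [h]
    thus dominates the indicator of [osc], while for [Dn] it vanishes off the exceptional event for
    [eta / 2]. It matters that [Delta] does not depend on [m]. *)
Lemma osc_bound eta eps : 0 < eta -> 0 < eps -> exists2 Delta, 0 < Delta &
  forall m, pr P (osc eta Delta m) <= eps.
Proof.
move=> eta0 eps0; have eta2 : 0 < eta / 2 by rewrite divr_gt0.
have [Delta D0 hD] := aec eta2 eps0; exists Delta => // m.
pose tm (p : 'I_m * 'I_m) (x : 'I_m -> R) := Num.max 0 (`|x p.1 - x p.2| * (eta / 2)^-1 - 1).
pose Q (p : 'I_m * 'I_m) := r (s p.1) (s p.2) < Delta.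
pose h (x : 'I_m -> R) := Num.min 1 (\sum_(p | Q p) tm p x).
have tm0 p x : 0 <= tm p x by rewrite /tm le_max lexx.
have hC x : `|h x| <= 1.
  rewrite ger0_norm /h ?ge_min ?lexx // le_min ler01 /=; exact: sumr_ge0.
have tmL p x y : `|tm p x - tm p y| <= 2 / (eta / 2) * \sum_i `|x i - y i|.
  have mx (a b : R) : `|Num.max 0 a - Num.max 0 b| <= `|a - b|.
    by rewrite !maxElt; do 2 (case: ifP => ?); rewrite ler_norml; apply/andP; split; move: (ler_norm (a - b)) (ler_norm (b - a)); rewrite [`|b - a|]distrC; lra.
  apply: le_trans (mx _ _) _.
  rewrite opprB addrA subrK -mulrBl normrM [X in _ * X]ger0_norm ?invr_ge0 ?(ltW eta2) //.
  rewrite [X in _ <= X]mulrAC ler_wpM2r ?invr_ge0 ?(ltW eta2) //.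
  have b1 i : `|x i - y i| <= \sum_i `|x i - y i|.
    by rewrite (bigD1 i) //= lerDl sumr_ge0.
  apply: le_trans (ler_dist_dist _ _) _.
  rewrite (_ : x p.1 - x p.2 - (y p.1 - y p.2) = (x p.1 - y p.1) - (x p.2 - y p.2)); last by ring.
  by apply: le_trans (ler_normB _ _) _; have := b1 p.1; have := b1 p.2; lra.
pose L := \sum_(p | Q p) (2 / (eta / 2)).
have hL : lipf h L.
  split; first by apply: sumr_ge0 => p _; rewrite divr_ge0 ?(ltW eta2).
  move=> x y; have mn (a b : R) : `|Num.min 1 a - Num.min 1 b| <= `|a - b|.
    by rewrite !minElt; do 2 (case: ifP => ?); rewrite ler_norml; apply/andP; split; move: (ler_norm (a - b)) (ler_norm (b - a)); rewrite [`|b - a|]distrC; lra.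
  apply: le_trans (mn _ _) _; rewrite -sumrB; apply: le_trans (ler_norm_sum _ _ _) _.
  by rewrite /L mulr_suml; apply: ler_sum => p _; exact: tmL.
have cv := Dn_fidi (vs := fun i : 'I_m => s i) (Y := fun i : 'I_m => Z i) (fun i => mZ i)
  (fun a => chfZ (fun i : 'I_m => nat_of_ord i) a) hL hC.
have bh : bmf (fun w => h (fun i : 'I_m => Z i w)) by apply: (bmf_lipf _ hL hC).
apply: (@le_trans _ _ (Ex P (fun w => h (fun i : 'I_m => Z i w)))).
  rewrite -Ex_indic; last exact: measurable_osc.
  apply: Ex_le => //; first by apply: bmf_indic; exact: measurable_osc.
  move=> w; rewrite indicE; case: (boolP (w \in _)) => [|_]; last first.
    by rewrite /h le_min ler01 /=; exact: sumr_ge0.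
  rewrite inE => -[a _ [b _]]; case: ifP => // /and3P[am bm rab] /= hab.
  rewrite /h le_min lexx /= (bigD1 (Ordinal am, Ordinal bm)) //=.
  apply: ler_wpDr; first exact: sumr_ge0.
  rewrite /tm /= le_max; apply/orP; right.
  rewrite lerBrDr ler_pdivlMr //; lra.
apply: (cvgr_to_le cv); near=> n.
have [Bd [mB pB hB]] : exists Bd, [/\ measurable Bd, pr P Bd <= eps &
    forall w, ~ Bd w -> forall v v', r v v' < Delta ->
      `|Dn P (k n) n (A n v) w - Dn P (k n) n (A n v') w| <= eta / 2] by near: n.
apply: le_trans pB; rewrite -Ex_indic //; apply: Ex_le; [|exact: bmf_indic|].
  by apply: (bmf_lipf _ hL hC) => i; have [] := bmf_Dn1 n (s i).
move=> w; rewrite indicE; case: (boolP (w \in _)) => [_|/negP]; first by rewrite /h ge_min lexx.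
rewrite inE => /hB{}hB; rewrite /h ge_min; apply/orP; right.
rewrite big1 // => p Qp; apply/eqP; rewrite /tm eq_maxl // subr_le0 ler_pdivrMr // mul1r.
exact: hB.
Unshelve. all: by end_near.
Qed.

Definition oscoo (eta Delta : R) : set Om := \bigcup_m osc eta Delta m.

Lemma measurable_oscoo eta Delta : measurable (oscoo eta Delta).
Proof. by apply: bigcup_measurable => m _; exact: measurable_osc. Qed.

Lemma oscoo_bound eta eps : 0 < eta -> 0 < eps -> exists2 Delta, 0 < Delta &
  pr P (oscoo eta Delta) <= eps.
Proof.
move=> eta0 eps0; have [Delta D0 hD] := osc_bound eta0 eps0; exists Delta => //.
have cv : P \o (fun m => osc eta Delta m) @ \oo --> P (oscoo eta Delta).
  apply: nondecreasing_cvg_mu; [by move=> m; exact: measurable_osc|exact: measurable_oscoo|].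
  apply/nondecreasing_seqP => m; apply/subsetPset => w [a _ [b _ hab]].
  exists a => //; exists b => //; move: hab; case: ifP => // /and3P[h1 h2 h3].
  by rewrite !ltnS (ltnW h1) (ltnW h2) h3.
rewrite -lee_fin -prE; last exact: measurable_oscoo.
apply: (cvge_to_le cv); near=> m => /=.
by rewrite prE ?lee_fin //; exact: measurable_osc.
Unshelve. all: by end_near.
Qed.

(** It contains every outcome at which [Z] fails to be uniformly continuous along [s]; the moduli
    are restricted to a countable set. *)
Definition badset : set Om := \bigcup_(j : nat) \bigcap_(l : nat) oscoo j.+1%:R^-1 l.+1%:R^-1.

Lemma measurable_badset : measurable badset.
Proof.
apply: bigcup_measurable => j _; apply: bigcap_measurable; first by exists 0%N.
by move=> l _; exact: measurable_oscoo.
Qed.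

Lemma badset0 : P badset = 0%E.
Proof.
apply/(negligibleP _ measurable_badset); apply: negligible_bigcup => j.
have mI : measurable (\bigcap_(l : nat) oscoo j.+1%:R^-1 l.+1%:R^-1).
  by apply: bigcap_measurable; [exists 0%N|move=> l _; exact: measurable_oscoo].
apply/(negligibleP _ mI); apply: etrans (prE P mI) _; congr (_%:E); apply/eqP; rewrite eq_le pr_ge0 andbT.
apply/ler_addgt0Pr => e e0; rewrite add0r.
have [//|D D0 hD] := @oscoo_bound j.+1%:R^-1 e _ e0.
apply: le_trans hD; apply: pr_le => //; first exact: measurable_oscoo.
have [l _ hl] := cvgr_lt _ (@cvg_harmonic R) _ D0.
move=> w /(_ l Logic.I)[m _ [a _ [b _ hab]]]; exists m => //; exists a => //; exists b => //.
move: hab; case: ifP => // /and3P[-> -> h] /= hh; rewrite (lt_trans h) //.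
exact: (hl l (leqnn l)).
Qed.

Lemma not_badset w : ~ badset w -> forall e, 0 < e -> exists2 D, 0 < D &
  forall a b, r (s a) (s b) < D -> `|Z a w - Z b w| < e.
Proof.
move=> nb e e0; have [j _ hj] := cvgr_lt _ (@cvg_harmonic R) _ e0.
have : exists l : nat, ~ oscoo j.+1%:R^-1 l.+1%:R^-1 w.
  by apply/existsNP => h; apply: nb; exists j => // l _; exact: h.
move=> [l hl]; exists l.+1%:R^-1 => // a b rab.
apply: (lt_le_trans _ (ltW (hj j (leqnn j)))); rewrite ltNge; apply/negP => h; apply: hl.
exists (maxn a b).+1 => //; exists a => //; exists b => //.
by rewrite !ltnS leq_maxl leq_maxr rab.
Qed.

(** Replacing [Z] by 0 on a null set makes every path uniformly continuous, so that later statements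
    carry no exceptional set. *)
Definition Zreg i w : R := Z i w * \1_(~` badset) w.

Lemma measurable_Zreg i : measurable_fun setT (Zreg i).
Proof.
by apply: measurable_funM => //; apply: measurable_indic; apply: measurableC; exact: measurable_badset.
Qed.

Lemma Zreg_uc w e : 0 < e -> exists2 D, 0 < D &
  forall a b, r (s a) (s b) < D -> `|Zreg a w - Zreg b w| < e.
Proof.
rewrite /Zreg indicE => e0; case: (boolP (w \in _)) => h; last first.
  by exists 1 => // a b _; rewrite !mulr0 subrr normr0.
have [|D D0 hD] := not_badset (w := w) _ e0; first by move: h; rewrite inE.
by exists D => // a b /hD; rewrite !mulr1.
Qed.

Lemma approx_ex v (j : nat) : exists i, r v (s i) < j.+1%:R^-1.
Proof. exact: s_dense. Qed.

Definition approx v (j : nat) : nat := sval (cid (approx_ex v j)).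

Lemma approxP v j : r v (s (approx v j)) < j.+1%:R^-1.
Proof. exact: (svalP (cid (approx_ex v j))). Qed.

Lemma approx_near v e : 0 < e -> \forall j \near \oo, r v (s (approx v j)) < e.
Proof.
move=> e0; near=> j; apply: lt_trans (approxP v j) _; near: j; exact: (cvgr_lt _ (@cvg_harmonic R) _ e0).
Unshelve. all: by end_near.
Qed.

Definition lproc (w : Om) (v : V) : R := lim ((fun j => Zreg (approx v j) w) @ \oo).

Lemma lproc_cvg w v : (fun j => Zreg (approx v j) w) @ \oo --> lproc w v.
Proof.
apply/cauchy_cvgP; apply/cauchy_exP => e e0.
have [D D0 hD] := Zreg_uc w e0.
have D2 : 0 < D / 2 by rewrite divr_gt0.
have [j0 _ hj0] := approx_near v D2.
suff : \forall j \near \oo, `|Zreg (approx v j0) w - Zreg (approx v j) w| < e.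
  by move=> h; exists (Zreg (approx v j0) w); rewrite -ball_normE.
near=> j; apply: hD.
apply: (le_lt_trans (sqdist_triangle _ v _)); rewrite sqdistC.
have h1 := hj0 j0 (leqnn j0); have h2 : r v (s (approx v j)) < D / 2 by near: j; exact: approx_near.
by rewrite /= in h1; lra.
Unshelve. all: by end_near.
Qed.

Lemma measurable_lproc v : measurable_fun setT (fun w => lproc w v).
Proof.
apply: (@measurable_fun_cvg _ _ R setT (fun j w => Zreg (approx v j) w)) => //.
  by move=> j; exact: measurable_Zreg.
by move=> w _; exact: lproc_cvg.
Qed.

Lemma lproc_uc w e : 0 < e -> exists2 D, 0 < D &
  forall v v', r v v' < D -> `|lproc w v - lproc w v'| <= e.
Proof.
move=> e0; have [D D0 hD] := Zreg_uc w e0.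
have D3 : 0 < D / 3 by rewrite divr_gt0.
exists (D / 3) => // v v' rvv.
apply: (cvgr_to_le (cvg_norm (cvgB (@lproc_cvg w v) (@lproc_cvg w v')))); near=> j.
apply: ltW; apply: hD.
have h1 : r v (s (approx v j)) < D / 3 by near: j; exact: approx_near.
have h2 : r v' (s (approx v' j)) < D / 3 by near: j; exact: approx_near.
have := sqdist_triangle (s (approx v j)) v (s (approx v' j)).
have := sqdist_triangle v v' (s (approx v' j)); have := sqdistC (s (approx v j)) v; lra.
Unshelve. all: by end_near.
Qed.

(** Total boundedness leaves finitely many values to bound, up to an oscillation of 1. *)
Lemma uc_lbounded (f : V -> R) :
  (exists2 D, 0 < D & forall v v', r v v' < D -> `|f v - f v'| <= 1) -> lbounded f.
Proof.
move=> [D D0 hD]; have [m [c hc]] := TB D0.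
exists (1 + \sum_i `|f (c i)|) => v; have [j hj] := hc v.
have h : `|f (c j)| <= \sum_i `|f (c i)| by rewrite (bigD1 j) //= lerDl sumr_ge0.
by have := hD _ _ hj; have := ler_normD (f v - f (c j)) (f (c j)); rewrite subrK; lra.
Qed.

Lemma lproc_lbounded w : lbounded (lproc w).
Proof. by apply: uc_lbounded; exact: lproc_uc. Qed.

Lemma Zreg_chf m (i : 'I_m -> nat) a :
  Ex P (fun w => cos (\sum_j a j * Zreg (i j) w)) =
    expR (- (\sum_l \sum_j a l * a j * G (s (i l)) (s (i j))) / 2) /\
  Ex P (fun w => sin (\sum_j a j * Zreg (i j) w)) = 0.
Proof.
have [h1 h2] := chfZ i a; rewrite -{}h1 -[X in _ /\ _ = X]h2.
have mB := measurable_badset.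
have pB : pr P badset = 0 by rewrite /pr badset0.
have E w : ~ badset w -> \sum_j a j * Zreg (i j) w = \sum_j a j * Z (i j) w.
  by move=> nb; apply: eq_bigr => j _; rewrite /Zreg indicE mem_set // mulr1.
have main (f : R -> R) : measurable_fun setT f -> (forall x, `|f x| <= 1) ->
    Ex P (fun w => f (\sum_j a j * Zreg (i j) w)) = Ex P (fun w => f (\sum_j a j * Z (i j) w)).
  move=> mf f1; apply/eqP; rewrite -subr_eq0 -normr_le0.
  have b (Y : nat -> Om -> R) : (forall i, measurable_fun setT (Y i)) ->
      bmf (fun w => f (\sum_j a j * Y (i j) w)).
    move=> mY; split; last by exists 1 => w; exact: f1.
    by apply: measurableT_comp => //; apply: (measurable_sum_lin (X := fun j => Y (i j))) => j.
  have := @Ex_dist _ _ _ P _ _ badset 0 2 (b _ measurable_Zreg) (b _ mZ) mB.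
  rewrite pB mulr0 addr0; apply => //.
    by move=> w nb; rewrite E // subrr normr0.
  by move=> w; apply: le_trans (ler_normB _ _) _; apply: lerD.
split; apply: main.
- exact: (continuous_measurable_fun (@continuous_cos R)).
- by move=> x; rewrite ler_norml cos_geN1 cos_le1.
- exact: (continuous_measurable_fun (@continuous_sin R)).
- by move=> x; rewrite ler_norml sin_geN1 sin_le1.
Qed.

Lemma cov_cvg v v' : (fun j => G (s (approx v j)) (s (approx v' j))) @ \oo --> G v v'.
Proof.
apply/cvgrPdist_le => e e0; have e2 : 0 < e / 2 by rewrite divr_gt0.
near=> j.
have h1 : r v (s (approx v j)) < e / 2 by near: j; exact: approx_near.
have h2 : r v' (s (approx v' j)) < e / 2 by near: j; exact: approx_near.
have := cov_dist v (s (approx v j)) v'.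
have := cov_dist v' (s (approx v' j)) (s (approx v j)); rewrite !(covC _ (s (approx v j))) => h3 h4.
apply: le_trans (ler_distD (G v' (s (approx v j))) _ _) _.
by rewrite (covC v v') (covC v' (s _)) -(covC v v'); lra.
Unshelve. all: by end_near.
Qed.

Lemma lproc_chf m (vs : 'I_m -> V) a :
  Ex P (fun w => cos (\sum_j a j * lproc w (vs j))) =
    expR (- (\sum_l \sum_j a l * a j * G (vs l) (vs j)) / 2) /\
  Ex P (fun w => sin (\sum_j a j * lproc w (vs j))) = 0.
Proof.
have main (f : R -> R) : continuous f -> (forall x, `|f x| <= 1) ->
   (fun l => Ex P (fun w => f (\sum_j a j * Zreg (approx (vs j) l) w))) @ \oo -->
   Ex P (fun w => f (\sum_j a j * lproc w (vs j))).
  move=> cf f1; apply: (@Ex_cvg _ _ _ P _ _ 1).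
  - move=> l; apply: measurableT_comp; first exact: continuous_measurable_fun.
    by apply: (measurable_sum_lin (X := fun j => Zreg (approx (vs j) l))) => j; exact: measurable_Zreg.
  - by move=> l w; exact: f1.
  - apply: measurableT_comp; first exact: continuous_measurable_fun.
    by apply: (measurable_sum_lin (X := fun j w => lproc w (vs j))) => j; exact: measurable_lproc.
  move=> w; apply: (cvg_comp _ f); last exact: cf.
  by apply: cvg_finsum => j; apply: cvgM; [exact: cvg_cst|exact: lproc_cvg].
have c1 : forall x : R, `|cos x| <= 1 by move=> x; rewrite ler_norml cos_geN1 cos_le1.
have s1 : forall x : R, `|sin x| <= 1 by move=> x; rewrite ler_norml sin_geN1 sin_le1.
have h1 := main _ (@continuous_cos R) c1; have h2 := main _ (@continuous_sin R) s1.
have e1 := funext (fun l => (Zreg_chf (fun j => approx (vs j) l) a).1).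
have e2 := funext (fun l => (Zreg_chf (fun j => approx (vs j) l) a).2).
rewrite /= in e1 e2; rewrite {}e1 in h1; rewrite {}e2 in h2.
split; last first.
  by rewrite -(cvg_lim (@Rhausdorff R) h2) lim_cst.
rewrite -(cvg_lim (@Rhausdorff R) h1); apply: cvg_lim => //.
apply: (cvg_comp _ expR); last exact: continuous_expR.
apply: cvgM; last exact: cvg_cst.
apply: cvgN; apply: cvg_finsum2 => i j; apply: cvgM; [exact: cvg_cst|exact: cov_cvg].
Qed.

End extension.
End limit_process.

(** * Weak convergence in the space of bounded functions *)

Section supdist.
Context {R : realType} {V : Type} (v0 : V).
Implicit Types f g : V -> R.

Lemma supdist_ub f g v : lbounded f -> lbounded g -> `|f v - g v| <= supdist f g.
Proof.
move=> [A hA] [B hB]; apply: ub_le_sup; last by exists v.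
by exists (A + B) => _ [u _ <-]; apply: le_trans (ler_normB _ _) _; apply: lerD.
Qed.

Lemma supdist_le f g e : (forall v, `|f v - g v| <= e) -> supdist f g <= e.
Proof. by move=> h; apply: ge_sup; [exists `|f v0 - g v0|, v0|move=> _ [u _ <-]]. Qed.

Lemma supdist_ge0 f g : lbounded f -> lbounded g -> 0 <= supdist f g.
Proof. by move=> bf bg; apply: le_trans (supdist_ub v0 bf bg). Qed.

Lemma supdistxx f : lbounded f -> supdist f f = 0.
Proof.
move=> bf; apply/eqP; rewrite eq_le supdist_ge0 // andbT.
by apply: supdist_le => v; rewrite subrr normr0.
Qed.

Lemma supdistC f g : supdist f g = supdist g f.
Proof.
by congr sup; apply/seteqP; split => _ [v _ <-]; exists v => //; rewrite distrC.
Qed.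

Lemma supdist_triangle f g (h : V -> R) : lbounded f -> lbounded g -> lbounded h ->
  supdist f h <= supdist f g + supdist g h.
Proof.
move=> bf bg bh; apply: supdist_le => v; apply: le_trans (ler_distD (g v) _ _) _.
by apply: lerD; exact: supdist_ub.
Qed.

Lemma lbounded_step m (x : 'I_m -> R) (p : V -> 'I_m) : lbounded (fun v => x (p v)).
Proof.
by exists (\sum_i `|x i|) => v; rewrite (bigD1 (p v)) //= lerDl sumr_ge0.
Qed.

(** Conditions are imposed at bounded functions only, the elements of the space proper; elsewhere
    [supdist] carries no information. *)
Definition llip (h : (V -> R) -> R) (L C : R) :=
  [/\ 0 <= L, forall f g, lbounded f -> lbounded g -> `|h f - h g| <= L * supdist f g &
      forall f, lbounded f -> `|h f| <= C].

(** On functions constant on the [m] cells of [p], a functional becomes a function of [m] real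
    variables, and the sum of the coordinate differences dominates the sup distance. *)
Lemma lipf_llip h L C m (p : V -> 'I_m) : llip h L C -> lipf (fun x : 'I_m -> R => h (fun v => x (p v))) L.
Proof.
move=> [L0 hL hC]; split => // x y; apply: le_trans (hL _ _ (lbounded_step _ _) (lbounded_step _ _)) _.
rewrite ler_wpM2l //; apply: supdist_le => v.
by rewrite (bigD1 (p v)) //= lerDl sumr_ge0.
Qed.

(** Lower semicontinuity: it holds for a continuous functional, for its opposite and for the
    indicator of an open set. *)
Definition llsc (h : (V -> R) -> R) :=
  forall f, lbounded f -> forall e, 0 < e -> exists2 del, 0 < del &
    forall g, lbounded g -> supdist f g < del -> h f - e < h g.

Section infconv.
Variables (h : (V -> R) -> R) (C : R).
Hypothesis hC : forall f, lbounded f -> `|h f| <= C.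

(* The largest [m]-Lipschitz minorant of [h] on bounded functions. *)
Definition infconv (m : nat) f : R := inf [set h g + m%:R * supdist f g | g in @lbounded R V].

Let infset m f := [set h g + m%:R * supdist f g | g in @lbounded R V].

Let infset_lb m f : lbounded f -> lbound (infset m f) (- C).
Proof.
move=> bf _ [g bg <-]; have := hC bg; rewrite ler_norml => /andP[h1 _].
have : 0 <= m%:R * supdist f g by rewrite mulr_ge0 // supdist_ge0.
lra.
Qed.

Lemma infconv_lb m f g : lbounded f -> lbounded g -> infconv m f <= h g + m%:R * supdist f g.
Proof. by move=> bf bg; apply: ge_inf; [exists (- C); exact: infset_lb|exists g]. Qed.

Lemma infconv_le m f : lbounded f -> infconv m f <= h f.
Proof. by move=> bf; have := infconv_lb m bf bf; rewrite supdistxx // mulr0 addr0. Qed.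

Lemma infconv_llip m : llip (infconv m) m%:R C.
Proof.
split => // [f g bf bg|f bf].
  have main f' g' : lbounded f' -> lbounded g' -> infconv m f' <= infconv m g' + m%:R * supdist f' g'.
    move=> bf' bg'; rewrite -lerBlDr; apply: lb_le_inf; first by exists (h g' + m%:R * supdist g' g'), g'.
    move=> _ [u bu <-]; rewrite lerBlDr; apply: le_trans (infconv_lb m bf' bu) _.
    by rewrite -addrA lerD2l -mulrDr ler_wpM2l // addrC supdist_triangle.
  have := main f g bf bg; have := main g f bg bf; rewrite (supdistC g f) ler_norml => h1 h2.
  by apply/andP; split; lra.
rewrite ler_norml; apply/andP; split.
  by apply: lb_le_inf (infset_lb bf); exists (h f + m%:R * supdist f f), f.
by apply: le_trans (infconv_le m bf) _; have := hC bf; rewrite ler_norml => /andP[].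
Qed.

(** A competitor farther than [del] from [f] pays at least [m * del >= 2 C], more than it can gain;
    a nearer one gains at most [e] by semicontinuity. *)
Lemma infconv_cvg f : llsc h -> lbounded f -> (fun m => infconv m f) @ \oo --> h f.
Proof.
move=> hl bf; apply/cvgrPdist_le => e e0; have [del d0 hd] := hl f bf e e0.
near=> m; have h1 := infconv_le m bf.
suff : h f - e <= infconv m f by move=> h2; rewrite ger0_norm; lra.
apply: lb_le_inf; first by exists (h f + m%:R * supdist f f), f.
move=> _ [g bg <-]; have s0 := supdist_ge0 bf bg.
have [lt|ge] := ltP (supdist f g) del.
  have := hd _ bg lt; have : 0 <= m%:R * supdist f g by rewrite mulr_ge0.
  lra.
have hm : 2 * C / del <= m%:R by near: m; exact: nbhs_infty_ger.
have := hC bg; have := hC bf; rewrite !ler_norml => /andP[_ h2] /andP[h3 _].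
have : 2 * C <= m%:R * supdist f g.
  rewrite -(divfK (lt0r_neq0 d0) (2 * C)) ler_pM // ?(ltW d0) // divr_ge0 ?(ltW d0) //.
  by have := normr_ge0 (h f); have := hC bf; lra.
lra.
Unshelve. all: by end_near.
Qed.

End infconv.
End supdist.

(** * Outer expectations and weak convergence *)

Section weak_convergence.
Context {R : realType} {d : measure_display} {Om : measurableType d} (P : probability Om R).

Lemma outexp_le (f g : Om -> R) : bmf g -> (forall w, f w <= g w) -> (outexp P f <= (Ex P g)%:E)%E.
Proof.
move=> bg fg; apply: ereal_inf_lbound; exists g; last by rewrite ExE.
by split; [case: bg|split => //; exact: bmf_integrable].
Qed.

Lemma outexp_ge (f g : Om -> R) : bmf g -> (forall w, g w <= f w) -> ((Ex P g)%:E <= outexp P f)%E.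
Proof.
move=> bg fg; apply: le_ereal_inf_tmp => _ [g' [mg' [ig' fg']] <-].
rewrite -ExE //; apply: le_integral => //; first exact: bmf_integrable.
by move=> w _; rewrite lee_fin; exact: le_trans (fg' w).
Qed.

Lemma outexp_mono (f g : Om -> R) : (forall w, f w <= g w) -> (outexp P f <= outexp P g)%E.
Proof.
move=> fg; apply: le_ereal_inf => _ [g' [mg' [ig' fg']] <-]; exists g' => //.
by split => //; split => // w; exact: le_trans (fg' w).
Qed.

Variables (V : Type) (v0 : V) (r : V -> V -> R).
Hypothesis TB : forall e, 0 < e -> exists m (c : 'I_m -> V), forall v, exists j, r v (c j) < e.
Variables (X : nat -> Om -> V -> R) (W : Om -> V -> R).
Hypothesis mX : forall n v, measurable_fun setT (fun w => X n w v).
Hypothesis bX : forall n w, lbounded (X n w).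
Hypothesis mW : forall v, measurable_fun setT (fun w => W w v).
Hypothesis bW : forall w, lbounded (W w).
Hypothesis ucW : forall w e, 0 < e -> exists2 D, 0 < D &
  forall v v', r v v' < D -> `|W w v - W w v'| <= e.
Hypothesis aec : forall eta eps : R, 0 < eta -> 0 < eps -> exists2 Delta : R, 0 < Delta &
  \forall n \near \oo, exists Bd, [/\ measurable Bd, pr P Bd <= eps &
    forall w, ~ Bd w -> forall v v', r v v' < Delta -> `|X n w v - X n w v'| <= eta].
Hypothesis fidi : forall m (vs : 'I_m -> V) h L C, lipf h L -> (forall x, `|h x| <= C) ->
  (fun n => Ex P (fun w => h (fun i => X n w (vs i)))) @ \oo --> Ex P (fun w => h (fun i => W w (vs i))).

Lemma finite_nets : exists F : nat -> {m : nat & (('I_m -> V) * (V -> 'I_m))%type},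
  forall q v, r v ((projT2 (F q)).1 ((projT2 (F q)).2 v)) < q.+1%:R^-1.
Proof.
have /choice[F hF] : forall q : nat, exists x : {m : nat & (('I_m -> V) * (V -> 'I_m))%type},
    forall v, r v ((projT2 x).1 ((projT2 x).2 v)) < q.+1%:R^-1.
  move=> q; have [//|m [c hc]] := TB (_ : 0 < q.+1%:R^-1).
  by have /choice[p hp] := hc; exists (existT _ m (c, p)).
by exists F.
Qed.

Unset Implicit Arguments.
Let F := sval (cid finite_nets).
Let c q := (projT2 (F q)).1.
Let p q := (projT2 (F q)).2.
Set Implicit Arguments.

Lemma finite_netsP q v : r v (c q (p q v)) < q.+1%:R^-1.
Proof. exact: (svalP (cid finite_nets)). Qed.

Lemma lbounded_net_step (f : V -> R) q : lbounded (fun v => f (c q (p q v))).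
Proof. exact: (lbounded_step (fun i => f (c q i)) (p q)). Qed.

Section lipschitz.
Variables (h : (V -> R) -> R) (L C : R).
Hypothesis hh : llip h L C.

Let C0 : 0 <= C. Proof. by case: hh => _ _ /(_ _ (lbounded_net_step (fun=> 0) 0)); apply: le_trans. Qed.

Lemma llip_step_cvg w : (fun q => h (fun v => W w (c q (p q v)))) @ \oo --> h (W w).
Proof.
have [L0 hL _] := hh; apply/cvgrPdist_le => e e0.
have e1 : 0 < e / (L + 1) by rewrite divr_gt0 // ltr_wpDl.
have [D D0 hD] := ucW w e1; near=> q.
apply: le_trans (hL _ _ (bW w) (lbounded_net_step _ q)) _.
have : supdist (W w) (fun v => W w (c q (p q v))) <= e / (L + 1).
  apply: supdist_le => // v; apply: hD; apply: lt_trans (finite_netsP q v) _.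
  by near: q; exact: (cvgr_lt _ (@cvg_harmonic R) _ D0).
move=> /(ler_wpM2l L0) h1; apply: le_trans h1 _.
by rewrite mulrA ler_pdivrMr ?ltr_wpDl // mulrC ler_wpM2l ?(ltW e0) //; lra.
Unshelve. all: by end_near.
Qed.

Lemma bmf_net_step q (Y : Om -> V -> R) : (forall v, measurable_fun setT (fun w => Y w v)) ->
  bmf (fun w => h (fun v => Y w (c q (p q v)))).
Proof.
move=> mY; have [_ _ hC] := hh.
apply: (bmf_lipf (X := fun i w => Y w (c q i)) _ (lipf_llip v0 (p q) hh)) => //.
by move=> x; apply: hC; exact: lbounded_step.
Qed.

Lemma llip_measurable : bmf (fun w => h (W w)).
Proof.
have [_ _ hC] := hh; split; last by exists C => w; exact: hC.
apply: (@measurable_fun_cvg _ _ R setT (fun q w => h (fun v => W w (c q (p q v))))) => //.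
  by move=> q; have [] := bmf_net_step q mW.
by move=> w _; exact: llip_step_cvg.
Qed.

(** Evaluation on a finite net is measurable, so the outer expectation is squeezed between the
    expectations of this evaluation minus and plus [g]. The error [e] splits into [e / 2] for [g],
    half of it from the exceptional event, and [e / 4] each for the convergence on the net and the
    approximation of [W]. *)
Lemma llip_conv e : 0 < e -> \forall n \near \oo,
  ((Ex P (fun w => h (W w)) - e)%:E <= outexp P (fun w => h (X n w)))%E /\
  (outexp P (fun w => h (X n w)) <= (Ex P (fun w => h (W w)) + e)%:E)%E.
Proof.
have [L0 hL hC] := hh => e0; have e4 : 0 < e / 4 by rewrite divr_gt0.
have eL : 0 < e / (4 * (L + 1)) by rewrite divr_gt0 // mulr_gt0 // ltr_wpDl.
have eC : 0 < e / (8 * (C + 1)) by rewrite divr_gt0 // mulr_gt0 // ltr_wpDl.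
have [D D0 hD] := aec eL eC.
have cW : (fun q => Ex P (fun w => h (fun v => W w (c q (p q v))))) @ \oo --> Ex P (fun w => h (W w)).
  apply: (@Ex_cvg _ _ _ P _ _ C).
  - by move=> q; have [] := bmf_net_step q mW.
  - by move=> q w; apply: hC; exact: lbounded_net_step.
  - by have [] := llip_measurable.
  - exact: llip_step_cvg.
have [q [hq1 hq2]] : exists q, q.+1%:R^-1 < D /\
    `|Ex P (fun w => h (W w)) - Ex P (fun w => h (fun v => W w (c q (p q v))))| <= e / 4.
  have : \forall q \near \oo, q.+1%:R^-1 < D /\
    `|Ex P (fun w => h (W w)) - Ex P (fun w => h (fun v => W w (c q (p q v))))| <= e / 4.
    near=> q; split; first by near: q; exact: (cvgr_lt _ (@cvg_harmonic R) _ D0).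
    by near: q; move/cvgrPdist_le : cW; exact.
  by move=> [q _ hq]; exists q; exact: (hq q (leqnn q)).
have cX := @fidi _ (c q) _ L C (lipf_llip v0 (p q) hh) (fun x => hC _ (lbounded_step x (p q))).
near=> n.
have [Bd [mB pB hB]] : exists Bd, [/\ measurable Bd, pr P Bd <= e / (8 * (C + 1)) &
    forall w, ~ Bd w -> forall v v', r v v' < D -> `|X n w v - X n w v'| <= e / (4 * (L + 1))] by near: n.
have hn : `|Ex P (fun w => h (fun v => W w (c q (p q v)))) - Ex P (fun w => h (fun v => X n w (c q (p q v))))| <= e / 4.
  by near: n; move/cvgrPdist_le : cX; exact.
have bB := bmf_indic mB.
have bs := bmf_net_step q (mX n).
pose g w := e / 4 + 2 * C * \1_Bd w.
have bg : bmf g by apply: bmfD; [exact: bmf_cst|exact: bmfZ].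
have Eg : Ex P g <= e / 2.
  rewrite /g ExD; [|exact: bmf_cst|exact: bmfZ].
  rewrite Ex_cst ExZ // Ex_indic //.
  have h1 : 2 * C * pr P Bd <= 2 * C * (e / (8 * (C + 1))) by rewrite ler_wpM2l // mulr_ge0.
  have h2 : 2 * C * (e / (8 * (C + 1))) <= e / 4.
    rewrite mulrA ler_pdivrMr; last by rewrite mulr_gt0 // ltr_wpDl.
    by have := mulr_ge0 C0 (ltW e0); lra.
  lra.
have key w : `|h (X n w) - h (fun v => X n w (c q (p q v)))| <= g w.
  rewrite /g indicE; case: (boolP (w \in Bd)) => [_|/negP].
    rewrite mulr1; apply: le_trans (ler_normB _ _) _.
    by have := hC _ (bX n w); have := hC _ (lbounded_net_step (X n w) q); lra.
  rewrite inE mulr0 addr0 => nB; apply: le_trans (hL _ _ (bX n w) (lbounded_net_step _ q)) _.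
  have : supdist (X n w) (fun v => X n w (c q (p q v))) <= e / (4 * (L + 1)).
    by apply: supdist_le => // v; apply: hB => //; apply: lt_trans hq1; exact: finite_netsP.
  move=> /(ler_wpM2l L0) h1; apply: le_trans h1 _.
  rewrite mulrA ler_pdivrMr; last by rewrite mulr_gt0 // ltr_wpDl.
  by have := ltW e0; lra.
move: hq2 hn; rewrite !ler_norml => /andP[a1 a2] /andP[a3 a4].
split.
  apply: le_trans (outexp_ge (g := fun w => h (fun v => X n w (c q (p q v))) - g w) _ _).
  - by rewrite lee_fin ExB //; lra.
  - exact: bmfB.
  - by move=> w; have := key w; rewrite ler_norml => /andP[]; lra.
apply: le_trans (outexp_le (g := fun w => h (fun v => X n w (c q (p q v))) + g w) _ _) _.
- exact: bmfD.
- by move=> w; have := key w; rewrite ler_norml => /andP[]; lra.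
- by rewrite lee_fin ExD //; lra.
Unshelve. all: by end_near.
Qed.

End lipschitz.

(** Coordinates do not in general generate the Borel field of the bounded functions. Measurability
    comes instead from two pointwise limits: Lipschitz envelopes of [h], and finite nets along the
    uniformly continuous paths of [W]. *)
Lemma llsc_measurable h C : (forall f, lbounded f -> `|h f| <= C) -> llsc h -> bmf (fun w => h (W w)).
Proof.
move=> hC hl; split; last by exists C => w; exact: hC.
apply: (@measurable_fun_cvg _ _ R setT (fun m w => infconv h m (W w))) => //.
  by move=> m; have [] := llip_measurable (infconv_llip v0 hC m).
by move=> w _; exact: (infconv_cvg v0 hC).
Qed.

Lemma llsc_Ex_cvg h C : (forall f, lbounded f -> `|h f| <= C) -> llsc h ->
  (fun m => Ex P (fun w => infconv h m (W w))) @ \oo --> Ex P (fun w => h (W w)).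
Proof.
move=> hC hl; apply: (@Ex_cvg _ _ _ P _ _ C).
- by move=> m; have [] := llip_measurable (infconv_llip v0 hC m).
- by move=> m w; have [_ _] := infconv_llip v0 hC m; exact.
- by have [] := llsc_measurable hC hl.
- by move=> w; exact: (infconv_cvg v0 hC).
Qed.

Lemma measurable_lopen O : lopen O -> measurable [set w | O (W w)].
Proof.
move=> [_ hO]; pose h f : R := `[< O f >]%:R.
have hC f : lbounded f -> `|h f| <= 1 by rewrite /h; case: asboolP => _; rewrite ?normr1 ?normr0.
have hl : llsc h.
  move=> f bf e e0; rewrite /h; case: asboolP => [Of|_]; last first.
    by exists 1 => // g _ _; rewrite sub0r; apply: lt_le_trans (_ : 0 <= _); rewrite ?oppr_lt0.
  have [del d0 hd] := hO f Of; exists del => // g bg fg.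
  by rewrite (asboolT (hd g bg fg)) ltrBlDr ltrDl.
have [mh _] := llsc_measurable hC hl.
have := mh measurableT _ (measurable_set1 1); rewrite setTI; congr measurable.
apply/seteqP; split => w /=; rewrite /h; case: asboolP => //.
by move=> _ /esym/eqP; rewrite oner_eq0.
Qed.

Lemma outexp_cvg h : lbddfun h -> lcont h ->
  (fun n => outexp P (fun w => h (X n w))) @ \oo --> (\int[P]_w (h (W w))%:E)%E.
Proof.
move=> [C hC] hl.
have l1 : llsc h.
  move=> f bf e e0; have [del d0 hd] := hl f bf e e0; exists del => // g bg fg.
  by have := hd g bg fg; rewrite ltr_norml => /andP[]; lra.
pose h' f := - h f.
have hC' f : lbounded f -> `|h' f| <= C by rewrite normrN; exact: hC.
have l2 : llsc h'.
  move=> f bf e e0; have [del d0 hd] := hl f bf e e0; exists del => // g bg fg.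
  by have := hd g bg fg; rewrite /h' ltr_norml => /andP[]; lra.
have bh := llsc_measurable hC l1.
rewrite ExE //; set E := Ex P _.
have E' : Ex P (fun w => h' (W w)) = - E.
  rewrite /E (_ : (fun w => h' (W w)) = fun w => -1 * h (W w)) ?ExZ ?mulN1r //.
  by apply/funext => w; rewrite mulN1r.
have main e : 0 < e -> \forall n \near \oo,
    ((E - e)%:E <= outexp P (fun w => h (X n w)))%E /\ (outexp P (fun w => h (X n w)) <= (E + e)%:E)%E.
  move=> e0; have e2 : 0 < e / 2 by rewrite divr_gt0.
  (* Envelopes of [h] bound the outer expectation from below and those of [- h] from above; half of
     [e] goes to the choice of [m1] and [m2], half to [llip_conv]. *)
  have [m1 hm1] : exists m, E - e / 2 <= Ex P (fun w => infconv h m (W w)).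
    have [|m _ hm] := cvgr_ge _ (llsc_Ex_cvg hC l1) (E - e / 2); first by rewrite ltrBlDr ltrDl.
    by exists m; exact: (hm m (leqnn m)).
  have [m2 hm2] : exists m, - E - e / 2 <= Ex P (fun w => infconv h' m (W w)).
    have [|m _ hm] := cvgr_ge _ (llsc_Ex_cvg hC' l2) (- E - e / 2).
      by rewrite E' ltrBlDr ltrDl.
    by exists m; exact: (hm m (leqnn m)).
  have k1 := infconv_llip v0 hC m1.
  pose g f : R := - infconv h' m2 f.
  have k2 : llip g m2%:R C.
    have [a1 a2 a3] := infconv_llip v0 hC' m2; split => //.
      by move=> f f2 bf bg; rewrite /g -opprD normrN a2.
    by move=> f bf; rewrite normrN a3.
  near=> n; split.
    have [c1 _] : ((Ex P (fun w => infconv h m1 (W w)) - e / 2)%:E <= outexp P (fun w => infconv h m1 (X n w)))%E /\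
      (outexp P (fun w => infconv h m1 (X n w)) <= (Ex P (fun w => infconv h m1 (W w)) + e / 2)%:E)%E.
      by near: n; exact: llip_conv k1 _ e2.
    apply: le_trans (le_trans c1 _); first by rewrite lee_fin; lra.
    by apply: outexp_mono => w; exact: (infconv_le v0 hC).
  have [_ c2] : ((Ex P (fun w => g (W w)) - e / 2)%:E <= outexp P (fun w => g (X n w)))%E /\
      (outexp P (fun w => g (X n w)) <= (Ex P (fun w => g (W w)) + e / 2)%:E)%E.
    by near: n; exact: llip_conv k2 _ e2.
  apply: le_trans (le_trans _ c2) _.
    by apply: outexp_mono => w; rewrite /g lerNr; exact: (infconv_le v0 hC').
  have bk := llip_measurable (infconv_llip v0 hC' m2).
  rewrite lee_fin (_ : (fun w => g (W w)) = fun w => -1 * infconv h' m2 (W w)); last by apply/funext => w; rewrite mulN1r.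
  by rewrite ExZ // mulN1r; lra.
have fin : \forall n \near \oo, outexp P (fun w => h (X n w)) \is a fin_num.
  have := main 1 ltr01; apply: filterS => n [a1 a2].
  rewrite fin_numE; apply/andP; split; apply/eqP => e; rewrite e in a1 a2; first by move: a1.
  by move: a2.
apply/fine_cvgP; split => //; apply/cvgrPdist_le => e e0.
near=> n => /=.
have f1 : outexp P (fun w => h (X n w)) \is a fin_num by near: n.
have [a1 a2] : ((E - e)%:E <= outexp P (fun w => h (X n w)))%E /\ (outexp P (fun w => h (X n w)) <= (E + e)%:E)%E.
  by near: n; exact: main.
move: a1 a2; rewrite -(fineK f1) !lee_fin /= => a1 a2.
by rewrite ler_norml; apply/andP; split; lra.
Unshelve. all: by end_near.
Qed.

End weak_convergence.

(** * The uniform marginals *)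

Section uniform.
Context {R : realType} {d : measure_display} {Om : measurableType d} (P : probability Om R).
Variable X : Om -> R.
Hypothesis mX : measurable_fun setT X.
Hypothesis cF : continuous (Fdist P X).

Let F := Fdist P X.

Lemma measurable_le_set (Y : Om -> R) (x : R) : measurable_fun setT Y -> measurable [set w | Y w <= x].
Proof.
move=> mY; have := mY measurableT _ (measurable_itv `]-oo, x]).
by rewrite setTI; congr measurable; apply/seteqP; split => w; rewrite /= in_itv.
Qed.

Lemma measurable_lt_set (Y : Om -> R) (x : R) : measurable_fun setT Y -> measurable [set w | Y w < x].
Proof.
move=> mY; have := mY measurableT _ (measurable_itv `]-oo, x[).
by rewrite setTI; congr measurable; apply/seteqP; split => w; rewrite /= in_itv.
Qed.

Lemma Fdist_ge0 x : 0 <= F x. Proof. exact: pr_ge0. Qed.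

Lemma Fdist_le1 x : F x <= 1. Proof. by apply: pr_le1; exact: measurable_le_set. Qed.

Lemma Fdist_nd x y : x <= y -> F x <= F y.
Proof.
move=> xy; apply: pr_le; [exact: measurable_le_set|exact: measurable_le_set|].
by move=> w /= h; exact: le_trans xy.
Qed.

Lemma Fdist_surj u : 0 < u < 1 -> exists x, F x = u.
Proof.
move=> /andP[u0 u1]; pose e := Num.min u (1 - u).
have e0 : 0 < e by rewrite lt_min u0 subr_gt0.
have [A A0 hA] := tail_cvg0 P mX e0.
have mA : measurable [set w | A <= `|X w|] by exact: measurable_tail.
have F1 : F (- A) <= u.
  have : pr P [set w | X w <= - A] <= e.
    apply: le_trans hA; apply: pr_le => //; first exact: measurable_le_set.
    by move=> w /= h; rewrite ler_normr lerNr h orbT.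
  by move=> h; apply: le_trans h _; rewrite ge_min lexx.
have F2 : u <= F A.
  have mX' : measurable [set w | X w <= A] by exact: measurable_le_set.
  have : pr P (~` [set w | X w <= A]) <= e.
    apply: le_trans hA; apply: pr_le => //; first exact: measurableC.
    by move=> w /= /negP; rewrite -ltNge => /ltW h; rewrite ler_normr h.
  rewrite prC // => h; have : e <= 1 - u by rewrite ge_min lexx orbT.
  by rewrite /F /Fdist -/(pr P _); lra.
have AA : - A <= A by lra.
have [|x _ hx] := @IVT R F (- A) A u AA (continuous_subspaceT cF).
  by rewrite ge_min F1 /= le_max F2 orbT.
by exists x.
Qed.

(** [F] may have flat pieces, so the event is compared with half-lines: it lies in [X <= x] when
    [F x = u], and it contains [X <= x] when [F x = u - e]. *)
Lemma pr_Fdist_lt u : 0 <= u <= 1 -> pr P [set w | F (X w) < u] = u.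
Proof.
have mF : measurable_fun setT F by apply: continuous_measurable_fun.
have mFX : measurable_fun setT (F \o X) by exact: measurableT_comp.
move=> /andP[u0 u1]; have mu : measurable [set w | F (X w) < u] by exact: (measurable_lt_set u mFX).
apply/eqP; rewrite eq_le; apply/andP; split.
  have [u10|u10] := ltP u 1; last by rewrite (le_trans (pr_le1 P mu)).
  have [<-|nu] := eqVneq 0 u.
    rewrite (_ : [set w | _] = set0) ?pr0 //; apply/seteqP; split => // w /=.
    by rewrite ltNge Fdist_ge0.
  have [|x <-] := @Fdist_surj u; first by rewrite u10 lt_neqAle nu u0.
  apply: pr_le; [exact: (measurable_lt_set (F x) mFX)|exact: measurable_le_set|].
  by move=> w /=; rewrite ltNge => /negP h; rewrite leNgt; apply/negP => /ltW /Fdist_nd /h.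
apply/ler_addgt0Pl => e e0.
have [ue|ue] := leP u e; first by have := pr_ge0 P [set w | F (X w) < u]; lra.
have [|x hx] := @Fdist_surj (u - e); first by apply/andP; split; lra.
have : pr P [set w | X w <= x] <= pr P [set w | F (X w) < u].
  apply: pr_le => //; first exact: measurable_le_set.
  by move=> w /= /Fdist_nd; rewrite hx; lra.
by rewrite -/(F x); rewrite (_ : pr P _ = F x) // hx; lra.
Qed.

Lemma pr_unif_le y : 0 <= y <= 1 -> pr P [set w | 1 - F (X w) <= y] = y.
Proof.
have mF : measurable_fun setT F by apply: continuous_measurable_fun.
have mFX : measurable_fun setT (F \o X) by exact: measurableT_comp.
move=> /andP[y0 y1].
rewrite (_ : [set w | _] = ~` [set w | F (X w) < 1 - y]); last first.
  by apply/seteqP; split => w /=; [move=> h; apply/negP; rewrite -leNgt; lra|move/negP; rewrite -leNgt; lra].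
rewrite prC; last exact: (measurable_lt_set (1 - y) mFX).
by rewrite pr_Fdist_lt; [ring|apply/andP; split; lra].
Qed.

Lemma pr_Fdist_eq x : pr P [set w | X w = x] = 0.
Proof.
have mx : measurable [set w | X w = x].
  by have := mX measurableT (measurable_set1 x); rewrite setTI.
apply/eqP; rewrite eq_le pr_ge0 andbT; apply/ler_addgt0Pl => e e0; rewrite addr0.
have /cvgrPdist_le /(_ e e0) /nbhs_ballP[del /= d0 hd] := @cF x.
have hb : ball x del (x - del / 2).
  by rewrite -ball_normE /= opprB addrC subrK ger0_norm; lra.
have := hd _ hb => h.
have h1 : pr P [set w | X w <= x - del / 2] + pr P [set w | X w = x] <= pr P [set w | X w <= x].
  rewrite -prUD //; last 2 first.
    exact: measurable_le_set.
    by rewrite -subset0 => w /= [+ e1]; rewrite e1; lra.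
  apply: pr_le; [apply: measurableU => //; exact: measurable_le_set|exact: measurable_le_set|].
  by move=> w /= [|->//]; lra.
have := ler_norm (Fdist P X x - Fdist P X (x - del / 2)).
rewrite /Fdist -!/(pr P _) in h *; lra.
Qed.

End uniform.

(** * Continuity of the uniform transforms and countable reduction *)

Section paths.
Context {R : realType} {T : pseudoMetricType R} {d : measure_display} {Om : measurableType d}.
Variables (P : probability Om R) (xi : nat -> Om -> T -> R).
Hypothesis cpt : compact [set: T].
Hypothesis cxi : forall i w, continuous (xi i w).
Hypothesis mxi : forall i t, measurable_fun setT (fun w => xi i w t).
Hypothesis cF : forall t, continuous (Fdist P (fun w => xi 0%N w t)).

Local Notation U := (Ufun P xi).

Lemma Ufun01 i w t : 0 <= U i w t <= 1.
Proof.
have h1 := Fdist_ge0 P (fun w => xi 0%N w t) (xi i w t).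
have h2 := Fdist_le1 P (mxi 0 t) (xi i w t).
by rewrite /Ufun; apply/andP; split; lra.
Qed.

Lemma measurable_Ucoord t : measurable_fun setT (fun x : R => 1 - Fdist P (fun w => xi 0%N w t) x).
Proof. by apply: measurable_funB => //; apply: continuous_measurable_fun; exact: cF. Qed.

Lemma measurable_Ufun i t : measurable_fun setT (fun w => U i w t).
Proof. exact: (measurableT_comp (measurable_Ucoord t) (mxi i t)). Qed.

Lemma Obs_Ufun t (B : set R) : measurable B -> Obs xi (fun i => [set w | B (U i w t)]).
Proof.
move=> mB; apply: Obs_ext (Obs_eval (B := (fun x => 1 - Fdist P (fun w => xi 0%N w t) x) @^-1` B) xi t _) _ => //.
by have := measurable_Ucoord t measurableT mB; rewrite setTI.
Qed.

Lemma pr_Ufun_le t y : 0 <= y <= 1 -> pr P [set w | U 0 w t <= y] = y.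
Proof. exact: pr_unif_le. Qed.

Lemma pr_Ufun_le1 t y : 0 <= y -> pr P [set w | U 0 w t <= y] <= y.
Proof.
move=> y0; have [y1|y1] := leP y 1; first by rewrite pr_Ufun_le ?y0.
apply: le_trans (ltW y1); apply: pr_le1; apply: measurable_le_set; exact: measurable_Ufun.
Qed.

Lemma pr_Ufun_eq t y : pr P [set w | U 0 w t = y] = 0.
Proof.
have mE c : measurable [set w | U 0 w t <= c] by apply: measurable_le_set; exact: measurable_Ufun.
have mQ : measurable [set w | U 0 w t = y].
  by have := measurable_Ufun 0 t measurableT (measurable_set1 y); rewrite setTI.
have out : (y < 0) || (1 < y) -> pr P [set w | U 0 w t = y] = 0.
  move=> h; rewrite (_ : [set w | _] = set0) ?pr0 //; apply/seteqP; split => // w /= e.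
  by have := Ufun01 0 w t; rewrite e => /andP[]; move/orP: h => [] h; lra.
have [y0|y0] := ltP y 0; first by apply: out; rewrite y0.
have [y1|y1] := ltP 1 y; first by apply: out; rewrite y1 orbT.
apply/eqP; rewrite eq_le pr_ge0 andbT; apply/ler_addgt0Pl => e e0; rewrite addr0.
have [ye|ye] := leP y e.
  apply: le_trans ye; rewrite -[leRHS](@pr_Ufun_le t) ?y0 //; apply: pr_le => //.
  by move=> w /= ->.
have : pr P [set w | U 0 w t <= y - e] + pr P [set w | U 0 w t = y] <= pr P [set w | U 0 w t <= y].
  rewrite -prUD //; last by rewrite -subset0 => w /= [+ e1]; rewrite e1; lra.
  apply: pr_le => //; first exact: measurableU.
  by move=> w /= [|->//]; lra.
by rewrite !pr_Ufun_le ?y0 //; [lra|apply/andP; split; lra].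
Qed.

(** Both the path and the distribution function vary with [t]. The indicators of
    [xi 0 w' (s n) <= xi i w (s n)] converge off the event [xi 0 w' t = xi i w t], where [w] is
    fixed; that event is null by (C1), and bounded convergence concludes. *)
Lemma Ufun_seq_continuous i w (s : nat -> T) t : s @ \oo --> t -> (fun n => U i w (s n)) @ \oo --> U i w t.
Proof.
move=> st; apply: cvgB; first exact: cvg_cst.
have cx w' j : (fun n => xi j w' (s n)) @ \oo --> xi j w' t.
  by apply: (cvg_comp _ (xi j w')) st _; exact: cxi.
have mle (Y Z : Om -> R) : measurable_fun setT Y -> measurable_fun setT Z -> measurable [set w' | Y w' <= Z w'].
  move=> mY mZ; rewrite (_ : [set w' | _] = [set w' | Y w' - Z w' <= 0]).
    by apply: measurable_le_set; exact: measurable_funB.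
  by apply/seteqP; split => w' /=; rewrite subr_le0.
pose x := xi i w t; pose N := [set w' | xi 0%N w' t = x].
have pN : pr P N = 0 by apply: pr_Fdist_eq => //; exact: cF.
have mN : measurable N by have := mxi 0 t measurableT (measurable_set1 x); rewrite setTI.
pose f n w' : R := \1_[set w' | xi 0%N w' (s n) <= xi i w (s n)] w' * \1_(~` N) w'.
pose g w' : R := \1_[set w' | xi 0%N w' t <= x] w' * \1_(~` N) w'.
have mE n : measurable [set w' | xi 0%N w' (s n) <= xi i w (s n)] by exact: measurable_le_set.
have mE0 : measurable [set w' | xi 0%N w' t <= x] by exact: measurable_le_set.
have ExN (E : set Om) : measurable E -> Ex P (fun w' => \1_E w' * \1_(~` N) w') = pr P E.
  move=> mE'; rewrite (_ : (fun w' => _) = \1_(E `&` ~` N)); last by apply/funext => w'; rewrite indicI.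
  have mI : measurable (E `&` N) by exact: measurableI.
  rewrite Ex_indic; last by apply: measurableI => //; exact: measurableC.
  rewrite [RHS](pr_split P mE' mN) -setDE.
  suff -> : pr P (E `&` N) = 0 by rewrite add0r.
  by apply/eqP; rewrite eq_le pr_ge0 andbT -pN; apply: pr_le => // w' [].
have := @Ex_cvg _ _ _ P f g 1.
rewrite (_ : Ex P g = Fdist P (fun w' => xi 0%N w' t) (xi i w t)); last exact: ExN.
rewrite (_ : (fun n => Ex P (f n)) = fun n => Fdist P (fun w' => xi 0%N w' (s n)) (xi i w (s n))); last first.
  by apply/funext => n; exact: ExN.
apply.
- move=> n; apply: measurable_funM; apply: measurable_indic => //; exact: measurableC.
- move=> n w'; rewrite normrM !indicE; do 2 case: (_ \in _); rewrite ?normr1 ?normr0 ?mulr1 ?mulr0 ?mul0r //.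
- apply: measurable_funM; apply: measurable_indic => //; exact: measurableC.
move=> w'; rewrite /f /g !indicE; case: (boolP (w' \in ~` N)) => [|_]; last first.
  by rewrite mulr0; under eq_fun do rewrite mulr0; exact: cvg_cst.
rewrite inE /N /= => /eqP nx.
have c : (fun n => xi 0%N w' (s n) - xi i w (s n)) @ \oo --> xi 0%N w' t - x by apply: cvgB; exact: cx.
have [lt|ge] := ltP (xi 0%N w' t) x.
  rewrite mem_set /=; last exact: ltW.
  apply: cvg_near_cst; near=> n; rewrite indicE mem_set //= ltW // -subr_lt0.
  by near: n; apply: (cvgr_lt _ c 0); rewrite subr_lt0.
have gt : x < xi 0%N w' t by rewrite lt_neqAle eq_sym nx.
rewrite memNset /=; last by apply/negP; rewrite -ltNge.
apply: cvg_near_cst; near=> n; rewrite indicE memNset //=; apply/negP; rewrite -ltNge -subr_gt0.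
by near: n; apply: (cvgr_gt _ c 0); rewrite subr_gt0.
Unshelve. all: by end_near.
Qed.

(** If there were no finite net, the complements of finite unions of balls would generate a proper
    filter, and the ball around a cluster point would contradict it. *)
Lemma finite_net e : 0 < e -> exists B : seq T, forall t, exists2 b, b \in B & ball b e t.
Proof.
move=> e0; apply: contrapT => /forallNP no.
pose F : set_system T := [set C | exists B : seq T, forall t, (forall b, b \in B -> ~ ball b e t) -> C t].
have FF : ProperFilter F.
  split; last split.
  - move=> [B hB]; apply: (no B) => t; apply: contrapT => nt; apply: (hB t) => b bB bt.
    by apply: nt; exists b.
  - by exists [::].
  - move=> C D [B hB] [B' hB']; exists (B ++ B') => t ht; split.
      by apply: hB => b bB; apply: ht; rewrite mem_cat bB.
    by apply: hB' => b bB; apply: ht; rewrite mem_cat bB orbT.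
  - by move=> C D CD [B hB]; exists B => t /hB /CD.
have [|p [_ hp]] := cpt FF; first by exists [::].
have [||t [h1 h2]] := hp [set t | ~ ball p e t] (ball p e).
- by exists [:: p] => t; apply; rewrite inE.
- exact: nbhsx_ballx.
- exact: h1.
Qed.

(** The sequence must lie in the arbitrary set [A] itself: in every ball of the finite nets that
    meets [A] a point of [A] is chosen, with [a0] as default. *)
Lemma dense_sub (A : set T) : A !=set0 -> exists S : nat -> T, (forall m, A (S m)) /\
  forall t, A t -> exists f : nat -> nat, (fun n => S (f n)) @ \oo --> t.
Proof.
move=> [a0 Aa0].
have /choice[B hB] : forall l : nat, exists B : seq T, forall t, exists2 b, b \in B & ball b l.+1%:R^-1 t.
  by move=> l; exact: finite_net.
pose g (p : nat * nat) : T :=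
  if pselect (exists a, A a /\ ball (nth a0 (B p.1) p.2) p.1.+1%:R^-1 a) is left h then sval (cid h) else a0.
have gA p : A (g p).
  by rewrite /g; case: pselect => // h; case: (svalP (cid h)).
exists (fun m => if unpickle m is Some p then g p else a0); split.
  by move=> m; case: unpickle.
move=> t At; pose i l := index (sval (cid2 (hB l t))) (B l).
exists (fun l => pickle (l, i l)); apply/cvg_ballP => e e0; near=> l.
rewrite pickleK /g; case: pselect => [h|[]]; last first.
  exists t; split => //=; rewrite /i.
  by case: (cid2 (hB l t)) => b bB bt /=; rewrite nth_index.
have [_ /=] := svalP (cid h); set a := sval _.
rewrite /i; case: (cid2 (hB l t)) => b bB bt /=; rewrite nth_index // => ba.
have hl : l.+1%:R^-1 < e / 2 by near: l; apply: (cvgr_lt _ (@cvg_harmonic R)); rewrite divr_gt0.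
rewrite (splitr e); apply: (@ball_triangle _ _ b).
  by apply: ball_sym; apply: le_ball bt; exact: ltW.
by apply: le_ball ba; exact: ltW.
Unshelve. all: by end_near.
Qed.

Lemma dense_lt (A : set T) (S : nat -> T) i w c :
  (forall t, A t -> exists f : nat -> nat, (fun n => S (f n)) @ \oo --> t) ->
  (exists2 t, A t & U i w t < c) -> exists m, U i w (S m) < c.
Proof.
move=> hS [t At ut]; have [f hf] := hS t At.
have [n _ hn] := cvgr_lt _ (@Ufun_seq_continuous i w _ _ hf) _ ut.
by exists (f n); exact: (hn n (leqnn n)).
Qed.

Lemma dense_gt (A : set T) (S : nat -> T) i w c :
  (forall t, A t -> exists f : nat -> nat, (fun n => S (f n)) @ \oo --> t) ->
  (exists2 t, A t & c < U i w t) -> exists m, c < U i w (S m).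
Proof.
move=> hS [t At ut]; have [f hf] := hS t At.
have [n _ hn] := cvgr_gt _ (@Ufun_seq_continuous i w _ _ hf) _ ut.
by exists (f n); exact: (hn n (leqnn n)).
Qed.

End paths.

(** * Brackets and entropy *)

Section piece.
Context {R : realType} {T : pseudoMetricType R} {d : measure_display} {Om : measurableType d}.
Variables (P : probability Om R) (xi : nat -> Om -> T -> R).
Hypothesis cxi : forall i w, continuous (xi i w).
Hypothesis mxi : forall i t, measurable_fun setT (fun w => xi i w t).
Hypothesis cF : forall t, continuous (Fdist P (fun w => xi 0%N w t)).
Local Notation U := (Ufun P xi).
Variables (A : set T) (S : nat -> T).
Hypothesis SA : forall m, A (S m).
Hypothesis SD : forall t, A t -> exists f : nat -> nat, (fun n => S (f n)) @ \oo --> t.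

Local Notation supU w := (sup [set U 0 w t | t in A]).
Local Notation infU w := (inf [set U 0 w t | t in A]).

Lemma supU_gt w c : (c < supU w) <-> exists m, c < U 0 w (S m).
Proof.
have ne : [set U 0 w t | t in A] !=set0 by exists (U 0 w (S 0%N)), (S 0%N).
split; last first.
  move=> [m h]; apply: (lt_le_trans h); apply: ub_le_sup; last by exists (S m).
  by exists 1 => _ [t _ <-]; have /andP[] := Ufun01 P mxi 0 w t.
move=> /(sup_gt ne)[_ [t At <-]] h; by apply: (dense_gt cxi mxi cF (@SD)); exists t.
Qed.

Lemma infU_lt w c : (infU w < c) <-> exists m, U 0 w (S m) < c.
Proof.
have ne : [set U 0 w t | t in A] !=set0 by exists (U 0 w (S 0%N)), (S 0%N).
split; last first.
  move=> [m h]; apply: (le_lt_trans _ h); apply: ge_inf; last by exists (S m).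
  by exists 0 => _ [t _ <-]; have /andP[] := Ufun01 P mxi 0 w t.
move=> /(inf_lt ne)[_ [t At <-]] h; by apply: (dense_lt cxi mxi cF (@SD)); exists t.
Qed.

Lemma measurable_supU c : measurable [set w | c < supU w].
Proof.
rewrite (_ : [set w | _] = \bigcup_m ~` [set w | U 0 w (S m) <= c]).
  apply: bigcup_measurable => m _; apply: measurableC; apply: measurable_le_set.
  exact: measurable_Ufun.
apply/seteqP; split => w /=; first by move=> /supU_gt[m h]; exists m => //=; apply/negP; rewrite -ltNge.
by move=> [m _ /= /negP]; rewrite -ltNge => h; apply/supU_gt; exists m.
Qed.

Lemma measurable_infU c : measurable [set w | infU w <= c].
Proof.
rewrite (_ : [set w | _] = \bigcap_(l : nat) \bigcup_m [set w | U 0 w (S m) < c + l.+1%:R^-1]).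
  apply: bigcap_measurable; first by exists 0%N.
  move=> l _; apply: bigcup_measurable => m _; apply: measurable_lt_set; exact: measurable_Ufun.
apply/seteqP; split => w /=.
  move=> h l _; have [|m hm] := (infU_lt w (c + l.+1%:R^-1)).1; last by exists m.
  by apply: le_lt_trans h _; rewrite ltrDl.
move=> h; apply/ler_addgt0Pr => e e0.
have [l _ hl] := cvgr_lt _ (@cvg_harmonic R) _ e0.
have [m _ /= hm] := h l Logic.I; apply: ltW.
have : infU w < c + l.+1%:R^-1 by apply/infU_lt; exists m.
by move=> h5; apply: lt_trans h5 _; rewrite ltrD2l; exact: (hl l (leqnn l)).
Qed.

(** [g] stands for [c1 * eps^2] and [ka] for [c2 * eps^2], and [h4] is (C4) with the conditional
    probability multiplied out. *)
Variables (u0 g ka : R).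
Hypothesis g01 : 0 <= g <= 1/2.
Hypothesis ka01 : 0 <= ka <= 1/2.
Hypothesis h4 : forall u, 0 < u <= u0 ->
  (P ([set w | (u * expR g < supU w)%R] `&` [set w | (infU w <= u)%R])
    <= ka%:E * P [set w | (infU w <= u)%R])%E.

Let pI u := pr P [set w | infU w <= u].

Lemma expR_small : 1 <= expR g <= 1 + 2 * g.
Proof.
have /andP[g0 g1] := g01; have h1 := expR_ge1Dx g; have := expR_ge1Dx (- g).
rewrite expRN => h2; apply/andP; split; first lra.
have e0 := expR_gt0 g.
have : (1 - g) * expR g <= 1 by rewrite -[leRHS](mulVf (lt0r_neq0 e0)) ler_wpM2r ?(ltW e0).
by move: (expR g) e0 h1 => x; nra.
Qed.

Lemma pr_sup_inf u : 0 < u <= u0 ->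
  pr P ([set w | u * expR g < supU w] `&` [set w | infU w <= u]) <= ka * pI u.
Proof.
move=> /h4; have m1 := measurable_supU (u * expR g); have m2 := measurable_infU u.
by rewrite !prE //; exact: measurableI.
Qed.

(** If the infimum is at most [u], then either the single uniform variable at [S 0] is at most
    [u * exp g], or the supremum exceeds that value, which (C4) makes rare. As [ka <= 1/2], the last
    term can be absorbed on the left. *)
Lemma pr_inf_step u : 0 < u <= u0 -> pI u <= u * expR g + ka * pI u.
Proof.
move=> hu; have u_gt0 : 0 < u by case/andP: hu.
have m1 := measurable_supU (u * expR g); have m2 := measurable_infU u.
have mU : measurable [set w | U 0 w (S 0%N) <= u * expR g] by apply: measurable_le_set; exact: measurable_Ufun.
have mI := measurableI _ _ m1 m2.
apply: le_trans (lerD (pr_Ufun_le1 mxi cF (S 0%N) (mulr_ge0 (ltW u_gt0) (expR_ge0 g))) (pr_sup_inf hu)).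
apply: le_trans (prU P mU mI); apply: pr_le => //; first exact: measurableU.
move=> w /= h; have [h1|h1] := leP (U 0 w (S 0%N)) (u * expR g); first by left.
by right; split => //; apply/supU_gt; exists 0%N.
Qed.

Lemma pr_inf_le u : 0 < u <= u0 -> pI u <= 4 * u.
Proof.
move=> hu; have h := pr_inf_step hu; have p0 : 0 <= pI u by exact: pr_ge0.
have /andP[e1 e2] := expR_small; have /andP[k0 k1] := ka01; have /andP[g0 g1] := g01.
have /andP[u_gt0 _] := hu.
have h1 : ka * pI u <= 1/2 * pI u by rewrite ler_wpM2r.
have h2 : u * expR g <= u * 2 by rewrite ler_wpM2l ?(ltW u_gt0) //; lra.
lra.
Qed.

Lemma pr_inf_ge u : 0 <= u <= 1 -> u <= pI u.
Proof.
move=> hu; rewrite -[leLHS](pr_Ufun_le mxi cF (S 0%N) hu); apply: pr_le; last 1 first.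
- move=> w /=; apply: le_trans; apply: ge_inf; last by exists (S 0%N).
  by exists 0 => _ [t _ <-]; have /andP[] := Ufun01 P mxi 0 w t.
- by apply: measurable_le_set; exact: measurable_Ufun.
- exact: measurable_infU.
Qed.

(** With [u' = u * exp (- g)], either the infimum is at most [u'] while the supremum exceeds
    [u' * exp g], to which (C4) applies, or the infimum lies in [(u', v]]; the two-sided bounds on
    its distribution function control that case. *)
Lemma piece_bracket u v : u <= v -> 0 < v -> v <= u0 -> v <= 1 ->
  pr P ([set w | exists m, U 0 w (S m) < v] `&` [set w | exists m, u < U 0 w (S m)]) <=
    4 * (v - u) + 4 * v * g + 8 * ka * v.
Proof.
move=> uv v0 vu0 v1.
have hv : 0 < v <= u0 by rewrite v0.
have /andP[e1 e2] := expR_small; have /andP[k0 k1] := ka01; have /andP[g0 g1] := g01.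
have mS c := measurable_supU c; have mI c := measurable_infU c.
have mE : measurable ([set w | exists m, U 0 w (S m) < v] `&` [set w | exists m, u < U 0 w (S m)]).
  apply: measurableI.
    rewrite (_ : [set w | _] = \bigcup_m [set w | U 0 w (S m) < v]).
      by apply: bigcup_measurable => m _; apply: measurable_lt_set; exact: measurable_Ufun.
    by apply/seteqP; split => w /= [m]; [move=> h; exists m|move=> _ h; exists m].
  by rewrite (_ : [set w | _] = [set w | u < supU w]) //; apply/seteqP; split => w /= /supU_gt.
have p1 := mulr_ge0 (ltW v0) g0; have p2 := mulr_ge0 k0 (ltW v0).
(* For [u <= 0] the bound [4 v] on the infimum suffices, since then [v <= v - u]. *)
have [u00|u_gt0] := leP u 0.
  have : pr P ([set w | exists m, U 0 w (S m) < v] `&` [set w | exists m, u < U 0 w (S m)]) <= pI v.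
    by apply: pr_le => // w /= [/infU_lt /ltW].
  by have := pr_inf_le hv; lra.
pose u' := u / expR g.
have ee : expR g != 0 by rewrite gt_eqF ?expR_gt0.
have u'E : u' * expR g = u by rewrite divfK.
have u'0 : 0 < u' by rewrite divr_gt0 ?expR_gt0.
have u'u : u' <= u by rewrite -[leRHS]u'E ler_peMr // ltW.
have hu' : 0 < u' <= u0 by rewrite u'0 (le_trans u'u) // (le_trans uv).
have u'1 : 0 <= u' <= 1 by rewrite (ltW u'0) (le_trans u'u) // (le_trans uv).
have s1 := pr_sup_inf hu'; rewrite u'E in s1.
have sub : pr P ([set w | exists m, U 0 w (S m) < v] `&` [set w | exists m, u < U 0 w (S m)]) <=
    pr P ([set w | u < supU w] `&` [set w | infU w <= u']) + pr P ([set w | infU w <= v] `\` [set w | infU w <= u']).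
  have mA1 := measurableI _ _ (mS u) (mI u'); have mA2 := measurableD (mI v) (mI u').
  apply: le_trans (prU P mA1 mA2); apply: pr_le => //; first exact: measurableU.
  move=> w [/= /infU_lt /ltW h1 /supU_gt h2].
  have [h3|h3] := leP (infU w) u'; [by left|right; split => //= h5].
have spl := pr_split P (mI v) (mI u').
rewrite (_ : [set w | infU w <= v] `&` [set w | infU w <= u'] = [set w | infU w <= u']) in spl; last first.
  by apply/seteqP; split => w /= => [[]//|h]; split => //; apply: le_trans h _; exact: le_trans u'u uv.
rewrite -!/(pI _) in spl.
have a1 := pr_inf_ge u'1; have a2 := pr_inf_step hv; have a3 := pr_inf_le hv; have a4 := pr_inf_le hu'.
have b1 : ka * pI u' <= ka * (4 * v) by rewrite ler_wpM2l //; move: (le_trans u'u uv) a4; lra.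
have b2 : ka * pI v <= ka * (4 * v) by rewrite ler_wpM2l.
have b3 : v * expR g <= v * (1 + 2 * g) by rewrite ler_wpM2l // ltW.
have b4 : u <= u' * (1 + 2 * g) by rewrite -[leLHS]u'E ler_wpM2l // ltW.
have b5 : u' * g <= v * g by rewrite ler_wpM2r // (le_trans u'u).
move: s1 sub spl a1 a2 b1 b2 b3 b4 b5; rewrite -/(pI u'); lra.
Qed.

End piece.

(** * Scales extracted from the entropy integral *)

Section entropy.
Context {R : realType}.
Variables (f : R -> R) (eps0 del : R).
Hypothesis f0 : forall x, 0 <= f x.
Hypothesis intf : (@lebesgue_measure R).-integrable `]0, eps0] (EFin \o f).
Hypothesis del0 : 0 < del <= eps0.

Let h q : R := del * (1/2) ^+ q.
Let I q : set R := `]h q.+1, h q].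

Let hS q : h q = h q.+1 + h q.+1. Proof. by rewrite /h exprS; field. Qed.
Let h_gt0 q : 0 < h q. Proof. by case/andP: del0 => d0 _; rewrite mulr_gt0 // exprn_gt0. Qed.
Let h_le q : h q <= eps0.
Proof.
by case/andP: del0 => d0; apply: le_trans; rewrite ler_piMr ?(ltW d0) // exprn_ile1 //; lra.
Qed.

Let sub0 q l : (`]h q, h l] : set R) `<=` `]0, eps0].
Proof.
move=> x /=; rewrite !in_itv /= => /andP[a b].
by rewrite (lt_trans _ a) // (le_trans b).
Qed.

Let intf' q l : (@lebesgue_measure R).-integrable `]h q, h l] (EFin \o f).
Proof. by apply: (integrableS _ _ _ intf) => //; exact: sub0. Qed.

Let J q l : R := fine (\int[@lebesgue_measure R]_(x in `]h q, h l]) (f x)%:E).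

Let JE q l : (\int[@lebesgue_measure R]_(x in `]h q, h l]) (f x)%:E = (J q l)%:E)%E.
Proof. by rewrite /J fineK //; apply: (integrable_fin_num _ (intf' q l)). Qed.

(** Covering numbers are not assumed monotone, so the scale is not prescribed: some point of each
    dyadic interval has [f] below its mean value there, up to the slack [(1/2)^q], which makes the
    contradiction strict. *)
Let pick q : exists2 e, 0 < e <= h q & f e * h q.+1 <= J q.+1 q + (1/2) ^+ q.
Proof.
apply: contrapT => no; have hq := h_gt0 q.+1.
pose c := (J q.+1 q + (1/2) ^+ q) / h q.+1.
have key : ((c * h q.+1)%:E <= (J q.+1 q)%:E)%E.
  rewrite -JE (_ : (c * h q.+1)%:E = \int[@lebesgue_measure R]_(x in `]h q.+1, h q]) (cst c%:E x))%E.
    apply: ge0_le_integral => //.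
    - move=> x _; rewrite lee_fin divr_ge0 ?(ltW hq) // addr_ge0 ?exprn_ge0 //.
      by rewrite -lee_fin -JE; apply: integral_ge0 => y _; rewrite lee_fin.
    - by have := measurable_int _ (intf' q.+1 q).
    move=> x /=; rewrite in_itv /= => /andP[x1 x2]; rewrite lee_fin /c.
    rewrite ler_pdivrMr // leNgt; apply/negP => lt; apply: no.
    by exists x; [rewrite x2 (lt_trans hq)|exact: ltW].
  rewrite integral_cst //= lebesgue_measure_itv /= lte_fin (hS q) ltrDl hq -EFinD -EFinM.
  by congr (_%:E); ring.
have : 0 < (1/2) ^+ q :> R by rewrite exprn_gt0.
move: key; rewrite lee_fin /c divfK ?gt_eqF //; lra.
Qed.

Let sumJ n : \sum_(q < n) J q.+1 q = J n 0.
Proof.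
elim: n => [|n ih].
  by rewrite big_ord0 /J set_itvoc0 integral_set0.
rewrite big_ord_recr /= ih; apply: EFin_inj; rewrite EFinD -!JE.
have hn : h n <= h 0 by rewrite /h ler_wpM2l ?expr0 ?exprn_ile1 //; [case/andP: del0 => /ltW|lra].
have hn1 : h n.+1 <= h n by rewrite [leRHS]hS lerDl ltW.
have U : [set` `]h n.+1, h 0]] = [set` `]h n, h 0]] `|` [set` `]h n.+1, h n]].
  by rewrite setUC; apply: itv_bndbnd_setU; rewrite bnd_simp.
rewrite U ge0_integral_setU //=.
- rewrite -U; exact: (measurable_int _ (intf' n.+1 0)).
- by move=> x _; rewrite lee_fin.
apply/disj_set2P; rewrite -subset0 => x /= []; rewrite !in_itv /= => /andP[a _] /andP[_ b].
by move: (lt_le_trans a b); rewrite ltxx.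
Qed.

Lemma entropy_scales : exists2 e : nat -> R, (forall q, 0 < e q <= del * (1/2) ^+ q) &
  exists B, forall n, \sum_(q < n) (1/2) ^+ q * f (e q) <= B.
Proof.
have /choice[e he] : forall q, exists e, 0 < e <= h q /\ f e * h q.+1 <= J q.+1 q + (1/2) ^+ q.
  by move=> q; have [e h1 h2] := pick q; exists e.
exists e; first by move=> q; have [] := he q.
have /andP[d0 _] := del0.
pose K := fine (\int[@lebesgue_measure R]_(x in `]0, eps0]) (f x)%:E).
(* [(1/2)^q] is [2 / del] times the length [h q.+1]; the summand 2 bounds the total slack. *)
exists (2 / del * (K + 2)) => n.
have -> : \sum_(q < n) (1/2) ^+ q * f (e q) = 2 / del * \sum_(q < n) f (e q) * h q.+1.
  by rewrite mulr_sumr; apply: eq_bigr => q _; rewrite /h exprS; field; rewrite gt_eqF.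
rewrite ler_wpM2l ?divr_ge0 ?(ltW d0) //.
apply: (@le_trans _ _ (\sum_(q < n) (J q.+1 q + (1/2) ^+ q))); first by apply: ler_sum => q _; have [] := he q.
rewrite big_split /=; apply: lerD.
  rewrite sumJ -lee_fin -JE /K fineK; last by apply: (integrable_fin_num _ intf).
  apply: ge0_subset_integral => //.
  - exact: (measurable_int _ intf).
  - by move=> x _; rewrite lee_fin.
have E m : \sum_(q < m) (1/2) ^+ q = 2 - 2 * (1/2) ^+ m :> R.
  elim: m => [|m ihm]; first by rewrite big_ord0; ring.
  by rewrite big_ord_recr /= ihm exprS; field.
have h1 : 0 <= (1/2) ^+ n :> R by apply: exprn_ge0; lra.
by rewrite E; lra.
Qed.

End entropy.

(** * Application to the tail empirical process *)

Section entropy_bound.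
Context {R : realType}.
Variables (D m0 : nat) (N : nat -> nat) (B0 : R).
Hypothesis m0_gt0 : (0 < m0)%N.
Hypothesis N_gt0 : forall q, (0 < N q)%N.
Hypothesis sumN : forall n, \sum_(q < n) (1/2) ^+ q * Num.sqrt (ln (N q)%:R) <= B0.

(** In each of the [D] coordinates there are [N q] pieces of [T] and [m0 * 4^q] grid intervals of
    length [4^-q]. *)
Definition ncells q := ((N q * (m0 * 4 ^ q)) ^ D)%N.

(** The deviation level [be] of the chaining: its square dominates the required log-cardinality, and
    the summand 1 keeps it at least 1. *)
Definition level q : R := 1 + Num.sqrt (ln (2 ^+ q.+1 * (ncells q * ncells q * ncells q.+1)%:R)).

Let L q : R := ln (N q)%:R.
Let s q := Num.sqrt (L q).

Let ln_ge0N (n : nat) : (0 < n)%N -> 0 <= ln n%:R :> R.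
Proof. by move=> n0; rewrite ln_ge0 // ler1n. Qed.

Let s2 q : s q ^+ 2 = L q. Proof. by rewrite sqr_sqrtr // ln_ge0N. Qed.

Let ncells_gt0 q : (0 < ncells q)%N.
Proof. by rewrite expn_gt0 !muln_gt0 N_gt0 m0_gt0 expn_gt0. Qed.

Let arg q : R := 2 ^+ q.+1 * (ncells q * ncells q * ncells q.+1)%:R.

Let arg_ge1 q : 1 <= arg q.
Proof.
rewrite /arg -natrX -natrM ler1n muln_gt0 expn_gt0 /=.
by rewrite !muln_gt0 !ncells_gt0.
Qed.

Lemma level_ge1 q : 1 <= level q.
Proof. by rewrite /level lerDl sqrtr_ge0. Qed.

Lemma level_exp q : 2 ^+ q.+1 * (ncells q * ncells q * ncells q.+1)%:R <= expR (level q ^+ 2).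
Proof.
have a0 : 0 < arg q by apply: lt_le_trans (arg_ge1 q).
rewrite -/(arg q) -[leLHS]lnK ?posrE // ler_expR.
have l0 : 0 <= ln (arg q) by rewrite ln_ge0.
have l1 := level_ge1 q; rewrite -[leLHS](sqr_sqrtr l0) ler_pXn2r ?nnegrE ?sqrtr_ge0 //; last lra.
by rewrite /level -/(arg q) lerDr.
Qed.

Let c : R := ln 2 + 3 * D%:R * ln m0%:R + 3 * D%:R * ln 4.

Let ln_ncells q : ln (ncells q)%:R = D%:R * (L q + ln m0%:R + q%:R * ln 4) :> R.
Proof.
have h4 : (0 < (4 ^ q)%:R :> R) by rewrite ltr0n expn_gt0.
have hm : (0 < m0%:R :> R) by rewrite ltr0n.
have hN : (0 < (N q)%:R :> R) by rewrite ltr0n.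
rewrite /ncells natrX lnXn; last by rewrite !natrM !mulr_gt0.
rewrite !natrM lnM ?posrE ?mulr_gt0 // lnM ?posrE // natrX lnXn //.
by rewrite -[LHS]mulr_natl -[ln 4 *+ q]mulr_natl addrA.
Qed.

Let ln_arg q : ln (arg q) <= c * q.+1%:R + 2 * D%:R * L q + D%:R * L q.+1.
Proof.
have nz q' : (0 < (ncells q')%:R :> R) by rewrite ltr0n.
rewrite /arg lnM ?posrE ?exprn_gt0 //; last by rewrite !natrM !mulr_gt0.
rewrite lnXn // !natrM !lnM ?posrE ?mulr_gt0 // !ln_ncells /c -mulr_natl -!(natr1 q).
have a1 : 0 <= ln 2 :> R by rewrite ln_ge0 // ler1n.
have a2 : 0 <= ln m0%:R :> R by exact: ln_ge0N.
have a3 : 0 <= ln 4 :> R by rewrite ln_ge0 // ler1n.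
have d0 : 0 <= D%:R :> R by [].
have q0 : 0 <= q%:R :> R by [].
have b1 : 0 <= D%:R * ln m0%:R * q%:R :> R by rewrite !mulr_ge0.
have b2 : 0 <= D%:R * ln 4 :> R by rewrite !mulr_ge0.
move: b1 b2; nra.
Qed.

(** A form of the subadditivity of the square root; [D >= 1] allows [D * s^2 <= (D * s)^2]. *)
Let level_le q : (0 < D)%N -> level q <= (2 + c) * q.+1%:R + 2 * D%:R * s q + D%:R * s q.+1.
Proof.
move=> D0; have c0 : 0 <= c.
  by rewrite /c !addr_ge0 ?mulr_ge0 ?ln_ge0N // ln_ge0 // ler1n.
have D1 : 1 <= D%:R :> R by rewrite ler1n.
have s0 q' : 0 <= s q' by exact: sqrtr_ge0.
have q1 : 1 <= q.+1%:R :> R by rewrite ler1n.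
set Y := 1 + c * q.+1%:R + 2 * D%:R * s q + D%:R * s q.+1.
have cq : 0 <= c * q.+1%:R by rewrite mulr_ge0.
have e1 : 0 <= D%:R * s q by rewrite mulr_ge0.
have e2 : 0 <= D%:R * s q.+1 by rewrite mulr_ge0.
have Y0 : 0 <= Y by rewrite /Y; lra.
suff : Num.sqrt (ln (arg q)) <= Y.
  by rewrite /level -/(arg q) /Y; lra.
rewrite -(ger0_norm Y0) -sqrtr_sqr ler_sqrt ?sqr_ge0 //.
apply: le_trans (ln_arg q) _; rewrite -!s2.
have f1 : D%:R * s q ^+ 2 <= (D%:R * s q) ^+ 2.
  by rewrite exprMn ler_wpM2r ?sqr_ge0 // expr2 ler_peMr.
have f2 : D%:R * s q.+1 ^+ 2 <= (D%:R * s q.+1) ^+ 2.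
  by rewrite exprMn ler_wpM2r ?sqr_ge0 // expr2 ler_peMr.
rewrite /Y -!mulrA; move: f1 f2 cq e1 e2.
set a := D%:R * s q; set b := D%:R * s q.+1; set x := c * q.+1%:R.
set a' := D%:R * s q ^+ 2; set b' := D%:R * s q.+1 ^+ 2 => f1 f2 x0 a0 b0.
have p1 := mulr_ge0 x0 a0; have p2 := mulr_ge0 x0 b0; have p3 := mulr_ge0 a0 b0.
have p4 := sqr_ge0 x; have p5 := sqr_ge0 a; nra.
Qed.

Let sum_lin n : \sum_(q < n) (1/2) ^+ q * q.+1%:R <= 4 :> R.
Proof.
have E m : \sum_(q < m) (1/2) ^+ q * q.+1%:R = 4 - 2 * m.+2%:R * (1/2) ^+ m :> R.
  elim: m => [|m ih]; first by rewrite big_ord0; ring.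
  by rewrite big_ord_recr /= ih exprS -!natr1; field.
have h : 0 <= (1/2) ^+ n :> R by apply: exprn_ge0; lra.
by rewrite E gerBl mulr_ge0.
Qed.

Lemma sum_level : (0 < D)%N -> exists B, forall n, \sum_(q < n) (1/2) ^+ q * level q <= B.
Proof.
move=> D0; have c0 : 0 <= c.
  by rewrite /c !addr_ge0 ?mulr_ge0 ?ln_ge0N // ln_ge0 // ler1n.
exists ((2 + c) * 4 + 2 * D%:R * B0 + D%:R * (2 * B0)) => n.
have h q : 0 <= (1/2) ^+ q :> R by apply: exprn_ge0; lra.
apply: (@le_trans _ _ (\sum_(q < n) ((2 + c) * ((1/2) ^+ q * q.+1%:R) + 2 * D%:R * ((1/2) ^+ q * s q) + D%:R * (2 * ((1/2) ^+ q.+1 * s q.+1))))).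
  apply: ler_sum => q _; apply: le_trans (ler_wpM2l (h q) (level_le q D0)) _.
  by apply: eq_ler; rewrite exprS; field.
rewrite !big_split /= -!mulr_sumr; apply: lerD; first apply: lerD.
- by apply: ler_wpM2l; [lra|exact: sum_lin].
- by rewrite ler_wpM2l // ?mulr_ge0 //; exact: sumN.
rewrite ler_wpM2l // ler_wpM2l //.
have := sumN n.+1; rewrite big_ord_recl expr0 mul1r.
have : 0 <= Num.sqrt (ln (N 0)%:R) :> R by exact: sqrtr_ge0.
under eq_bigr do rewrite lift0.
by move=> h0 h1; apply: le_trans h1; rewrite -[leLHS]add0r lerD.
Qed.

End entropy_bound.

(** * Regions, cells and brackets of the tail empirical process *)

Section setting.
Context {R : realType} {T : pseudoMetricType R} {d : measure_display} {Om : measurableType d}.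
Variables (P : probability Om R) (xi : nat -> Om -> T -> R) (k : nat -> R) (D : nat) (M : R).
Hypothesis cpt : compact [set: T].
Hypothesis cxi : forall i w, continuous (xi i w).
Hypothesis mxi : forall i t, measurable_fun setT (fun w => xi i w t).
Hypothesis indep : forall n (E : nat -> set Om),
  (forall i, (i < n)%N -> exists2 B, @cylm R T B & E i = xi i @^-1` B) ->
  fine (P [set w | forall i, (i < n)%N -> E i w]) = \prod_(i < n) fine (P (E i)).
Hypothesis ident : forall i B, @cylm R T B -> P (xi i @^-1` B) = P (xi 0%N @^-1` B).
Hypothesis cF : forall t, continuous (Fdist P (fun w => xi 0%N w t)).
Hypothesis k_range : forall n, (0 < n)%N -> 0 < k n <= n%:R.
Hypothesis koo : k @ \oo --> +oo.
Hypothesis kn0 : (fun n => k n / n%:R) @ \oo --> (0 : R).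
Hypothesis C3 : forall m, (2 <= m <= 2 * D)%N -> forall (t : 'I_m -> T) (x : 'I_m -> R),
  (forall j, 0 <= x j) ->
  cvg ((fun s : R => s^-1 * fine (P [set w | forall j, Ufun P xi 0 w (t j) <= s * x j])) @ 0^'+).
Local Notation V := (Vt T D M).
Local Notation U := (Ufun P xi).

Let k0 n : (0 < n)%N -> 0 < k n. Proof. by move=> /k_range/andP[]. Qed.

Lemma vd_range (v : V) : (0 < vd (sval v) <= D)%N.
Proof. by case: v => v []. Qed.

Lemma vx_range (v : V) j : 0 <= @vx R T (sval v) j <= M.
Proof. by case: v j => v []. Qed.

(* The value at n = 0 is irrelevant; it only keeps [scale] positive. *)
Definition scale n : R := if n == 0%N then 1 else k n / n%:R.

Lemma scale_gt0 n : 0 < scale n.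
Proof. by rewrite /scale; case: n => // n /=; rewrite divr_gt0 // k0. Qed.

Lemma scaleE n : (0 < n)%N -> n%:R / k n = (scale n)^-1.
Proof. by case: n => // n _; rewrite /scale /= invf_div. Qed.

Lemma scale_cvg : scale @ \oo --> (0 : R).
Proof.
apply: cvg_trans kn0; apply: near_eq_cvg; near=> n; rewrite /scale gtn_eqF //.
by near: n; exact: nbhs_infty_gt.
Unshelve. all: by end_near.
Qed.

Definition region n (v : V) (i : nat) : set Om :=
  [set w | forall j, U i w (@vt R T (sval v) j) < scale n * @vx R T (sval v) j].

Lemma Obs_U_lt t c : Obs xi (fun i => [set w | U i w t < c]).
Proof.
apply: Obs_ext (Obs_Ufun cF t (measurable_itv `]-oo, c[)) _ => i.
by apply/seteqP; split => w; rewrite /= in_itv.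
Qed.

Lemma Obs_U_le t c : Obs xi (fun i => [set w | U i w t <= c]).
Proof.
apply: Obs_ext (Obs_Ufun cF t (measurable_itv `]-oo, c])) _ => i.
by apply/seteqP; split => w; rewrite /= in_itv.
Qed.

Lemma Obs_region n v : Obs xi (region n v).
Proof.
exact: (Obs_forall (E := fun j i => [set w | U i w (@vt R T (sval v) j) < scale n * @vx R T (sval v) j])
  (fun j => Obs_U_lt _ _)).
Qed.

Lemma Wn_Dn n w v : (0 < n)%N -> Wn P xi k n w v = Dn P (k n) n (region n v) w.
Proof.
move=> n0; have kn := k0 n0; have sk : 0 < Num.sqrt (k n) by rewrite sqrtr_gt0.
have nn : 0 < n%:R :> R by rewrite ltr0n.
rewrite /Wn /Dn sumrB sumr_const card_ord.
have E i : [set w' | forall j, U i w' (@vt R T (sval v) j) < k n / n%:R * @vx R T (sval v) j] = region n v i.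
  by rewrite /region /scale gtn_eqF.
rewrite -/(pr P _) E.
rewrite (eq_bigr (fun i : 'I_n => (\1_(region n v i) w : R))); last first.
  by move=> i _; rewrite indicE -E; case: asboolP => h; [rewrite mem_set|rewrite memNset].
have kE : k n = Num.sqrt (k n) ^+ 2 by rewrite sqr_sqrtr // ltW.
rewrite -[pr _ _ *+ n]mulr_natl; move: sk kE; set s := Num.sqrt (k n) => sk kE.
by rewrite kE; field; rewrite gt_eqF.
Qed.

(** (C3) is stated with weak inequalities and regions with strict ones; the two events differ inside
    a finite union of null events. *)
Lemma pr_le_lt m (t : 'I_m -> T) (c : 'I_m -> R) :
  pr P [set w | forall j, U 0 w (t j) <= c j] = pr P [set w | forall j, U 0 w (t j) < c j].
Proof.
have m1 : measurable [set w | forall j, U 0 w (t j) <= c j].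
  exact: (Obs_measurable mxi 0 (Obs_forall (E := fun j i => [set w | U i w (t j) <= c j]) (fun j => Obs_U_le _ _))).
have m2 : measurable [set w | forall j, U 0 w (t j) < c j].
  exact: (Obs_measurable mxi 0 (Obs_forall (E := fun j i => [set w | U i w (t j) < c j]) (fun j => Obs_U_lt _ _))).
rewrite (pr_split P m1 m2) setIidr; last by move=> w h j; exact: ltW.
apply/eqP; rewrite eq_sym -subr_eq0 opprD addrA subrr add0r oppr_eq0 eq_le pr_ge0 andbT.
have mq j : measurable [set w | U 0 w (t j) = c j].
  by have := measurable_Ufun mxi cF 0 (t j) measurableT (measurable_set1 (c j)); rewrite setTI.
apply: le_trans (pr_bigU (B := fun j => [set w | U 0 w (t j) = c j]) (Q := xpredT) P (measurableD m1 m2) mq _) _.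
  move=> w [h1 /= /existsNP[j /negP h2]]; exists j => //.
  by apply/eqP; rewrite eq_le h1 leNgt.
by rewrite big1 // => j _; exact: pr_Ufun_eq.
Qed.

Lemma forall_catf (v w : V) (Q : T -> R -> Prop) :
  (forall j, Q (catf (@vt R T (sval v)) (@vt R T (sval w)) j) (catf (@vx R T (sval v)) (@vx R T (sval w)) j)) <->
  (forall j, Q (@vt R T (sval v) j) (@vx R T (sval v) j)) /\ (forall j, Q (@vt R T (sval w) j) (@vx R T (sval w) j)).
Proof.
split; last by move=> [h1 h2] j; rewrite /catf; case: fintype.split.
by move=> h; split => j; [have := h (lshift _ j)|have := h (rshift _ j)];
  rewrite /catf -/(unsplit (inl j)) -/(unsplit (inr j)) unsplitK.
Qed.

(** Listing the constraints twice does not change the event. Variances thus become covariances, and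
    indices with one coordinate fall under (C3) with [m = 2]. *)
Lemma Rfun_Rcov (v : V) : Rfun P xi (@vt R T (sval v)) (@vx R T (sval v)) = Rcov P xi v v.
Proof.
rewrite /Rcov /Rfun; congr (lim (_ @ 0^'+)); apply/funext => s; congr (_ * fine (P _)).
apply/seteqP; split => w /=; first by move=> h; apply/(forall_catf v v (fun t x => U 0 w t <= s * x)).
by move=> /(forall_catf v v (fun t x => U 0 w t <= s * x))[].
Qed.

Lemma region_cov v w : (fun n => n%:R / k n * pr P (region n v 0%N `&` region n w 0%N)) @ \oo --> Rcov P xi v w.
Proof.
have hm : (2 <= vd (sval v) + vd (sval w) <= 2 * D)%N.
  by have := vd_range v; have := vd_range w; lia.
have hx j : 0 <= catf (@vx R T (sval v)) (@vx R T (sval w)) j.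
  by rewrite /catf; case: fintype.split => j'; [have /andP[] := vx_range j'|have /andP[] := vx_range j'].
have h := @C3 _ hm (catf (@vt R T (sval v)) (@vt R T (sval w))) (catf (@vx R T (sval v)) (@vx R T (sval w))) hx.
have := (cvg_at_rightP _ _ _).1 h scale (conj scale_gt0 scale_cvg).
apply: cvg_trans; apply: near_eq_cvg; near=> n.
have n0 : (0 < n)%N by near: n; exact: nbhs_infty_gt.
rewrite scaleE //; congr (_ * _); rewrite -/(pr P _) pr_le_lt; congr (pr P _).
apply/seteqP; split => o /=; last by move=> h'; apply/(forall_catf v w (fun t x => U 0 o t < scale n * x)).
by move=> /(forall_catf v w (fun t x => U 0 o t < scale n * x)).
Unshelve. all: by end_near.
Qed.

Lemma rho2E v w : rho2 P xi v w = Num.sqrt (sqdist (@Rcov _ _ _ P T xi D M) v w).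
Proof. by rewrite /rho2 !Rfun_Rcov. Qed.

Variables (c1 c2 u0 eps0 : R) (N : R -> nat) (Tc : R -> nat -> set T).
Hypothesis c1_gt0 : 0 < c1.
Hypothesis c2_gt0 : 0 < c2.
Hypothesis u0_gt0 : 0 < u0.
Hypothesis eps0_gt0 : 0 < eps0.
Hypothesis Tcov : forall e, 0 < e <= eps0 -> [set: T] = \bigcup_(j in `I_(N e)) Tc e j.
Hypothesis C4 : forall u e j, 0 < u <= u0 -> 0 < e <= eps0 -> (j < N e)%N ->
  (P ([set w | (u * expR (c1 * e ^+ 2) < sup [set Ufun P xi 0 w t | t in Tc e j])%R]
     `&` [set w | (inf [set Ufun P xi 0 w t | t in Tc e j] <= u)%R])
   <= (c2 * e ^+ 2)%R%:E * P [set w | (inf [set Ufun P xi 0 w t | t in Tc e j] <= u)%R])%E.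
Hypothesis intN : (@lebesgue_measure R).-integrable `]0, eps0]
  (fun e => (Num.sqrt (ln (N e)%:R))%:E).
Hypothesis D_gt0 : (0 < D)%N.
Hypothesis M_gt0 : 0 < M.
Variable t0 : T.

Definition origin : V.
exists (@VRec R T 1 (fun=> t0) (fun=> 0)); split => /=; first by rewrite D_gt0.
by move=> _; rewrite lexx (ltW M_gt0).
Defined.

(** The bound by 1 gives [delta^2 <= delta], and the last bound then yields [c1 * delta^2 <= 1/2]
    and [c2 * delta^2 <= 1/2], as the estimates on pieces require. *)
Let delta := Num.min eps0 (Num.min 1 (2 * (c1 + c2 + 1))^-1).

Let delta_gt0 : 0 < delta.
Proof. by rewrite !lt_min eps0_gt0 ltr01 invr_gt0 mulr_gt0 //; have := c1_gt0; have := c2_gt0; lra. Qed.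

Let delta_eps : 0 < delta <= eps0.
Proof. by rewrite delta_gt0 ge_min lexx. Qed.

Let scales := @entropy_scales R (fun x => Num.sqrt (ln (N x)%:R)) eps0 delta (fun x => sqrtr_ge0 _) intN delta_eps.
Let e := s2val (cid2 scales).

Let e_range q : 0 < e q <= delta * (1/2) ^+ q.
Proof. by rewrite /e; case: (cid2 scales) => /= ? h _. Qed.

Let half_le1 q : (1/2) ^+ q <= 1 :> R. Proof. by rewrite exprn_ile1 //; lra. Qed.

Let e_eps q : 0 < e q <= eps0.
Proof.
have /andP[a b] := e_range q; rewrite a (le_trans b) //.
by apply: le_trans (_ : delta <= _); [rewrite ler_piMr ?(ltW delta_gt0)|have /andP[] := delta_eps].
Qed.

Let e_sqr q : e q ^+ 2 <= delta ^+ 2 * (1/4) ^+ q.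
Proof.
have /andP[a b] := e_range q.
rewrite -half_sqr -exprMn ler_pXn2r ?nnegrE ?(ltW a) //.
exact: le_trans (ltW a) b.
Qed.

Let N_gt0 q : (0 < N (e q))%N.
Proof.
have : [set: T] t0 by []; rewrite (Tcov (e_eps q)) => -[j /= jN _]; exact: leq_ltn_trans jN.
Qed.

Let m0 := Num.bound M.
Let M_m0 : M < m0%:R. Proof. by apply: archi_boundP; exact: ltW. Qed.
Let m0_gt0 : (0 < m0)%N. Proof. by rewrite -(ltr0n R); exact: lt_trans M_m0. Qed.

Let L q := (m0 * 4 ^ q)%N.
Let K q : finType := {ffun 'I_D -> 'I_(N (e q)) * 'I_(L q)}.

Let cardK q : #|K q| = ncells D m0 (fun q => N (e q)) q.
Proof. by rewrite card_ffun card_prod !card_ord. Qed.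

(* Missing coordinates repeat coordinate 0, so that cells of all dimensions are indexed alike. *)
Let pad (v : V) (j : 'I_D) : 'I_(vd (sval v)) :=
  insubd (Ordinal (proj1 (andP (vd_range v)))) (j : nat).

Let pad_surj v j' : exists j, pad v j = j'.
Proof.
have jD : (j' < D)%N by apply: leq_trans (ltn_ord j') _; have /andP[] := vd_range v.
by exists (Ordinal jD); apply: val_inj; rewrite /pad val_insubd /= ltn_ord.
Qed.

Let cellT_ex q t : exists j : 'I_(N (e q)), Tc (e q) j t.
Proof.
have : [set: T] t by []; rewrite (Tcov (e_eps q)) => -[j /= jN h].
by exists (Ordinal jN).
Qed.

Let cellX_ex q (x : R) : exists l : 'I_(L q), 0 <= x <= M -> l%:R <= x * 4 ^+ q < l.+1%:R.
Proof.
have L0 : (0 < L q)%N by rewrite muln_gt0 m0_gt0 expn_gt0.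
have [/andP[x0 xM]|h] := boolP (0 <= x <= M); last by exists (Ordinal L0).
have y0 : 0 <= x * 4 ^+ q by rewrite mulr_ge0 // exprn_ge0.
have /andP[a b] := Num.Theory.truncn_itv y0.
have lt : (Num.truncn (x * 4 ^+ q) < L q)%N.
  rewrite -(ltr_nat R); apply: le_lt_trans a _; rewrite /L natrM natrX.
  by rewrite ltr_pM2r ?exprn_gt0 // (le_lt_trans xM).
by exists (Ordinal lt); rewrite /= a.
Qed.

Let cell q (v : V) : K q := [ffun j => (sval (cid (cellT_ex q (@vt R T (sval v) (pad v j)))),
                                       sval (cid (cellX_ex q (@vx R T (sval v) (pad v j)))))].

Let S_ex q (j : nat) : exists S : nat -> T, Tc (e q) j !=set0 -> (forall m, Tc (e q) j (S m)) /\
  forall t, Tc (e q) j t -> exists f : nat -> nat, (fun n => S (f n)) @ \oo --> t.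
Proof.
have [h|h] := pselect (Tc (e q) j !=set0); last by exists (fun=> t0).
by have [S hS] := dense_sub cpt h; exists S.
Qed.

Let S q j := sval (cid (S_ex q j)).

Let SP q j t : Tc (e q) j t -> (forall m, Tc (e q) j (S q j m)) /\
  forall t, Tc (e q) j t -> exists f : nat -> nat, (fun n => S q j (f n)) @ \oo --> t.
Proof. by move=> h; apply: (svalP (cid (S_ex q j))); exists t. Qed.

Let xup q (l : nat) : R := l.+1%:R / 4 ^+ q.
(* One grid step below the cell, because regions are defined by strict inequalities. *)
Let xlo q (l : nat) : R := (l%:R - 1) / 4 ^+ q.

(** In each coordinate [up] asks that the infimum of [U i] over the piece be below the upper grid
    value, and [lo] that its supremum not exceed the lower one. Both are expressed on the dense
    sequence [S], which makes them measurable. *)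
Let up n q (c : K q) i : set Om :=
  [set w | forall j, exists m, U i w (S q (c j).1 m) < scale n * xup q (c j).2].
Let lo n q (c : K q) i : set Om :=
  [set w | forall j, forall m, U i w (S q (c j).1 m) <= scale n * xlo q (c j).2].

Let oup n q (c : K q) : Obs xi (up n c).
Proof.
apply: (Obs_forall (E := fun j i => [set w | exists m, U i w (S q (c j).1 m) < scale n * xup q (c j).2])) => j.
apply: Obs_ext (Obs_bigcup (fun m => Obs_U_lt (S q (c j).1 m) (scale n * xup q (c j).2))) _ => i.
by apply/seteqP; split => w /= [m]; [move=> _ h; exists m|exists m].
Qed.

Let olo n q (c : K q) : Obs xi (lo n c).
Proof.
apply: (Obs_forall (E := fun j i => [set w | forall m, U i w (S q (c j).1 m) <= scale n * xlo q (c j).2])) => j.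
apply: Obs_ext (Obs_bigcap (fun m => Obs_U_le (S q (c j).1 m) (scale n * xlo q (c j).2))) _ => i.
by apply/seteqP; split => w /= h m; [apply: h|move=> _; apply: h].
Qed.

Let cell1 q v j : Tc (e q) (cell q v j).1 (@vt R T (sval v) (pad v j)).
Proof. by rewrite ffunE; exact: (svalP (cid (cellT_ex _ _))). Qed.

Let cell2 q v j : (cell q v j).2%:R <= @vx R T (sval v) (pad v j) * 4 ^+ q < (cell q v j).2.+1%:R.
Proof. by rewrite ffunE; apply: (svalP (cid (cellX_ex _ _))); exact: vx_range. Qed.

Let p4 q : 0 < 4 ^+ q :> R. Proof. by rewrite exprn_gt0. Qed.

Let loA n q v i : lo n (cell q v) i `<=` region n v i.
Proof.
move=> w h j'; have [j <-] := pad_surj j'.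
rewrite ltNge; apply/negP => ge.
have [_ SD] := SP (cell1 q v j); have /andP[a _] := cell2 q v j.
have lt : scale n * xlo q (cell q v j).2 < U i w (@vt R T (sval v) (pad v j)).
  by apply: lt_le_trans ge; rewrite ltr_pM2l ?scale_gt0 // /xlo ltr_pdivrMr //; lra.
have ex2 : exists2 t, Tc (e q) (cell q v j).1 t & scale n * xlo q (cell q v j).2 < U i w t.
  by exists (@vt R T (sval v) (pad v j)) => //; exact: cell1.
by have [m] := dense_gt cxi mxi cF SD ex2; rewrite ltNge h.
Qed.

Let upA n q v i : region n v i `<=` up n (cell q v) i.
Proof.
move=> w h j; have [_ SD] := SP (cell1 q v j); have /andP[_ b] := cell2 q v j.
apply: (@dense_lt _ _ _ _ P xi cxi mxi cF _ _ i w (scale n * xup q (cell q v j).2) SD).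
exists (@vt R T (sval v) (pad v j)); first exact: cell1.
apply: lt_trans (h (pad v j)) _.
by rewrite ltr_pM2l ?scale_gt0 // /xup ltr_pdivlMr.
Qed.

(** The bound of [piece_bracket] summed over [D] coordinates: 8 comes from a grid gap of [2 * 4^-q],
    and the rest from thresholds of at most [scale n * (M + 1)] with [eps^2 <= delta^2 * 4^-q]. *)
Let C : R := D%:R * (8 + (M + 1) * delta ^+ 2 * (4 * c1 + 8 * c2)).

Let C_gt0 : 0 < C.
Proof.
rewrite mulr_gt0 ?ltr0n // ltr_pwDl // mulr_ge0 //; last by have := c1_gt0; have := c2_gt0; lra.
by apply: mulr_ge0 (sqr_ge0 delta); have := M_gt0; lra.
Qed.

Let small_delta : c1 * delta ^+ 2 <= 1/2 /\ c2 * delta ^+ 2 <= 1/2.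
Proof.
have h1 : delta <= 1 by rewrite !ge_min lexx orbT.
have h2 : delta <= (2 * (c1 + c2 + 1))^-1 by rewrite !ge_min lexx !orbT.
have cc : 0 < 2 * (c1 + c2 + 1) by have := c1_gt0; have := c2_gt0; lra.
have h3 : delta ^+ 2 <= (2 * (c1 + c2 + 1))^-1.
  by apply: le_trans h2; rewrite expr2 ler_piMr // ltW.
rewrite -(ler_pM2l cc) mulfV ?gt_eqF // in h3.
have := mulr_ge0 (ltW c1_gt0) (sqr_ge0 delta); have := mulr_ge0 (ltW c2_gt0) (sqr_ge0 delta).
have := sqr_ge0 delta; split; lra.
Qed.

(** A point of [up] outside [lo] violates the lower constraint at some coordinate [j] while meeting
    the upper one there, hence lies in [B j]. [n1] makes all scaled thresholds at most [min u0 1],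
    the range of (C4) and of the uniform marginals. *)
Let hbr : exists n1, forall n q v, (n1 <= n)%N ->
  n%:R / k n * pr P (up n (cell q v) 0%N `\` lo n (cell q v) 0%N) <= C * (1/4) ^+ q.
Proof.
have um : 0 < Num.min u0 1 / (M + 1).
  by rewrite divr_gt0 ?lt_min ?u0_gt0 ?ltr01 //; have := M_gt0; lra.
have [n1 _ hn1] := cvgr_lt _ scale_cvg _ um.
exists (maxn 1 n1) => n q v; rewrite geq_max => /andP[n0 n1n].
have sc := scale_gt0 n; have sM : scale n * (M + 1) <= Num.min u0 1.
  by rewrite -ler_pdivlMr; [exact: ltW (hn1 n n1n)|have := M_gt0; lra].
rewrite scaleE // mulrC ler_pdivrMr // -mulrA.
have q4 : 0 < (1/4) ^+ q :> R by apply: exprn_gt0; lra.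
have q41 : (1/4) ^+ q <= 1 :> R by rewrite exprn_ile1 //; lra.
have i4 : (1/4) ^+ q = (4 ^+ q)^-1 :> R by rewrite exprMn expr1n mul1r exprVn.
pose B j := [set w | exists m, U 0 w (S q (cell q v j).1 m) < scale n * xup q (cell q v j).2] `&`
            [set w | exists m, scale n * xlo q (cell q v j).2 < U 0 w (S q (cell q v j).1 m)].
have mB j : measurable (B j).
  apply: measurableI.
    apply: (Obs_measurable mxi 0 (E := fun i => [set w | exists m, U i w (S q (cell q v j).1 m) < scale n * xup q (cell q v j).2])).
    apply: Obs_ext (Obs_bigcup (fun m => Obs_U_lt (S q (cell q v j).1 m) (scale n * xup q (cell q v j).2))) _ => i.
    by apply/seteqP; split => w /= [m]; [move=> _ h; exists m|exists m].
  apply: (Obs_measurable mxi 0 (E := fun i => [set w | exists m, scale n * xlo q (cell q v j).2 < U i w (S q (cell q v j).1 m)])).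
  apply: Obs_ext (Obs_bigcup (fun m => ObsC (Obs_U_le (S q (cell q v j).1 m) (scale n * xlo q (cell q v j).2)))) _ => i.
  by apply/seteqP; split => w /= [m]; [move=> _ /negP; rewrite -ltNge => h; exists m|move=> h; exists m => //; apply/negP; rewrite -ltNge].
have mD : measurable (up n (cell q v) 0%N `\` lo n (cell q v) 0%N).
  by apply: measurableD; [exact: Obs_measurable (oup _ _)|exact: Obs_measurable (olo _ _)].
apply: le_trans (pr_bigU (B := B) (Q := xpredT) P mD mB _) _.
  move=> w [h1 /existsNP[j /existsNP[m /negP h2]]]; exists j => //; split => /=; first exact: h1.
  by exists m; rewrite ltNge.
pose Y : R := 8 + (M + 1) * delta ^+ 2 * (4 * c1 + 8 * c2).
rewrite [leRHS](_ : _ = \sum_(j < D) (Y * ((1/4) ^+ q * scale n))); last first.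
  by rewrite sumr_const card_ord -[RHS]mulr_natl /C -[LHS]mulrA.
apply: ler_sum => j _.
have [SA SD] := SP (cell1 q v j); have /andP[a b] := cell2 q v j.
have /andP[x0 xM] := vx_range (pad v j).
have Nj : ((cell q v j).1 < N (e q))%N by exact: ltn_ord.
have /andP[eq0 _] := e_eps q.
have es := e_sqr q; have es0 := sqr_ge0 (e q).
have [sd1 sd2] := small_delta.
have d2 := sqr_ge0 delta.
have e2d : e q ^+ 2 <= delta ^+ 2 by apply: le_trans es _; rewrite ler_piMr.
have g01 : 0 <= c1 * e q ^+ 2 <= 1/2.
  rewrite mulr_ge0 ?(ltW c1_gt0) //=; apply: le_trans sd1.
  by rewrite ler_wpM2l // ltW.
have ka01 : 0 <= c2 * e q ^+ 2 <= 1/2.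
  rewrite mulr_ge0 ?(ltW c2_gt0) //=; apply: le_trans sd2.
  by rewrite ler_wpM2l // ltW.
have xup_le : xup q (cell q v j).2 <= M + 1.
  rewrite /xup ler_pdivrMr // -natr1 mulrDl mul1r lerD //.
    by apply: le_trans a _; rewrite ler_wpM2r // ltW.
  by rewrite exprn_ege1 // ler1n.
have xup0 : 0 < xup q (cell q v j).2 by rewrite divr_gt0.
have v_le : scale n * xup q (cell q v j).2 <= Num.min u0 1.
  by apply: le_trans sM; rewrite ler_wpM2l // ltW.
have vu : scale n * xup q (cell q v j).2 <= u0 by apply: le_trans v_le _; rewrite ge_min lexx.
have v1 : scale n * xup q (cell q v j).2 <= 1 by apply: le_trans v_le _; rewrite ge_min lexx orbT.
have diff : xup q (cell q v j).2 - xlo q (cell q v j).2 = 2 * (1/4) ^+ q.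
  by rewrite /xup /xlo i4 -mulrBl -natr1; congr (_ * _); ring.
have uv : scale n * xlo q (cell q v j).2 <= scale n * xup q (cell q v j).2.
  by rewrite ler_pM2l // -subr_ge0 diff mulr_ge0 // ltW.
have h4 u (hu : 0 < u <= u0) := C4 hu (e_eps q) Nj.
apply: le_trans (piece_bracket cxi mxi cF SA SD g01 ka01 h4 uv (mulr_gt0 sc xup0) vu v1) _.
rewrite -mulrBr diff.
set y := (1/4) ^+ q in es q4 *; set X := xup q _ in xup_le xup0 *.
have z1 : scale n * X * e q ^+ 2 <= scale n * ((M + 1) * delta ^+ 2 * y).
  by rewrite -mulrA ler_pM2l // -mulrA ler_pM // ltW.
have z2 := ler_wpM2l (ltW c1_gt0) z1; have z3 := ler_wpM2l (ltW c2_gt0) z1.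
move: z2 z3; set z := scale n * X * _; set z' := scale n * (_ * y) => z2 z3.
have -> : 4 * (scale n * X) * (c1 * e q ^+ 2) = 4 * (c1 * z) by rewrite /z; ring.
have -> : 8 * (c2 * e q ^+ 2) * (scale n * X) = 8 * (c2 * z) by rewrite /z; ring.
have -> : (8 + (M + 1) * delta ^+ 2 * (4 * c1 + 8 * c2)) * (y * scale n) =
   8 * y * scale n + 4 * (c1 * z') + 8 * (c2 * z') by rewrite /z'; ring.
have -> : 4 * (scale n * (2 * y)) = 8 * y * scale n by ring.
lra.
Qed.

Let be := level (R := R) D m0 (fun q => N (e q)).

Let be1 q : 1 <= be q. Proof. exact: level_ge1. Qed.

Let hbe q : 2 ^+ q.+1 * (#|K q| * #|K q| * #|K q.+1|)%:R <= expR (be q ^+ 2).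
Proof. by rewrite !cardK; apply: level_exp. Qed.

Let sumbe : exists B, forall n, \sum_(q < n) (1/2) ^+ q * be q <= B.
Proof.
have [B hB] := s2valP' (cid2 scales).
exact: (sum_level m0_gt0 N_gt0 hB D_gt0).
Qed.

Local Notation r := (sqdist (@Rcov _ _ _ P T xi D M)).

Lemma region_sd v w : (fun n => n%:R / k n * sd P (region n v 0%N) (region n w 0%N)) @ \oo --> r v w.
Proof. exact: (sqdist_cvg mxi Obs_region region_cov). Qed.

Lemma region_aec (eta eps : R) : 0 < eta -> 0 < eps -> exists2 Delta : R, 0 < Delta &
  \forall n \near \oo, exists Bd, [/\ measurable Bd, pr P Bd <= eps &
    forall w, ~ Bd w -> forall v v', r v v' < Delta ->
      `|Dn P (k n) n (region n v) w - Dn P (k n) n (region n v') w| <= eta].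
Proof.
move=> eta0 eps1; have [n1 hb] := hbr; have [B hB] := sumbe.
exact: (asymptotic_equicontinuity mxi indep ident origin k0 koo Obs_region olo oup loA upA C_gt0 hb be1 hbe hB region_sd eta0 eps1).
Qed.

Lemma region_tb x : 0 < x -> exists m (c : 'I_m -> V), forall v, exists j, r v (c j) < x.
Proof.
move=> x0; have [n1 hb] := hbr.
have [q hq] : exists q, C * (1/4) ^+ q < x.
  have h : (fun q => C * (1/4) ^+ q : R) @ \oo --> (C * 0 : R).
    by apply: cvgM; [exact: cvg_cst|apply: cvg_expr; rewrite ger0_norm; lra].
  rewrite mulr0 in h; have [q _ hq] := cvgr_lt _ h _ x0; exists q; exact: (hq q (leqnn q)).
exists #|K q|, (fun i => rep origin cell (enum_val i)) => v; exists (enum_rank (cell q v)).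
rewrite enum_rankK; apply: le_lt_trans hq.
by apply: (limit_dist_same_cell mxi k0 Obs_region olo oup loA upA hb region_sd); rewrite cell_rep.
Qed.

End setting.

Section gaussian_coordinate.
Context {R : realType} {T : pseudoMetricType R} {d : measure_display} {Om : measurableType d}.
Variables (P : probability Om R) (xi : nat -> Om -> T -> R).
Hypothesis mxi : forall i t, measurable_fun setT (fun w => xi i w t).
Hypothesis cF : forall t, continuous (Fdist P (fun w => xi 0%N w t)).

Lemma gauss_coord_chf t th a :
  Ex P (fun w => cos (a * gaussq (1 - Fdist P (fun w' => xi 0%N w' t) (xi 0%N w t)) + th)) =
  cos th * expR (- (a ^+ 2 / 2)).
Proof.
exact: (Ex_gaussq_cos (measurable_Ufun mxi cF 0 t) (fun y => @pr_Ufun_le _ _ _ _ _ _ mxi cF t y) th a).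
Qed.

End gaussian_coordinate.

Theorem theorem1 (R : realType) (T : pseudoMetricType R)
  (d : measure_display) (Om : measurableType d) (P : probability Om R)
  (xi : nat -> Om -> T -> R) (k : nat -> R) (D : nat) (M : R) :
  (* (T, rho) compact metric space *)
  hausdorff_space T -> compact [set: T] ->
  (* xi_1, xi_2, ... (here xi 0, xi 1, ...) random elements of C(T) *)
  (forall i w, continuous (xi i w)) ->
  (forall i t, measurable_fun setT (fun w => xi i w t)) ->
  (* independence *)
  (forall n (E : nat -> set Om),
     (forall i, (i < n)%N -> exists2 B, @cylm R T B & E i = xi i @^-1` B) ->
     fine (P [set w | forall i, (i < n)%N -> E i w]) = \prod_(i < n) fine (P (E i))) ->
  (* identically distributed *)
  (forall i B, @cylm R T B -> P (xi i @^-1` B) = P (xi 0%N @^-1` B)) ->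
  (* (C1) *)
  (forall t, continuous (Fdist P (fun w => xi 0%N w t))) ->
  (* (C2) *)
  (forall n, (0 < n)%N -> 0 < k n <= n%:R) ->
  k @ \oo --> +oo ->
  (fun n => k n / n%:R) @ \oo --> 0 ->
  (* (C3) *)
  (forall m, (2 <= m <= 2 * D)%N -> forall (t : 'I_m -> T) (x : 'I_m -> R),
     (forall j, 0 <= x j) ->
     cvg ((fun s : R => s^-1 * fine (P [set w | forall j, Ufun P xi 0 w (t j) <= s * x j]))
            @ 0^'+)) ->
  (* (C4) *)
  (exists (c1 c2 u0 eps0 : R) (N : R -> nat) (Tc : R -> nat -> set T),
     [/\ 0 < c1, 0 < c2, 0 < u0 & 0 < eps0] /\
     (forall e, 0 < e <= eps0 -> [set: T] = \bigcup_(j in `I_(N e)) Tc e j) /\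
     (forall u e j, 0 < u <= u0 -> 0 < e <= eps0 -> (j < N e)%N ->
        (P ([set w | (u * expR (c1 * e ^+ 2) < sup [set Ufun P xi 0 w t | t in Tc e j])%R]
            `&` [set w | (inf [set Ufun P xi 0 w t | t in Tc e j] <= u)%R])
         <= (c2 * e ^+ 2)%R%:E * P [set w | (inf [set Ufun P xi 0 w t | t in Tc e j] <= u)%R])%E) /\
     (@lebesgue_measure R).-integrable `]0, eps0]
        (fun e => (Num.sqrt (ln (N e)%:R))%:E)) ->
  (0 < D)%N -> 0 < M ->
  (* conclusion *)
  (forall e, 0 < e -> exists (m : nat) (c : 'I_m -> Vt T D M),
      forall v, exists j, rho2 P xi v (c j) < e) /\
  exists (d' : measure_display) (Om' : measurableType d') (P' : probability Om' R)
         (W : Om' -> Vt T D M -> R),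
    [/\ (* W is a centered Gaussian process with covariance Rcov *)
        (forall v, measurable_fun setT (fun w => W w v)),
        (forall m (vs : 'I_m -> Vt T D M) (a : 'I_m -> R),
           (\int[P']_w (cos (\sum_(i < m) a i * W w (vs i)))%:E
              = (expR (- (\sum_(i < m) \sum_(j < m) a i * a j * Rcov P xi (vs i) (vs j)) / 2))%:E)%E
           /\ (\int[P']_w (sin (\sum_(i < m) a i * W w (vs i)))%:E = 0)%E),
        (* sample paths in l^oo(V), a.s. uniformly rho2-continuous *)
        (forall w, lbounded (W w)),
        (exists N : set Om', [/\ measurable N, P' N = 0%E &
           forall w, ~ N w -> forall e, 0 < e -> exists2 del, 0 < del &
             forall v1 v2, rho2 P xi v1 v2 < del -> `|W w v1 - W w v2| < e]) &
        (* W is Borel measurable into l^oo(V), and W_n ~> W (Hoffmann-Jorgensen) *)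
        (forall O, lopen O -> measurable [set w | O (W w)]) /\
        (forall h : (Vt T D M -> R) -> R, lbddfun h -> lcont h ->
           (fun n => outexp P (fun w => h (Wn P xi k n w))) @ \oo
             --> (\int[P']_w (h (W w))%:E)%E)].

Proof.
move=> _ cpt cxi mxi indep ident cF kr koo kn0 C3
  [c1 [c2 [u0 [eps0 [N [Tc [[c1p c2p u0p e0p] [Tcov [C4 intN]]]]]]]]] D0 M0.
have k0 n : (0 < n)%N -> 0 < k n by move=> /kr/andP[].
(* If [T] is empty then so is the index set, since every index has at least one coordinate; all
   functions on it coincide. *)
have [[t0 _]|T0] := pselect (exists t : T, True); last first.
  have V0 (v : Vt T D M) : False.
    case: v => -[vd' vt' vx'] [/= /andP[d0 _] _]; apply: T0.
    by exists (vt' (Ordinal d0)).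
  have I0 m (vs : 'I_m -> Vt T D M) (F : 'I_m -> R) : \sum_i F i = 0.
    by rewrite big1 // => i; case: (V0 (vs i)).
  have c0 : 'I_0 -> Vt T D M by case.
  pose f0 (v : Vt T D M) : R := 0.
  have ext (f : Vt T D M -> R) : f = f0 by apply/funext => v; case: (V0 v).
  split; first by move=> e e0; exists 0%N, c0 => v; case: (V0 v).
  exists d, Om, P, (fun _ => f0); split => //.
  - move=> m vs a; rewrite !(I0 _ vs) oppr0 mul0r expR0 cos0 sin0.
    by rewrite (ExE P (bmf_cst 1)) (ExE P (bmf_cst 0)) !Ex_cst.
  - by move=> _; exists 0 => v; case: (V0 v).
  - by exists set0; split => // w _ e e0; exists 1 => // v; case: (V0 v).
  split.
    move=> O _; have [Of|nO] := pselect (O f0).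
      by rewrite (_ : [set _ | _] = setT) //; apply/seteqP; split.
    by rewrite (_ : [set _ | _] = set0) //; apply/seteqP; split.
  move=> h _ _; rewrite (ExE P (bmf_cst (h f0))) Ex_cst.
  rewrite (_ : (fun n => _) = fun=> (h f0)%:E); first exact: cvg_cst.
  apply/funext => n; apply/eqP; rewrite eq_le -(Ex_cst P (h f0)).
  by rewrite outexp_le ?outexp_ge //; (try exact: bmf_cst) => w; rewrite (ext (Wn P xi k n w)).
pose V := Vt T D M.
pose r := sqdist (@Rcov _ _ _ P T xi D M).
have cov v w : (fun n => n%:R / k n * pr P (region P xi k n v 0%N `&` region P xi k n w 0%N)) @ \oo --> @Rcov _ _ _ P T xi D M v w.
  exact: (region_cov mxi cF kr kn0 C3).
have tb : forall e, 0 < e -> exists m (c : 'I_m -> V), forall v, exists j, r v (c j) < e.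
  by move=> e e0; exact: (region_tb cpt cxi mxi cF kr kn0 C3 c1p c2p u0p e0p Tcov C4 intN D0 M0 t0 e0).
have aec (eta eps : R) : 0 < eta -> 0 < eps -> exists2 Delta : R, 0 < Delta &
  \forall n \near \oo, exists Bd, [/\ measurable Bd, pr P Bd <= eps &
    forall w, ~ Bd w -> forall v v' : V, r v v' < Delta ->
      `|Dn P (k n) n (region P xi k n v) w - Dn P (k n) n (region P xi k n v') w| <= eta].
  by move=> h1 h2; exact: (region_aec cpt cxi mxi indep ident cF kr koo kn0 C3 c1p c2p u0p e0p Tcov C4 intN D0 M0 t0 h1 h2).
have oA n (v : V) : Obs xi (region P xi k n v) by exact: Obs_region.
have v1 : V := origin D0 M0 t0.
have [s sd] := dense_seq v1 tb.
(* One fixed coordinate [t0] of each path is enough, as the independence used is that across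
   observations. *)
pose z (x : R) := gaussq (1 - Fdist P (fun w' => xi 0%N w' t0) x).
have mz : measurable_fun setT z.
  exact: (measurableT_comp (measurable_quantile _) (measurable_Ucoord cF t0)).
pose Gs i j := Rcov P xi (s i) (s j).
have symG i j : Gs i j = Gs j i by exact: (covC cov).
have psdG l : 0 <= qform Gs l by exact: (cov_psd mxi k0 oA cov s).
pose Z := gseq xi t0 z Gs.
have mZ i : measurable_fun setT (Z i) by exact: measurable_gseq.
have chfZ m (i : 'I_m -> nat) a := gseq_chf mxi indep ident mz (gauss_coord_chf mxi cF t0) symG psdG i a.
pose W := lproc Z sd.
have mW v : measurable_fun setT (fun w => W w v) by exact: (measurable_lproc mxi k0 oA cov sd mZ).
have ucW w e : 0 < e -> exists2 D, 0 < D & forall v v', r v v' < D -> `|W w v - W w v'| <= e.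
  by move=> e0; exact: (lproc_uc mxi k0 oA cov Z sd w e0).
have bW w : lbounded (W w) by exact: (lproc_lbounded mxi k0 oA cov tb Z sd w).
have cW := lproc_chf mxi indep ident k0 koo kn0 oA cov aec sd mZ chfZ.
split.
  (* A net of radius [e^2] for the squared semimetric is a net of radius [e] for [rho2]. *)
  move=> e e0; have [m [c hc]] := tb _ (exprn_gt0 2 e0); exists m, c => v; have [j hj] := hc v.
  by exists j; rewrite rho2E -(ger0_norm (ltW e0)) -sqrtr_sqr ltr_sqrt // exprn_gt0.
exists d, Om, P, W; split => //.
- move=> m vs a; have [h1 h2] := cW m vs a.
  have b (f : R -> R) : continuous f -> (forall x, `|f x| <= 1) -> bmf (fun w => f (\sum_i a i * W w (vs i))).
    move=> cf f1; split; last by exists 1 => w; exact: f1.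
    apply: measurableT_comp; first exact: continuous_measurable_fun.
    exact: (measurable_sum_lin (X := fun j w => W w (vs j))).
  rewrite !ExE; last 2 first.
  - by apply: b; [exact: continuous_sin|move=> x; rewrite ler_norml sin_geN1 sin_le1].
  - by apply: b; [exact: continuous_cos|move=> x; rewrite ler_norml cos_geN1 cos_le1].
  by rewrite h1 h2.
(* The null set was already removed in [Zreg], so every path is uniformly continuous; halving [e]
   makes the inequality strict. *)
- exists set0; split => // w _ e e0; have [|D' D'0 hD] := ucW w (e / 2); first by rewrite divr_gt0.
  exists (Num.sqrt D'); first by rewrite sqrtr_gt0.
  move=> v w'; rewrite rho2E ltr_sqrt // => /hD h; lra.
split; first exact: (measurable_lopen v1 tb mW bW ucW).
move=> h hb hc.
pose X n w (v : V) := Dn P (k n) n (region P xi k n v) w.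
have mX n (v : V) : measurable_fun setT (fun w => X n w v) by have [] := bmf_Dn1 mxi indep ident k oA n v.
have bX n w : lbounded (X n w : V -> R).
  exists ((Num.sqrt (k n))^-1 * n%:R) => v; apply: Dn_bound; exact: Obs_measurable (oA n v).
have fidi m (vs : 'I_m -> V) g L C : lipf g L -> (forall x, `|g x| <= C) ->
    (fun n => Ex P (fun w => g (fun i => X n w (vs i)))) @ \oo --> Ex P (fun w => g (fun i => W w (vs i))).
  move=> gL gC; exact: (Dn_fidi mxi indep ident k0 koo kn0 oA cov (vs := vs) (Y := fun i w => W w (vs i)) (fun i => mW (vs i)) (cW m vs) gL gC).
have := outexp_cvg v1 tb mX bX mW bW ucW aec fidi hb hc.
apply: cvg_trans; apply: near_eq_cvg; near=> n.
have n0 : (0 < n)%N by near: n; exact: nbhs_infty_gt.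
by congr (outexp P _); apply/funext => w; congr h; apply/funext => v; rewrite Wn_Dn.
Unshelve. all: by end_near.
Qed.
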